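(* Let $(X,T)$ be a KTQ. The KTQ homology class in $H_2^N(X,T)$ of the cycle $c_D$ assigned to an oriented broken surface diagram $D$ in $\mathbb{R}^3$ colored by $(X,T)$ is invariant under Roseman moves. That is, if a colored diagram $D'$ is obtained from a colored diagram $D$ by a Roseman move, the colorings agreeing outside the ball where the move takes place, then $[c_D]=[c_{D'}]$ in $H_2^N(X,T)$.
   Context: A ternary quasigroup is a set $X$ with $T\colon X^3\to X$ such that in $T(x_1,x_2,x_3)=x_4$ any three of the elements determine the remaining one uniquely. A knot-theoretic ternary quasigroup (KTQ) is a ternary quasigroup satisfying, for all $a,b,c,d\in X$: (A1) $T(T(a,b,c),c,d)=T\big(T(a,b,T(b,c,d)),\,T(b,c,d),\,d\big)$; (A2) $T(a,b,T(b,c,d))=T\big(a,\,T(a,b,c),\,T(T(a,b,c),c,d)\big)$. $C_n(X)$ is the free $\mathrm{R}$-module ($\mathrm{R}$ a commutative unital ring) on $X^{n+2}$. For $n\ge 1$, $C_n^D(X,T)$ is its submodule generated by tuples $(x_0,\ldots,x_{n+1})$ with $x_{j+1}=T(x_j,x_{j+1},x_{j+2})$ for some $0\le j\le n-1$. $H_n^N(X,T)$ (KTQ homology) is the homology of the quotient complex $C_n^N=C_n/C_n^D$, with differential, in the relevant degrees (writing $abcT=T(a,b,c)$), $\partial_2(a,b,c,d)=(b,c,d)-(a,abcT,(abcT)cdT)-(abcT,c,d)+(a,b,bcdT)+(ab(bcdT)T,bcdT,d)-(a,b,c)$, $\partial_3(a,b,c,d,e)=(b,c,d,e)-(a,abcT,(abcT)cdT,[(abcT)cdT]deT)-(abcT,c,d,e)+(a,b,bcdT,(bcdT)deT)+(ab(bcdT)T,bcdT,d,e)-(a,b,c,cdeT)-(ab[bc(cdeT)T]T,bc(cdeT)T,cdeT,e)+(a,b,c,d)$.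 A (broken) surface diagram $D$ is the generic projection $p(S)\subset\mathbb{R}^3$ of a closed surface $S$ smoothly embedded in $\mathbb{R}^4$, with under-over information at double points. The closure of its double point set is a graph with vertices of degree $1$ (branch points) or $6$ (triple points), possibly with loops without vertices; edges and such loops are called double point edges. Roseman moves are the seven standard local moves on knotted surface diagrams. For oriented $S$, $p(S)$ is co-oriented off branch points by a normal $v$ such that $(v,v_1,v_2)$ matches the orientation of $\mathbb{R}^3$ whenever the tangent frame $(v_1,v_2)$ matches the orientation of $S$. Regions are the components of $\mathbb{R}^3-p(S)$. For a double point edge, the ascending path is $(r_1,r_2,r_3)$: $r_1$ is the source region (all co-orientation arrows at the edge point out of it), $r_1,r_2$ are separated by the under-sheet, $r_3$ is the target region (all arrows point into it); $r_4$ is the remaining region near the edge. A KTQ-coloring is a function $c$ from regions to $X$ with $c(r_4)=T(c(r_1),c(r_2),c(r_3))$ for each double point edge. At a triple point let $v_T,v_M,v_B$ be the co-orientation normals to the top, middle and bottom sheets. The triple point is positive if $(v_T,v_M,v_B)$ matches the right-hand orientation of $\mathbb{R}^3$, negative otherwise. Its ascending path is the sequence of regions $(r_0,r_1,r_2,r_3)$ near it, starting at the source region (all three normals point away from it), ending at the target region (all three normals point towards it), with $r_0,r_1$ separated by the bottom sheet, $r_1,r_2$ by the middle sheet, $r_2,r_3$ by the top sheet; its colored path is $(c(r_0),c(r_1),c(r_2),c(r_3))$. The chain $c_D$ is the sum of colored paths over all triple points, each taken with the sign of the triple point; it is a cycle in $C_2^N(X,T)$. *)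

(* Defs.v *)
From HB Require Import structures.
From mathcomp Require Import all_boot all_order all_fingroup all_algebra.
From mathcomp Require Import all_classical all_reals all_analysis.
From mathcomp Require Import freeg.

Set Implicit Arguments.
Unset Strict Implicit.
Unset Printing Implicit Defensive.

Import numFieldNormedType.Exports.
Import Order.TTheory GRing.Theory Num.Theory.
Local Open Scope classical_set_scope.
Local Open Scope ring_scope.

(** ** Knot-theoretic ternary quasigroups and their homology *)

Definition ternary_quasigroup (X : Type) (T : X -> X -> X -> X) : Prop :=
  [/\ forall b c d, exists! a, T a b c = d,
      forall a c d, exists! b, T a b c = d &
      forall a b d, exists! c, T a b c = d].

Definition KTQ (X : Type) (T : X -> X -> X -> X) : Prop :=
  [/\ ternary_quasigroup T,
      forall a b c d,
        T (T a b c) c d = T (T a b (T b c d)) (T b c d) d &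
      forall a b c d,
        T a b (T b c d) = T a (T a b c) (T (T a b c) c d)].

(* The chain module C_n(X) is {freeg (n.+2.-tuple X) / K}. *)

Definition degenerate (X : Type) (T : X -> X -> X -> X) (n : nat)
    (w : n.+2.-tuple X) : Prop :=
  let x j := nth (thead w) w j in
  exists2 j, (j < n)%N & x j.+1 = T (x j) (x j.+1) (x j.+2).

Definition degenerate_chain (X : choiceType) (K : comNzRingType)
    (T : X -> X -> X -> X) (n : nat) (z : {freeg (n.+2.-tuple X) / K}) : Prop :=
  exists2 s : seq ((K * n.+2.-tuple X)%type),
    forall p, p \in s -> degenerate T p.2 &
    z = \sum_(p <- s) p.1 *: << p.2 >>.

Definition boundary3_gen (X : choiceType) (K : comNzRingType)
    (T : X -> X -> X -> X) (w : 5.-tuple X) : {freeg (4.-tuple X) / K} :=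
  let a := tnth w (@Ordinal 5 0 isT) in let b := tnth w (@Ordinal 5 1 isT) in
  let c := tnth w (@Ordinal 5 2 isT) in let d := tnth w (@Ordinal 5 3 isT) in
  let e := tnth w (@Ordinal 5 4 isT) in
    << [tuple b; c; d; e] >>
  - << [tuple a; T a b c; T (T a b c) c d; T (T (T a b c) c d) d e] >>
  - << [tuple T a b c; c; d; e] >>
  + << [tuple a; b; T b c d; T (T b c d) d e] >>
  + << [tuple T a b (T b c d); T b c d; d; e] >>
  - << [tuple a; b; c; T c d e] >>
  - << [tuple T a b (T b c (T c d e)); T b c (T c d e); T c d e; e] >>
  + << [tuple a; b; c; d] >>.

Definition boundary3 (X : choiceType) (K : comNzRingType)
    (T : X -> X -> X -> X) (s : {freeg (5.-tuple X) / K}) :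
    {freeg (4.-tuple X) / K} :=
  fglift (@boundary3_gen X K T) s.

(* The class of a 2-chain z, as a coset of C_2^D + im d_3 in C_2.  When z is a
   cycle of C_2/C_2^D this coset consists of cycles, and it is the element of
   H_2^N = ker d_2 / im d_3 represented by z. *)
Definition homology_class (X : choiceType) (K : comNzRingType)
    (T : X -> X -> X -> X) (z : {freeg (4.-tuple X) / K}) :
    set {freeg (4.-tuple X) / K} :=
  [set z' | exists s : {freeg (5.-tuple X) / K},
              @degenerate_chain X K T 2 (z' - z - boundary3 T s)].

(** ** Smooth maps *)

(* C^oo on an open set A: all iterated directional derivatives are
   differentiable at the points of A. *)
Definition smooth_on (R : realType) (V W : normedModType R) (A : set V)
    (f : V -> W) : Prop :=
  forall (vs : seq V) (x : V), A x ->
    differentiable (foldr (fun v (g : V -> W) => 'D_v g) f vs) x.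

Definition diffeo (R : realType) (V W : normedModType R) (A : set V)
    (B : set W) (f : V -> W) (g : W -> V) : Prop :=
  [/\ open A /\ open B,
      forall x, A x -> B (f x) /\ g (f x) = x,
      forall y, B y -> A (g y) /\ f (g y) = y,
      smooth_on A f & smooth_on B g].

(* R^4 is written as R^3 * R; the projection R^4 -> R^3 is the first component
   and the second one is the height used for the under-over information. *)
Notation R2 R := ('rV[R]_2) (only parsing).
Notation R3 R := ('rV[R]_3) (only parsing).
Notation R4 R := (('rV[R]_3 * R^o)%type) (only parsing).

Definition vec3 (R : realType) (x y z : R) : R3 R :=
  \row_(i < 3) tnth [tuple x; y; z] i.

Definition dot (R : realType) (u v : R3 R) : R := \sum_(i < 3) u 0 i * v 0 i.

Definition det2 (R : realType) (v w : R2 R) : R :=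
  v 0 0 * w 0 1 - v 0 1 * w 0 0.

Definition det3 (R : realType) (u v w : R3 R) : R :=
  \det (\matrix_(i < 3) tnth [tuple u; v; w] i).

(** ** Closed oriented surfaces in R^4 and generic projections *)

(* f is a diffeomorphism from the open set W of R^2 onto S `&` O, in the sense
   that its inverse extends to a smooth map g on the open set O of R^4. *)
Definition chart (R : realType) (S : set (R4 R)) (W : set (R2 R))
    (O : set (R4 R)) (f : R2 R -> R4 R) (g : R4 R -> R2 R) : Prop :=
  [/\ open W /\ open O, f @` W = S `&` O, forall u, W u -> g (f u) = u,
      smooth_on W f & smooth_on O g].

(* frames x is the set of the tangent frames at x that match the orientation. *)
Record oriented_surface (R : realType) := OrientedSurface {
  carrier : set (R4 R);
  frames : R4 R -> set ((R4 R * R4 R)%type);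
  carrier_compact : compact carrier;
  carrier_smooth : forall x, carrier x ->
    exists (W : set (R2 R)) (O : set (R4 R)) (f : R2 R -> R4 R)
           (g : R4 R -> R2 R),
      [/\ chart carrier W O f g, (f @` W) x &
          forall u, W u ->
            frames (f u) =
            [set v | exists w1 w2 : R2 R,
               0 < det2 w1 w2 /\ v = ('d f u w1, 'd f u w2)]] }.

Definition fiber (R : realType) (S : oriented_surface R) (y : R3 R) :
    set (R4 R) :=
  [set x | carrier S x /\ x.1 = y].

Definition image3 (R : realType) (S : oriented_surface R) : set (R3 R) :=
  [set y | fiber S y !=set0].

(* v is a (not necessarily unit) co-orientation normal at the point x.1 of the
   sheet of the projection coming from x; it exists only if the projection is an
   immersion at x. *)
Definition conormal (R : realType) (S : oriented_surface R) (x : R4 R)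
    (v : R3 R) : Prop :=
  forall v1 v2 : R4 R, frames S x (v1, v2) ->
    [/\ dot v v1.1 = 0, dot v v2.1 = 0 & 0 < det3 v v1.1 v2.1].

(* k points over y, all in the immersive part, with linearly independent
   normals; hence k <= 3, and k = 0 when y is not in the image. *)
Definition transverse_at (R : realType) (S : oriented_surface R) (y : R3 R) :
    Prop :=
  exists (k : nat) (x : 'I_k -> R4 R) (N : 'M[R]_(k, 3)),
    [/\ injective x, fiber S y = range x,
        forall i, conormal S (x i) (row i N) & row_free N].

(* Whitney's normal form (a, b) |-> (a, b^2, a b) of the cross-cap. *)
Definition branch_at (R : realType) (S : oriented_surface R) (y : R3 R) :
    Prop :=
  exists x : R4 R, fiber S y = [set x] /\
  exists (W : set (R2 R)) (O : set (R4 R)) (f : R2 R -> R4 R)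
         (g : R4 R -> R2 R) (U V : set (R3 R)) (h h' : R3 R -> R3 R),
    [/\ chart (carrier S) W O f g, W 0 /\ f 0 = x, diffeo U V h h' &
        forall u, W u -> U (f u).1 /\
          h (f u).1 = vec3 (u 0 0) (u 0 1 ^+ 2) (u 0 0 * u 0 1)].

(* The broken surface diagram of a surface S consists of the generic projection
   of S, with its co-orientation, and the relative heights at double points. *)
Record diagram (R : realType) := Diagram {
  surface :> oriented_surface R;
  generic : forall y, transverse_at surface y \/ branch_at surface y }.

Definition simple_point (R : realType) (D : diagram R) (y v : R3 R) : Prop :=
  exists x : R4 R, fiber D y = [set x] /\ conormal D x v.

Definition double_point (R : realType) (D : diagram R) (y vO vU : R3 R) :
    Prop :=
  exists xO xU : R4 R,
    [/\ fiber D y = [set xO; xU], xU.2 < xO.2,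
        conormal D xO vO & conormal D xU vU].

Definition triple_point (R : realType) (D : diagram R) (y vT vM vB : R3 R) :
    Prop :=
  exists xT xM xB : R4 R,
    [/\ fiber D y = [set xT; xM; xB], xB.2 < xM.2 /\ xM.2 < xT.2,
        conormal D xT vT, conormal D xM vM & conormal D xB vB].

Definition same_diagram_at (R : realType) (D D' : diagram R) (y : R3 R) :
    Prop :=
  [/\ image3 D y <-> image3 D' y,
      forall v, simple_point D y v <-> simple_point D' y v,
      forall v w, double_point D y v w <-> double_point D' y v w &
      forall u v w, triple_point D y u v w <-> triple_point D' y u v w].

(** ** Regions, colorings and the chain of a colored diagram *)

Definition region (R : realType) (D : diagram R) (z : R3 R) : set (R3 R) :=
  connected_component (~` image3 D) z.

(* r is the region near y lying on the positive side of the sheets with normal v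
   for (v, true) in N, and on the negative side for (v, false) in N. *)
Definition region_near (R : realType) (D : diagram R) (y : R3 R)
    (N : seq ((R3 R * bool)%type)) (r : set (R3 R)) : Prop :=
  exists2 u : R3 R,
    all (fun vb => if vb.2 then 0 < dot u vb.1 else dot u vb.1 < 0) N &
    \forall e \near (0 : R)^'+,
      ~ image3 D (y + e *: u) /\ region D (y + e *: u) = r.

(* A coloring is a function on regions; its values at other sets of points are
   irrelevant. *)
Definition coloring (R : realType) (X : Type) (T : X -> X -> X -> X)
    (D : diagram R) (c : set (R3 R) -> X) : Prop :=
  forall (y vO vU : R3 R) (r1 r2 r3 r4 : set (R3 R)),
    double_point D y vO vU ->
    region_near D y [:: (vU, false); (vO, false)] r1 ->
    region_near D y [:: (vU, true);  (vO, false)] r2 ->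
    region_near D y [:: (vU, true);  (vO, true)]  r3 ->
    region_near D y [:: (vU, false); (vO, true)]  r4 ->
    c r4 = T (c r1) (c r2) (c r3).

(* The triple points y of D, each with its sign and its colored path. *)
Definition colored_triple_points (R : realType) (X : choiceType)
    (D : diagram R) (c : set (R3 R) -> X) :
    set ((R3 R * bool * 4.-tuple X)%type) :=
  [set t | exists (vT vM vB : R3 R) (r0 r1 r2 r3 : set (R3 R)),
    [/\ triple_point D t.1.1 vT vM vB,
        t.1.2 = (0 < det3 vT vM vB),
        region_near D t.1.1 [:: (vB, false); (vM, false); (vT, false)] r0 /\
        region_near D t.1.1 [:: (vB, true);  (vM, false); (vT, false)] r1,
        region_near D t.1.1 [:: (vB, true);  (vM, true);  (vT, false)] r2 /\
        region_near D t.1.1 [:: (vB, true);  (vM, true);  (vT, true)]  r3 &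
        t.2 = [tuple c r0; c r1; c r2; c r3]]].

Definition diagram_chain (R : realType) (K : comNzRingType) (X : choiceType)
    (D : diagram R) (c : set (R3 R) -> X) : {freeg (4.-tuple X) / K} :=
  \sum_(t \in colored_triple_points D c)
    ((if t.1.2 then 1 else -1) *: << t.2 >> : {freeg (4.-tuple X) / K}).

(** ** Roseman moves *)

(* In the order of the constructors: birth of two branch points joined by a
   double arc; the saddle exchanging two double arcs ending at branch points and
   one double arc without branch points; birth of a double circle; saddle between
   two double arcs; birth of a pair of triple points, when a sheet is pushed
   through a double arc; a branch point passing through a sheet; a sheet passing
   through a triple point (tetrahedral move). *)
Inductive roseman :=
  | BranchBubble | BranchSaddle | DoubleBubble | DoubleSaddle
  | TriplePair | BranchPass | Tetrahedral.

Definition nb_sheets (m : roseman) : nat :=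
  match m with
  | BranchBubble | BranchSaddle => 1
  | DoubleBubble | DoubleSaddle | BranchPass => 2
  | TriplePair => 3
  | Tetrahedral => 4
  end.

(* The sheets f_j^t : R^2 -> R^3 of the generic one-parameter unfolding of the
   codimension one singularity of the move.  The two sides of the move are t < 0
   and t > 0 near the origin; t is made to depend on the point of the sheet, so
   that both sides coincide away from the origin.  The last sheet is
   x + y = z^2 - t for TriplePair, x + y = t for BranchPass and x + y + z = t for
   Tetrahedral. *)
Definition model_sheet (R : realType) (m : roseman) (j : nat) (t : R)
    (u : R2 R) : R3 R :=
  let a := u 0 0 in let b := u 0 1 in
  match m, j with
  | BranchBubble, _ => vec3 a (b ^+ 2) (b * (b ^+ 2 + a ^+ 2 - t))
  | BranchSaddle, _ => vec3 a (b ^+ 2) (b * (b ^+ 2 - a ^+ 2 - t))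
  | DoubleBubble, 0%N => vec3 a b 0
  | DoubleBubble, _ => vec3 a b (a ^+ 2 + b ^+ 2 - t)
  | DoubleSaddle, 0%N => vec3 a b 0
  | DoubleSaddle, _ => vec3 a b (a ^+ 2 - b ^+ 2 - t)
  | TriplePair, 0%N => vec3 0 a b
  | TriplePair, 1%N => vec3 a 0 b
  | TriplePair, _ => vec3 ((b ^+ 2 - t + a) / 2) ((b ^+ 2 - t - a) / 2) b
  | BranchPass, 0%N => vec3 a (b ^+ 2) (a * b)
  | BranchPass, _ => vec3 ((t + a) / 2) ((t - a) / 2) b
  | Tetrahedral, 0%N => vec3 0 a b
  | Tetrahedral, 1%N => vec3 a 0 b
  | Tetrahedral, 2%N => vec3 a b 0
  | Tetrahedral, _ => vec3 (t / 3 + a) (t / 3 + b) (t / 3 - a - b)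
  end.

Definition bump (R : realType) (beta : R^o -> R^o) : Prop :=
  [/\ smooth_on setT beta, 0 < beta 0 <= 1,
      forall s t : R, 0 <= s -> s <= t -> beta t <= beta s &
      forall t : R, 1 <= t -> beta t = 0].

Definition side_sheet (R : realType) (beta : R^o -> R^o) (m : roseman)
    (side : bool) (j : 'I_(nb_sheets m)) (u : R2 R) : R3 R :=
  let t := beta (u 0 0 ^+ 2 + u 0 1 ^+ 2) in
  model_sheet m j (if side then t else - t) u.

(* The under-over information of a model: distinct sheets are ordered by rk,
   and along the self-crossings of a cross-cap sheet, where the two preimages are
   (a, b) and (a, - b), the upper one is that with b > 0 or with b < 0 according
   to sg. *)
Definition above (R : realType) (k : nat) (rk : {perm 'I_k}) (sg : bool)
    (j : 'I_k) (u : R2 R) (j' : 'I_k) (u' : R2 R) : Prop :=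
  if j == j' then 0 < (-1) ^+ sg * (u 0 1 - u' 0 1)
  else (rk j' < rk j)%N.

(* Over U, and in the coordinates h : U -> V with inverse h', the diagram D
   consists of the sheets f_j, lifted to R^4 by F_j; eps j tells whether the
   orientation of F_j is reversed. *)
Definition modeled (R : realType) (D : diagram R) (U V : set (R3 R))
    (h' : R3 R -> R3 R) (k : nat) (f : 'I_k -> R2 R -> R3 R)
    (rk : {perm 'I_k}) (sg : bool) (eps : 'I_k -> bool) : Prop :=
  exists F : 'I_k -> R2 R -> R4 R,
  [/\ forall j u, V (f j u) ->
        carrier D (F j u) /\ (F j u).1 = h' (f j u),
      forall x, carrier D x -> U x.1 ->
        exists! ju, V (f ju.1 ju.2) /\ F ju.1 ju.2 = x,
      forall j, smooth_on (f j @^-1` V) (F j),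
      forall j u, V (f j u) -> frames D (F j u) =
        [set v | exists w1 w2 : R2 R,
           0 < (-1) ^+ eps j * det2 w1 w2 /\
           v = ('d (F j) u w1, 'd (F j) u w2)] &
      forall j u j' u', V (f j u) -> f j u = f j' u' ->
        above rk sg j u j' u' -> (F j' u').2 < (F j u).2].

(* D' is obtained from D by a Roseman move, in either direction, inside B; here
   B is carried to the closed Euclidean ball of radius 3 by a diffeomorphism h
   between neighbourhoods, and the two sides of all models coincide outside this
   ball. *)
Definition roseman_move (R : realType) (D D' : diagram R) (B : set (R3 R)) :
    Prop :=
  exists (m : roseman) (side : bool) (beta : R^o -> R^o)
         (rk : {perm 'I_(nb_sheets m)}) (sg : bool) (eps : 'I_(nb_sheets m) -> bool)
         (U V : set (R3 R)) (h h' : R3 R -> R3 R),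
    [/\ bump beta,
        diffeo U V h h' /\
        ([set q | dot q q <= 9] `<=` V /\ B = h' @` [set q | dot q q <= 9]),
        modeled D U V h' (@side_sheet R beta m side) rk sg eps,
        modeled D' U V h' (@side_sheet R beta m (~~ side)) rk sg eps &
        forall y, ~ B y -> same_diagram_at D D' y].

(* Main.v *)
Require Import Defs.
From HB Require Import structures.
From mathcomp Require Import all_boot all_order all_fingroup all_algebra.
From mathcomp Require Import all_classical all_reals all_analysis.
From mathcomp Require Import freeg.
From mathcomp Require Import ring lra.
Set Implicit Arguments.
Unset Strict Implicit.
Unset Printing Implicit Defensive.
Import numFieldNormedType.Exports.
Import Order.TTheory GRing.Theory Num.Theory.
Local Open Scope classical_set_scope.
Local Open Scope ring_scope.

(** The chain of a diagram is a sum over its triple points.  Outside the ball of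
    the move the two diagrams have the same triple points, with the same signs,
    and the regions near them have the same colors; so the difference of the two
    chains only involves the triple points inside the ball ([move_homologous]).
    There both diagrams are images, under a diffeomorphism, of explicit sheets,
    and three facts translate the geometry into algebra.  The color of a point
    off the sheets does not change along a path off the sheets
    ([modeled_path]); in each model this makes it, near the crossings, a function
    of the sides of the sheets on which the point lies.  At a double point the
    four adjacent colors satisfy the coloring rule ([modeled_double]).  At a
    triple point the sign is that of the determinant of the gradients of the
    co-oriented equations of the sheets, up to the reversed orientations, and the
    colored path is read off from the adjacent colors ([modeled_triple]).

    Four of the seven moves create no triple point ([no_triple_homologous]).

    When a sheet is pushed through a double arc, two triple points appear, at
    opposite heights on this arc.  The third sheet crosses the arc in opposite
    directions at these points, whence opposite signs.  Seven of the eight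
    regions around one point are also adjacent to the other one, and the eighth
    color is determined by three others because T is a quasigroup operation
    ([pair_col_indep]); so the colored paths agree and the two terms cancel
    ([pair_homologous]).

    When a branch point passes through a sheet, one triple point appears.  The two
    sectors between the branches of the cross-cap are the same region on the side
    of the pinch point, and their colors on the other side of the sheet agree by
    the quasigroup property ([sector_color]).  The branches are consecutive in
    height, so the colored path crosses one after the other, and the coloring rule
    at the double line says that it is degenerate ([pass_path],
    [pass_homologous]).

    In the tetrahedral move four sheets meet pairwise in all ways, and their sides
    give 16 sign patterns.  Each of the two diagrams has a region for 15 of them;
    the patterns missing on the two sides are opposite, and the 14 common ones are
    seen on the boundary of the ball, where the colorings agree.  Gluing the two
    colorings gives a function on the vertices of a four-dimensional cube which
    satisfies the coloring rule on all its square faces ([glue_face]).  The eight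
    terms of the boundary of the main path of this cube are the colored paths of
    its eight facets ([cube_boundary]); four of them are the triple points of one
    diagram and the opposite four are those of the other one, and the signs match
    since the determinants of the normals alternate ([tetra_sign_const],
    [rank_sign_const]).  So the difference of the chains is a boundary
    ([tetra_homologous]). *)

(** * Vectors of three-space *)

Section Space.
Variable R : realType.
Implicit Types u v w a b : 'rV[R]_3.

Lemma vec3E0 (x y z : R) : vec3 x y z 0 0 = x. Proof. by rewrite mxE. Qed.
Lemma vec3E1 (x y z : R) : vec3 x y z 0 1 = y. Proof. by rewrite mxE. Qed.
Lemma vec3E2 (x y z : R) : vec3 x y z 0 2 = z. Proof. by rewrite mxE. Qed.
Definition vec3E := (vec3E0, vec3E1, vec3E2).

Lemma vec3_ext u v :
  u 0 0 = v 0 0 -> u 0 1 = v 0 1 -> u 0 2 = v 0 2 -> u = v.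
Proof.
move=> e0 e1 e2; apply/rowP => -[[|[|[|//]]] i3].
- by rewrite (_ : Ordinal i3 = 0) //; apply: val_inj.
- by rewrite (_ : Ordinal i3 = 1) //; apply: val_inj.
- by rewrite (_ : Ordinal i3 = 2) //; apply: val_inj.
Qed.

Lemma vec2_ext (u v : 'rV[R]_2) : u 0 0 = v 0 0 -> u 0 1 = v 0 1 -> u = v.
Proof.
move=> e0 e1; apply/rowP => -[[|[|//]] i2].
- by rewrite (_ : Ordinal i2 = 0) //; apply: val_inj.
- by rewrite (_ : Ordinal i2 = 1) //; apply: val_inj.
Qed.

Lemma dotE u v : dot u v = u 0 0 * v 0 0 + u 0 1 * v 0 1 + u 0 2 * v 0 2.
Proof.
rewrite /dot !big_ord_recl big_ord0 addr0 addrA.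
by congr (_ + _ * _ + _ * _); congr (_ 0 _); apply: val_inj.
Qed.

Lemma det3E u v w : det3 u v w =
  u 0 0 * (v 0 1 * w 0 2 - v 0 2 * w 0 1)
  - u 0 1 * (v 0 0 * w 0 2 - v 0 2 * w 0 0)
  + u 0 2 * (v 0 0 * w 0 1 - v 0 1 * w 0 0).
Proof.
rewrite /det3 (expand_det_row _ 0) !big_ord_recl big_ord0 /cofactor.
rewrite !(expand_det_row _ 0) !big_ord_recl !big_ord0 /cofactor !det_mx11 !mxE.
pose co (x : 'rV[R]_3) (i : nat) := x 0 (inord i).
have E (x : 'rV[R]_3) i : x 0 i = co x i by rewrite /co inord_val.
rewrite !(tnth_nth 0) !E /= /bump /=.
ring.
Qed.

Lemma det3M (A : 'M[R]_3) u v w :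
  det3 (u *m A) (v *m A) (w *m A) = det3 u v w * \det A.
Proof.
rewrite /det3 -det_mulmx; congr (\det _); apply/row_matrixP => i.
rewrite row_mul !rowK.
by case: i => -[|[|[|//]]] i3; rewrite !(tnth_nth 0).
Qed.

Lemma dot_ge0 v : 0 <= dot v v.
Proof. rewrite dotE; nra. Qed.

Lemma dot_eq0 v : dot v v = 0 -> v = 0.
Proof.
rewrite dotE => v0.
by apply: vec3_ext; rewrite mxE; nra.
Qed.

Lemma dotDr u v w : dot u (v + w) = dot u v + dot u w.
Proof. rewrite !dotE !mxE; ring. Qed.

Lemma dotZr k u v : dot u (k *: v) = k * dot u v.
Proof. rewrite !dotE !mxE; ring. Qed.

Lemma dotC u v : dot u v = dot v u.
Proof. rewrite !dotE; ring. Qed.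

(** A vector orthogonal to [a] and [b] is a multiple of their cross product; this
    form of that fact needs no division. *)
Lemma orth_cross u v a b : dot v a = 0 -> dot v b = 0 ->
  dot v v * det3 u a b = dot v u * det3 v a b.
Proof.
move=> va vb.
have : dot v v * det3 u a b = dot v u * det3 v a b
   + dot v a * det3 u v b + dot v b * det3 u a v by rewrite !dotE !det3E; ring.
by rewrite va vb !mul0r !addr0.
Qed.

(** The vector representing the linear form [det3 _ a b]. *)
Definition cross a b : 'rV[R]_3 := vec3 (det3 (vec3 1 0 0) a b)
  (det3 (vec3 0 1 0) a b) (det3 (vec3 0 0 1) a b).

Lemma dot_cross u a b : dot u (cross a b) = det3 u a b.
Proof. rewrite /cross dotE !det3E !vec3E; ring. Qed.

Lemma det3_plane u a b (x y : 'rV[R]_2) :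
  det3 u (x 0 0 *: a + x 0 1 *: b) (y 0 0 *: a + y 0 1 *: b) =
  det2 x y * det3 u a b.
Proof. rewrite /det2 !det3E !mxE; ring. Qed.

(** The determinant of the matrix product of the rows [a, b, c] with the columns
    [u, v, w]. *)
Lemma det3_gram a b c u v w : det3 a b c * det3 u v w =
  det3 (vec3 (dot a u) (dot a v) (dot a w)) (vec3 (dot b u) (dot b v) (dot b w))
       (vec3 (dot c u) (dot c v) (dot c w)).
Proof. rewrite !det3E !vec3E !dotE; ring. Qed.

End Space.

(** * Differentials and diffeomorphisms *)

Section Calculus.
Variable R : realType.

Lemma near_diff_eq (V W : normedModType R) (f g : V -> W) (x v : V) :
  (\near x, f x = g x) -> differentiable f x -> differentiable g x ->
  'd f x v = 'd g x v.
Proof. by move=> fg df dg; rewrite -!deriveE //; exact: near_eq_derive. Qed.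

(** The difference quotient along [u] tends to a positive number. *)
Lemma ray_pos (V : normedModType R) (g : V -> R^o) (y u : V) :
  differentiable g y -> g y = 0 -> 0 < ('d g y u : R) ->
  \forall e \near (0 : R)^'+, 0 < (g (y + e *: u) : R).
Proof.
move=> dg gy d0.
have : (fun e : R => e^-1 *: (g (e *: u + y) - g y) : R^o) @ 0^' --> 'D_u g y.
  exact: diff_derivable.
rewrite deriveE // => /cvg_dnbhs_at_right /cvgr_gt /(_ _ d0) H.
near=> e.
have e0 : 0 < e by near: e; exact: nbhs_right_gt.
have : 0 < (e^-1 *: (g (e *: u + y) - g y) : R) by near: e; exact: H.
by rewrite gy subr0 addrC /GRing.scale /= pmulr_rgt0 // invr_gt0.
Unshelve. all: by end_near. Qed.

Lemma smooth_differentiable (V W : normedModType R) (A : set V) (f : V -> W) x :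
  smooth_on A f -> A x -> differentiable f x.
Proof. by move=> sf Ax; exact: (sf [::] x Ax). Qed.

Lemma smooth_derive_continuous (V W : normedModType R) (A : set V)
    (f : V -> W) x v :
  smooth_on A f -> A x -> {for x, continuous ('D_v f)}.
Proof.
by move=> sf Ax; apply: differentiable_continuous; exact: (sf [:: v] x Ax).
Qed.

Lemma continuous_sum3 (T : topologicalType) (x : T) (f : T -> 'rV[R]_3) i :
  {for x, continuous f} -> {for x, continuous (fun t => f t 0 i : R)}.
Proof.
move=> fx; apply: (@continuous_comp _ _ _ f (fun z : 'rV[R]_3 => z 0 i)).
  exact: fx.
exact: coord_continuous.
Qed.

End Calculus.

Section Diffeo.
Variables (R : realType) (U V : set 'rV[R]_3) (h h' : 'rV[R]_3 -> 'rV[R]_3).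
Hypothesis hh : diffeo U V h h'.
Implicit Types p w : 'rV[R]_3.

Lemma diffeo_inv : diffeo V U h' h.
Proof. by case: hh => -[? ?] ? ? ? ?; split. Qed.

Lemma diffeo_dif p : V p -> differentiable h' p.
Proof. by case: hh => _ _ _ _ s; exact: smooth_differentiable. Qed.

(** The chain rule for [h \o h' = id]. *)
Lemma diffeo_dK p w : V p -> 'd h (h' p) ('d h' p w) = w.
Proof.
case: hh => -[oU oV] _ VU sh sh' Vp.
have dh' : differentiable h' p by exact: (smooth_differentiable sh').
have dh : differentiable h (h' p).
  by apply: (smooth_differentiable sh); case: (VU _ Vp).
have <- : 'd (h \o h') p w = 'd h (h' p) ('d h' p w).
  exact: (congr1 (fun F : _ -> _ => F w) (diff_comp dh' dh)).
rewrite (@near_diff_eq _ _ _ (h \o h') id p w).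
- by rewrite diff_val.
- near=> q; rewrite /=; apply: (VU _ _).2; near: q; exact: open_nbhs_nbhs.
- exact: differentiable_comp.
- exact: ex_diff.
Unshelve. all: by end_near. Qed.

Definition jac p : 'M[R]_3 := jacobian h' p.

Lemma jacE p w : 'd h' p w = w *m jac p.
Proof. by rewrite mul_rV_lin1. Qed.

Lemma det_jac p : \det (jac p) =
  det3 ('d h' p (vec3 1 0 0)) ('d h' p (vec3 0 1 0)) ('d h' p (vec3 0 0 1)).
Proof. by rewrite !jacE det3M !det3E !vec3E; ring. Qed.
End Diffeo.

Section DiffeoSign.
Variables (R : realType) (U V : set 'rV[R]_3) (h h' : 'rV[R]_3 -> 'rV[R]_3).
Hypothesis hh : diffeo U V h h'.
Implicit Types p w : 'rV[R]_3.

Lemma det_jac_neq0 p : V p -> \det (jac h' p) != 0.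
Proof.
move=> Vp; have : jac h' p *m jac h (h' p) = 1%:M.
  apply/row_matrixP => i.
  by rewrite !rowE mulmxA -!jacE (diffeo_dK hh) // mulmx1.
move=> /(congr1 determinant); rewrite det_mulmx det1 => e.
apply/negP => /eqP d0.
move: e.
rewrite [X in X * _]d0.
rewrite mul0r.
move/esym/eqP.
by rewrite oner_eq0.
Qed.

(** The determinant is a polynomial in directional derivatives of a smooth map. *)
Lemma det_jac_continuous p : V p -> {for p, continuous (fun q => \det (jac h' q))}.
Proof.
move=> Vp.
have [[_ oV] _ _ _ sh'] := hh.
pose d i (q : 'rV[R]_3) := 'D_(tnth [tuple vec3 1 0 0; vec3 0 1 0; vec3 0 0 1] i) h' q.
have dc i j : {for p, continuous (fun q => d i q 0 j : R)}.
  by apply: continuous_sum3; exact: smooth_derive_continuous sh' Vp.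
pose E (q : 'rV[R]_3) : R := d 0 q 0 0 * (d 1 q 0 1 * d 2 q 0 2 - d 1 q 0 2 * d 2 q 0 1)
  - d 0 q 0 1 * (d 1 q 0 0 * d 2 q 0 2 - d 1 q 0 2 * d 2 q 0 0)
  + d 0 q 0 2 * (d 1 q 0 0 * d 2 q 0 1 - d 1 q 0 1 * d 2 q 0 0).
have e : \forall q \near p, E q = \det (jac h' q).
  near=> q; have Vq : V q by near: q; exact: open_nbhs_nbhs.
  by rewrite det_jac /E /d !deriveE //; [rewrite det3E | exact: (diffeo_dif hh) ..].
have M2 (a b : 'rV[R]_3 -> R) : {for p, continuous a} ->
    {for p, continuous b} -> {for p, continuous (fun q => a q * b q)}.
  by move=> ca cb; exact: continuousM.
have B2 (a b : 'rV[R]_3 -> R) : {for p, continuous a} ->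
    {for p, continuous b} -> {for p, continuous (fun q => a q - b q)}.
  by move=> ca cb; exact: (@continuousB R R^o).
have D2 (a b : 'rV[R]_3 -> R) : {for p, continuous a} ->
    {for p, continuous b} -> {for p, continuous (fun q => a q + b q)}.
  by move=> ca cb; exact: (@continuousD R R^o).
have Ec : E @ p --> E p.
  exact: (D2 _ _ (B2 _ _
    (M2 _ _ (dc 0 0) (B2 _ _ (M2 _ _ (dc 1 1) (dc 2 2)) (M2 _ _ (dc 1 2) (dc 2 1))))
    (M2 _ _ (dc 0 1) (B2 _ _ (M2 _ _ (dc 1 0) (dc 2 2)) (M2 _ _ (dc 1 2) (dc 2 0)))))
    (M2 _ _ (dc 0 2) (B2 _ _ (M2 _ _ (dc 1 0) (dc 2 1)) (M2 _ _ (dc 1 1) (dc 2 0))))).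
have e0 : E p = \det (jac h' p) by exact: (nbhs_singleton e).
suff : (fun q => \det (jac h' q)) @ p --> E p by rewrite e0.
exact: (cvg_trans (near_eq_cvg e) Ec).
Unshelve. all: by end_near. Qed.

End DiffeoSign.

(** Intermediate values along the segment joining the two points. *)
Lemma nonvanishing_sign (R : realType) (m : 'rV[R]_3 -> R) (S : set 'rV[R]_3) :
  (forall p, S p -> {for p, continuous m}) -> (forall p, S p -> m p != 0) ->
  (forall p q (t : R), S p -> S q -> 0 <= t <= 1 -> S (p + t *: (q - p))) ->
  forall p q, S p -> S q -> (m p < 0) = (m q < 0).
Proof.
move=> mc m0 cS.
suff H p q : S p -> S q -> m p < 0 -> m q < 0.
  by move=> p q Sp Sq; apply/idP/idP; exact: H.
move=> Sp Sq p0; rewrite ltNge; apply/negP => q0.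
pose f (t : R) := m (p + t *: (q - p)) : R.
have f0 : f 0 = m p by rewrite /f scale0r addr0.
have f1 : f 1 = m q by rewrite /f scale1r subrKC.
have [||t t01 ft] := @IVT R f 0 1 0 ler01 _ _.
- apply: continuous_in_subspaceT => t; rewrite inE /= in_itv /= => t01.
  apply: (@continuous_comp _ _ _ (fun t : R => p + t *: (q - p)) m).
    apply: cvgD; first exact: cvg_cst.
    by apply: cvgZr_tmp; exact: cvg_id.
  by apply: mc; exact: cS.
- by rewrite f0 f1 ge_min le_max (ltW p0) q0 orbT.
have /negP := m0 (p + t *: (q - p)) (cS _ _ _ Sp Sq t01); apply.
by rewrite -/(f t) ft.
Qed.

(** * Regions, double points and triple points in a model *)

(** The sign is a boolean parameter, so that the sides of sheets can be computed
    with. *)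
Definition pos_if (R : realType) (b : bool) (x : R) : bool :=
  if b then 0 < x else x < 0.

Lemma pos_ifE (R : realType) b (x : R) :
  pos_if b x = (x != 0) && ((0 < x) == b).
Proof. by case: b; rewrite /pos_if; case: ltgtP. Qed.

Lemma pos_ifN (R : realType) b (x : R) : pos_if b (- x) = pos_if (~~ b) x.
Proof. by case: b; rewrite /pos_if ?oppr_gt0 ?oppr_lt0. Qed.

Lemma pos_ifM (R : realType) b (k x : R) : k != 0 ->
  pos_if b (k * x) = pos_if (b (+) (k < 0)) x.
Proof.
move=> k0; have [kn|kp|ke] := ltgtP k 0; last by rewrite ke eqxx in k0.
  by case: b; rewrite /pos_if /= ?nmulr_rgt0 ?nmulr_rlt0.
by case: b; rewrite /pos_if /= ?pmulr_rgt0 ?pmulr_rlt0.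
Qed.

Lemma pos_if_sgn (R : realType) (b e : bool) (x : R) :
  pos_if b ((-1) ^+ e * x) = pos_if (b (+) e) x.
Proof. by case: e; rewrite ?expr1 ?expr0 ?mulN1r ?mul1r ?pos_ifN ?addbT ?addbF. Qed.

Lemma pos_if_conv (R : realType) b (x y t : R) : pos_if b x -> pos_if b y ->
  0 <= t <= 1 -> pos_if b (x + t * (y - x)).
Proof.
case: b; rewrite /pos_if => x0 y0 /andP[t0 t1].
  have -> : x + t * (y - x) = (1 - t) * x + t * y by ring.
  have [->|t0'] := eqVneq t 0; first by rewrite subr0 mul1r mul0r addr0.
  by rewrite ltr_wpDl ?mulr_ge0 ?subr_ge0 ?(ltW x0) // mulr_gt0 // lt0r t0' t0.
have -> : x + t * (y - x) = (1 - t) * x + t * y by ring.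
have [->|t0'] := eqVneq t 0; first by rewrite subr0 mul1r mul0r addr0.
rewrite -oppr_gt0 opprD -!mulrN ltr_wpDl ?mulr_ge0 ?subr_ge0 ?oppr_ge0 ?(ltW x0) //.
by rewrite mulr_gt0 ?oppr_gt0 // lt0r t0' t0.
Qed.

Lemma pos_if_pmul (R : realType) b (k x : R) : 0 < k -> pos_if b (k * x) = pos_if b x.
Proof. by move=> k0; rewrite pos_ifM ?gt_eqF // (lt_gtF k0) addbF. Qed.

Section Regions.
Variables (R : realType) (D : diagram R).
Implicit Types (y u : 'rV[R]_3).

(** The path is a connected set off the image. *)
Lemma region_path (y : R -> 'rV[R]_3) (a b : R) : a <= b ->
  {within `[a, b], continuous y} ->
  (forall t : R, a <= t <= b -> ~ image3 D (y t)) ->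
  region D (y a) = region D (y b).
Proof.
move=> ab cy ny; apply: same_connected_component.
apply: (@connected_component_max _ _ (y @` `[a, b])).
- by exists a => //=; rewrite in_itv /= lexx.
- by move=> _ [t /= + <-]; rewrite in_itv /=; exact: ny.
- apply: connected_continuous_connected cy; exact: segment_connected.
- by exists b => //=; rewrite in_itv /= lexx andbT.
Qed.

(** A short open ray off the image is connected, hence stays in one region. *)
Lemma region_ray y u : (\forall e \near (0 : R)^'+, ~ image3 D (y + e *: u)) ->
  exists r, \forall e \near (0 : R)^'+,
    ~ image3 D (y + e *: u) /\ region D (y + e *: u) = r.
Proof.
move=> /[dup] H [e0 /= e0_gt0 He].
have Hi e : 0 < e < e0 -> ~ image3 D (y + e *: u).
  move=> /andP[e1 e2]; apply: He => //=.
  by rewrite sub0r normrN gtr0_norm.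
exists (region D (y + (e0 / 2) *: u)); near=> e; split; first by near: e.
have e1 : 0 < e by near: e; exact: nbhs_right_gt.
have e2 : e < e0 / 2 by near: e; apply: nbhs_right_lt; rewrite divr_gt0.
apply: (@region_path (fun t => y + t *: u)); first exact: ltW.
  apply: continuous_subspaceT => t.
  by apply: cvgD; [exact: cvg_cst | apply: cvgZr_tmp; exact: cvg_id].
by move=> t /andP[t1 t2]; apply: Hi; lra.
Unshelve. all: by end_near. Qed.

End Regions.

(** The differential of [g], represented as a vector through the scalar product. *)
Definition grad (R : realType) (g : 'rV[R]_3 -> R^o) (p : 'rV[R]_3) : 'rV[R]_3 :=
  vec3 ('d g p (vec3 1 0 0) : R) ('d g p (vec3 0 1 0) : R) ('d g p (vec3 0 0 1) : R).

Lemma gradE (R : realType) (g : 'rV[R]_3 -> R^o) (p w : 'rV[R]_3) :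
  'd g p w = dot (grad g p) w.
Proof.
rewrite {1}(_ : w = w 0 0 *: vec3 1 0 0 + w 0 1 *: vec3 0 1 0 + w 0 2 *: vec3 0 0 1).
  rewrite !linearD !linearZ /grad dotE !vec3E /=.
  by rewrite /GRing.scale /=; ring.
by apply: vec3_ext; rewrite !mxE /= !(tnth_nth 0) /=; ring.
Qed.

Lemma dot_basis (R : realType) (a : 'rV[R]_3) :
  vec3 (dot a (vec3 1 0 0)) (dot a (vec3 0 1 0)) (dot a (vec3 0 0 1)) = a.
Proof. by apply: vec3_ext; rewrite vec3E !dotE !vec3E; ring. Qed.

Lemma det3_scale (R : realType) (k1 k2 k3 : R) (a b c : 'rV[R]_3) :
  let r k x := vec3 (k * dot x (vec3 1 0 0)) (k * dot x (vec3 0 1 0))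
    (k * dot x (vec3 0 0 1)) in
  det3 (r k1 a) (r k2 b) (r k3 c) = k1 * k2 * k3 * det3 a b c.
Proof.
rewrite /= -[in RHS](dot_basis a) -[in RHS](dot_basis b) -[in RHS](dot_basis c).
by rewrite !det3E !vec3E; ring.
Qed.

(** [g] is a local equation of the sheet [f] near [f u], and its gradient is a
    positive multiple of the normal that orients [f]. *)
Definition co_oriented (R : realType) (f : 'rV[R]_2 -> 'rV[R]_3)
    (u : 'rV[R]_2) (g : 'rV[R]_3 -> R^o) : Prop :=
  [/\ differentiable f u, differentiable g (f u), g (f u) = 0 &
    exists2 k : R, 0 < k & forall w,
      det3 w ('d f u (delta_mx 0 0)) ('d f u (delta_mx 0 1)) =
      k * dot (grad g (f u)) w].

Section Modeled.
Variables (R : realType) (D : diagram R).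
Variables (U V : set 'rV[R]_3) (h h' : 'rV[R]_3 -> 'rV[R]_3).
Hypothesis hh : diffeo U V h h'.
Variables (k : nat) (f : 'I_k -> 'rV[R]_2 -> 'rV[R]_3) (rk : {perm 'I_k})
  (sg : bool) (eps : 'I_k -> bool).
Variable F : 'I_k -> 'rV[R]_2 -> ('rV[R]_3 * R^o)%type.
Hypothesis F_lift : forall j u, V (f j u) ->
  carrier D (F j u) /\ (F j u).1 = h' (f j u).
Hypothesis F_onto : forall x, carrier D x -> U x.1 ->
  exists! ju, V (f ju.1 ju.2) /\ F ju.1 ju.2 = x.
Hypothesis F_smooth : forall j, smooth_on (f j @^-1` V) (F j).
Hypothesis F_frames : forall j u, V (f j u) -> frames D (F j u) =
  [set v | exists w1 w2 : 'rV[R]_2,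
    0 < (-1) ^+ eps j * det2 w1 w2 /\
    v = ('d (F j) u w1, 'd (F j) u w2)].
Hypothesis F_height : forall j u j' u', V (f j u) -> f j u = f j' u' ->
  above rk sg j u j' u' -> (F j' u').2 < (F j u).2.

Implicit Types (p w : 'rV[R]_3) (u : 'rV[R]_2) (j : 'I_k).

Definition off_sheets p := forall j u, f j u <> p.

(** The points of the surface over [h' p] all come from the sheets, since [h'] is
    injective. *)
Lemma fiberE p x : V p ->
  fiber D (h' p) x <-> exists j u, f j u = p /\ F j u = x.
Proof.
have [_ _ VU _ _] := hh.
move=> Vp; split; last first.
  by move=> [j [u [fp <-]]]; have := @F_lift j u; rewrite fp => /(_ Vp).
move=> [xD x1]; have Ux : U x.1 by rewrite x1; case: (VU _ Vp).
have [[j u] [[Vf Fx] _]] := F_onto xD Ux.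
exists j, u; split => //; rewrite /= in Vf Fx.
have [_] := F_lift Vf; rewrite Fx x1 => /(congr1 h).
by rewrite (VU _ Vp).2 (VU _ Vf).2.
Qed.

Lemma image3E p : V p -> image3 D (h' p) <-> exists j u, f j u = p.
Proof.
move=> Vp; split.
  by move=> [x /(fiberE _ Vp)[j [u [fp _]]]]; exists j, u.
by move=> [j [u fp]]; exists (F j u); apply/fiberE => //; exists j, u.
Qed.

Lemma off_image p : V p -> off_sheets p -> ~ image3 D (h' p).
Proof. by move=> Vp op /(image3E Vp)[j [u /op]]. Qed.

Lemma model_path (y : R -> 'rV[R]_3) :
  (forall t : R, 0 <= t <= 1 -> {for t, continuous y}) ->
  (forall t : R, 0 <= t <= 1 -> V (y t) /\ off_sheets (y t)) ->
  region D (h' (y 0)) = region D (h' (y 1)).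
Proof.
move=> cy ny; apply: (@region_path R D (h' \o y)) => //; last first.
  by move=> t /ny[Vy /(off_image Vy)].
apply: continuous_in_subspaceT => t; rewrite inE /= in_itv /= => t01.
apply: continuous_comp; first exact: cy.
by apply: differentiable_continuous; apply: (diffeo_dif hh); case: (ny _ t01).
Qed.

Lemma model_segment p q :
  (forall t : R, 0 <= t <= 1 -> V (p + t *: (q - p)) /\
    off_sheets (p + t *: (q - p))) ->
  region D (h' p) = region D (h' q).
Proof.
move=> H; pose y (t : R) := p + t *: (q - p).
have e0 : y 0 = p by rewrite /y scale0r addr0.
have e1 : y 1 = q by rewrite /y scale1r subrKC.
have : region D (h' (y 0)) = region D (h' (y 1)); last by rewrite e0 e1.
apply: (@model_path y); last exact: H.
move=> t _.
by apply: cvgD; [exact: cvg_cst | apply: cvgZr_tmp; exact: cvg_id].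
Qed.

(** Near [u] the first component of the lift is [h' \o f j]. *)
Lemma fst_diff j u (w : 'rV[R]_2) : V (f j u) -> differentiable (f j) u ->
  ('d (F j) u w).1 = 'd h' (f j u) ('d (f j) u w).
Proof.
have [[_ oV] _ _ _ _] := hh.
move=> Vf df.
have dF : differentiable (F j) u.
  exact: (smooth_differentiable (F_smooth (j:=j)) Vf).
have dh := diffeo_dif hh Vf.
have fstc : continuous (fst : ('rV[R]_3 * R^o)%type -> 'rV[R]_3).
  by move=> ?; exact: cvg_fst.
have dfst : differentiable (fst : ('rV[R]_3 * R^o)%type -> 'rV[R]_3) (F j u).
  exact: linear_differentiable.
have e1 : 'd (fst \o F j) u w = ('d (F j) u w).1.
  have := congr1 (fun G : _ -> _ => G w) (diff_comp dF dfst).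
  by rewrite /= (diff_lin _ fstc).
have e2 : 'd (h' \o f j) u w = 'd h' (f j u) ('d (f j) u w).
  exact: (congr1 (fun G : _ -> _ => G w) (diff_comp df dh)).
rewrite -e1 -e2; apply: near_diff_eq.
- have : \forall u' \near u, V (f j u').
    apply: (differentiable_continuous df); exact: open_nbhs_nbhs.
  by apply: filterS => u' Vf'; case: (F_lift Vf').
- exact: differentiable_comp.
- exact: differentiable_comp.
Qed.

Section LocalSheet.
Variables (j : 'I_k) (u : 'rV[R]_2) (g : 'rV[R]_3 -> R^o).
Hypothesis (Vf : V (f j u)) (fg : co_oriented (f j) u g).
Local Notation p := (f j u).

(** A co-orientation normal and the gradient both vanish on the tangent plane, so
    they are proportional.  The factor carries the orientation of the sheet and
    that of the change of coordinates, since [h'] multiplies triple products by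
    its Jacobian determinant. *)
Lemma conormal_grad v : conormal D (F j u) v -> exists2 r : R, 0 < r &
  forall w, dot v ('d h' p w) =
    r * ((-1) ^+ eps j * (\det (jac h' p) * dot (grad g p) w)).
Proof.
have [df dg gp [kap kap0 fk]] := fg.
set e := (-1) ^+ eps j : R; have ee : e * e = 1 by rewrite -expr2 sqrr_sign.
set s1 := 'd (f j) u (delta_mx 0 0); set s2 := 'd (f j) u (delta_mx 0 1).
move=> /(_ ('d (F j) u (delta_mx 0 0)) ('d (F j) u (e *: delta_mx 0 1))).
rewrite F_frames // => /(_ _)[|].
  exists (delta_mx 0 0), (e *: delta_mx 0 1); split => //.
  by rewrite /det2 !mxE /= !mulr1 !mulr0 subr0 mul1r ee.
rewrite !fst_diff // !linearZ /= -/s1 -/s2 dotZr.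
set t1 := 'd h' p s1; set t2 := 'd h' p s2 => v1 v2.
have -> : det3 v t1 (e *: t2) = e * det3 v t1 t2 by rewrite !det3E !mxE; ring.
set m := det3 v t1 t2 => em0.
have {}v2 : dot v t2 = 0 by rewrite -[LHS]mul1r -ee -mulrA v2 mulr0.
have vv : 0 < dot v v.
  rewrite lt0r dot_ge0 andbT; apply/eqP => /dot_eq0 v0.
  by move: em0; rewrite /m v0 !det3E !mxE; lra.
exists (kap * (dot v v / (e * m))); first by rewrite mulr_gt0 // divr_gt0.
move=> w; have := orth_cross ('d h' p w) v1 v2; rewrite -/m.
have -> : det3 ('d h' p w) t1 t2 = kap * dot (grad g p) w * \det (jac h' p).
  by rewrite /t1 /t2 !jacE det3M fk.
move: (\det _) (dot _ w) (dot v ('d h' p w)) => d x z.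
move: (dot v v) vv m em0 => n _ m em0 H.
have m0 : m != 0 by apply: contraTneq em0 => ->; rewrite mulr0 ltxx.
have e0 : e != 0 by rewrite signr_eq0.
by apply: (mulIf m0); rewrite -H; field; rewrite m0 e0.
Qed.

(** The witness is, up to the orientation, the cross product of the images of the
    two coordinate vectors of the sheet; it does not vanish, because the triple
    product with the image of [w] does not. *)
Lemma conormal_exists w : dot (grad g p) w != 0 -> exists v, conormal D (F j u) v.
Proof.
have [df dg gp [kap kap0 fk]] := fg => w0.
set e := (-1) ^+ eps j : R; have ee : e * e = 1 by rewrite -expr2 sqrr_sign.
pose t i := 'd h' p ('d (f j) u (delta_mx 0 i)).
have tE (x : 'rV[R]_2) : 'd h' p ('d (f j) u x) = x 0 0 *: t 0 + x 0 1 *: t 1.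
  have xE : x = x 0 0 *: delta_mx 0 0 + x 0 1 *: delta_mx 0 1.
    by apply: vec2_ext; rewrite !mxE /=; ring.
  by rewrite {1}xE !linearD !linearZ.
have cr : cross (t 0) (t 1) != 0.
  apply/eqP => c0; have : det3 ('d h' p w) (t 0) (t 1) = 0.
    by rewrite -dot_cross c0 dotE !mxE; ring.
  rewrite /t !jacE det3M fk => /eqP; rewrite !mulf_eq0 (negbTE w0) gt_eqF //=.
  by rewrite (negbTE (det_jac_neq0 hh Vf)).
have cc : 0 < dot (cross (t 0) (t 1)) (cross (t 0) (t 1)).
  by rewrite lt0r dot_ge0 andbT; apply: contra_neq cr; exact: dot_eq0.
exists (e *: cross (t 0) (t 1)) => v1 v2.
rewrite F_frames // => -[w1 [w2 [w12 [-> ->]]]].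
rewrite !fst_diff // !tE.
have dc x : dot (e *: cross (t 0) (t 1)) x = e * det3 x (t 0) (t 1).
  by rewrite dotC dotZr dot_cross.
rewrite !dc det3_plane; split.
- by rewrite !det3E !mxE; ring.
- by rewrite !det3E !mxE; ring.
rewrite (_ : det3 _ _ _ = e * dot (cross (t 0) (t 1)) (cross (t 0) (t 1))).
  by rewrite mulrA [_ * e]mulrC mulr_gt0.
by rewrite dot_cross !det3E !mxE; ring.
Qed.

(** The side of a sheet, as seen by its co-orientation, is read off the sign of
    a co-oriented local equation. *)
Definition side_bit (d : bool) (j : 'I_k) (g : 'rV[R]_3 -> R^o) q :=
  (0 < (g q : R)) (+) eps j (+) d.

Variable (delta : bool).
Hypothesis (pdelta : (\det (jac h' p) < 0) = delta).

Lemma dot_conormal_sign v w b : conormal D (F j u) v ->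
  pos_if b (dot ('d h' p w) v) = pos_if (b (+) eps j (+) delta) (dot (grad g p) w).
Proof.
move=> /conormal_grad[r r0 /(_ w) vw].
rewrite dotC vw pos_ifM ?gt_eqF // (lt_gtF r0) addbF pos_if_sgn.
by rewrite pos_ifM ?pdelta // (det_jac_neq0 hh Vf).
Qed.

(** The local equation, read in the coordinates of the diagram, has a derivative
    of known sign along [u0]. *)
Lemma side_near v (u0 : 'rV[R]_3) b : conormal D (F j u) v ->
  pos_if b (dot u0 v) -> \forall e \near (0 : R)^'+,
  (g (h (h' p + e *: u0)) : R) != 0 /\ side_bit delta j g (h (h' p + e *: u0)) = b.
Proof.
have [df dg gp _] := fg.
have [_ _ VU sh _] := hh => vc su.
have [Up hp] : U (h' p) /\ h (h' p) = p by exact: VU.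
set w := 'd h (h' p) u0.
have wu : 'd h' p w = u0.
  by have := diffeo_dK (diffeo_inv hh) u0 Up; rewrite hp.
pose s := b (+) eps j (+) delta.
have sw : pos_if s (dot (grad g p) w).
  by rewrite -(dot_conormal_sign _ _ vc) wu.
have dh : differentiable h (h' p) by exact: (smooth_differentiable sh Up).
have dg' : differentiable g (h (h' p)) by rewrite hp.
have dG0 : differentiable (g \o h) (h' p) by exact: differentiable_comp.
pose G := ((-1) ^+ (~~ s) : R) *: (g \o h).
have dG : differentiable G (h' p) by exact: differentiableZ.
have Gp : G (h' p) = 0.
  rewrite (_ : G (h' p) = (-1) ^+ (~~ s) * (g (h (h' p)) : R)) //.
  by rewrite hp gp mulr0.
have dGu : 0 < ('d G (h' p) u0 : R).
  have -> : 'd G (h' p) u0 = (-1) ^+ (~~ s) * ('d (g \o h) (h' p) u0 : R).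
    exact: (congr1 (fun F : _ -> _ => F u0) (diffZ _ dG0)).
  have -> : 'd (g \o h) (h' p) u0 = 'd g (h (h' p)) w.
    exact: (congr1 (fun F : _ -> _ => F u0) (diff_comp dh dg')).
  rewrite hp gradE.
  by rewrite -[0 < _]/(pos_if true _) pos_if_sgn addTb negbK.
have := ray_pos dG Gp dGu.
apply: filterS => e.
rewrite -[0 < _]/(pos_if true _) [G _]/((-1) ^+ (~~ s) * (g _ : R)) pos_if_sgn.
rewrite addTb negbK pos_ifE => /andP[g0 /eqP gs]; split => //.
by rewrite /side_bit gs /s; case: (b); case: (eps j); case: (delta).
Qed.

End LocalSheet.

Section Crossings.
Variables (X : choiceType) (T : X -> X -> X -> X) (c : set 'rV[R]_3 -> X).
Hypothesis hc : coloring T D c.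
Variable p : 'rV[R]_3.
Hypothesis Vp : V p.
Variable delta : bool.
Hypothesis pdelta : (\det (jac h' p) < 0) = delta.

Definition model_color q := c (region D (h' q)).

Lemma near_ray (P : 'rV[R]_3 -> Prop) (u0 : 'rV[R]_3) : (\forall q \near p, P q) ->
  \forall e \near (0 : R)^'+, P (h (h' p + e *: u0)) /\
    h' (h (h' p + e *: u0)) = h' p + e *: u0 /\ V (h (h' p + e *: u0)).
Proof.
move=> Pp; have [[oU _] UV VU sh _] := hh.
have [Up hp] : U (h' p) /\ h (h' p) = p by exact: VU.
have ray0 : (fun e : R => h' p + e *: u0) @ 0^'+ --> h' p.
  apply: cvg_at_right_filter; rewrite -[X in _ --> X]addr0.
  apply: cvgD; first exact: cvg_cst.
  by rewrite -[X in _ --> X](scale0r u0); apply: cvgZr_tmp; exact: cvg_id.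
have ch : h @ (h' p) --> p.
  rewrite -[X in _ --> X]hp; apply: differentiable_continuous.
  exact: (smooth_differentiable sh Up).
have H : \forall y \near h' p, P (h y) /\ h' (h y) = y /\ V (h y).
  near=> y; have Uy : U y by near: y; exact: open_nbhs_nbhs.
  have [Vy hy] := UV _ Uy; split => //.
  by near: y; exact: (ch _ Pp).
exact: (ray0 _ H).
Unshelve. all: by end_near. Qed.

(** A region met by a short ray has the color that the ray sees. *)
Lemma region_along (u0 : 'rV[R]_3) x :
  (\forall e \near (0 : R)^'+, off_sheets (h (h' p + e *: u0)) /\
    model_color (h (h' p + e *: u0)) = x) ->
  exists2 r, \forall e \near (0 : R)^'+,
    ~ image3 D (h' p + e *: u0) /\ region D (h' p + e *: u0) = r & c r = x.
Proof.
move=> H; have K := @near_ray (fun=> True) u0 (filterE _ (fun=> I)).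
have [|r Hr] := @region_ray R D (h' p) u0.
  near=> e.
  have [_ [he Ve]] : True /\ h' (h (h' p + e *: u0)) = h' p + e *: u0 /\
    V (h (h' p + e *: u0)) by near: e; exact: K.
  have [oe _] : off_sheets (h (h' p + e *: u0)) /\
    model_color (h (h' p + e *: u0)) = x by near: e; exact: H.
  by rewrite -he; exact: (off_image Ve oe).
exists r => //; near (0 : R)^'+ => e.
have [_ [he Ve]] : True /\ h' (h (h' p + e *: u0)) = h' p + e *: u0 /\
    V (h (h' p + e *: u0)) by near: e; exact: K.
have [_ <-] : ~ image3 D (h' p + e *: u0) /\ region D (h' p + e *: u0) = r.
  by near: e; exact: Hr.
have [_ <-] : off_sheets (h (h' p + e *: u0)) /\
    model_color (h (h' p + e *: u0)) = x by near: e; exact: H.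
by rewrite /model_color he.
Unshelve. all: by end_near. Qed.

Section Face.
Variables (jU jO : 'I_k) (uU uO : 'rV[R]_2) (gU gO : 'rV[R]_3 -> R^o).
Variable col : bool -> bool -> X.

(** The sheets are transverse, so some ray enters each of the four sectors at the
    double point, and it sees the color that [col] gives to this sector.  The
    coloring rule relates these four colors. *)
Lemma double_crossing :
  f jU uU = p -> co_oriented (f jU) uU gU ->
  f jO uO = p -> co_oriented (f jO) uO gO ->
  above rk sg jO uO jU uU ->
  (forall j u, f j u = p -> j = jU /\ u = uU \/ j = jO /\ u = uO) ->
  (forall bU bO, exists w, pos_if bU (dot (grad gU p) w) /\
                           pos_if bO (dot (grad gO p) w)) ->
  (\forall q \near p, (gU q : R) != 0 -> (gO q : R) != 0 -> off_sheets q /\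
     model_color q = col (side_bit delta jU gU q) (side_bit delta jO gO q)) ->
  col false true = T (col false false) (col true false) (col true true).
Proof.
move=> eU fU eO fO ab fib span near_col.
have VU : V (f jU uU) by rewrite eU.
have VO : V (f jO uO) by rewrite eO.
have dU : (\det (jac h' (f jU uU)) < 0) = delta by rewrite eU.
have dO : (\det (jac h' (f jO uO)) < 0) = delta by rewrite eO.
have [w0 [wU wO]] := span true true.
have [vU cU] : exists v, conormal D (F jU uU) v.
  apply: (conormal_exists VU fU (w := w0)); rewrite eU.
  by move: wU; rewrite pos_ifE => /andP[].
have [vO cO] : exists v, conormal D (F jO uO) v.
  apply: (conormal_exists VO fO (w := w0)); rewrite eO.
  by move: wO; rewrite pos_ifE => /andP[].
have dp : double_point D (h' p) vO vU.
  exists (F jO uO), (F jU uU); split => //; last first.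
    by apply: F_height ab; rewrite ?eO ?eU.
  apply/seteqP; split => x.
    by move=> /(fiberE _ Vp)[j [u [/fib[[-> ->]|[-> ->]] <-]]]; [right|left].
  by case=> ->; apply/fiberE => //; [exists jO, uO|exists jU, uU].
have reg bU bO : exists2 r, region_near D (h' p) [:: (vU, bU); (vO, bO)] r &
    c r = col bU bO.
  have [w [w1 w2]] := span (bU (+) eps jU (+) delta) (bO (+) eps jO (+) delta).
  pose u0 := 'd h' p w.
  have sU : pos_if bU (dot u0 vU).
    by have := dot_conormal_sign VU fU dU w bU cU; rewrite eU -/u0 => ->.
  have sO : pos_if bO (dot u0 vO).
    by have := dot_conormal_sign VO fO dO w bO cO; rewrite eO -/u0 => ->.
  have nU := side_near VU fU dU cU sU.
  have nO := side_near VO fO dO cO sO.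
  rewrite eU in nU; rewrite eO in nO.
  have [|r Hr cr] := @region_along u0 (col bU bO).
    near=> e.
    have [gU0 <-] : (gU (h (h' p + e *: u0)) : R) != 0 /\
      side_bit delta jU gU (h (h' p + e *: u0)) = bU by near: e; exact: nU.
    have [gO0 <-] : (gO (h (h' p + e *: u0)) : R) != 0 /\
      side_bit delta jO gO (h (h' p + e *: u0)) = bO by near: e; exact: nO.
    move: gU0 gO0; near: e.
    by have := near_ray u0 near_col; apply: filterS => e [].
  exists r => //; exists u0 => //=.
  by rewrite andbT; apply/andP; split; [exact: sU|exact: sO].
have [r1 n1 <-] := reg false false.
have [r2 n2 <-] := reg true false.
have [r3 n3 <-] := reg true true.
have [r4 n4 <-] := reg false true.
exact: (hc dp n1 n2 n3 n4).
Unshelve. all: by end_near. Qed.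

End Face.

Section Triple.
Variables (jB jM jT : 'I_k) (uB uM uT : 'rV[R]_2).
Variables (gB gM gT : 'rV[R]_3 -> R^o).
Variable col : bool -> bool -> bool -> X.
Hypotheses (eB : f jB uB = p) (eM : f jM uM = p) (eT : f jT uT = p).
Hypotheses (fB : co_oriented (f jB) uB gB) (fM : co_oriented (f jM) uM gM)
  (fT : co_oriented (f jT) uT gT).
Hypotheses (aTM : above rk sg jT uT jM uM) (aMB : above rk sg jM uM jB uB).
Hypothesis fib : forall j u, f j u = p ->
  [\/ j = jB /\ u = uB, j = jM /\ u = uM | j = jT /\ u = uT].
Hypothesis near_col : \forall q \near p,
  (gB q : R) != 0 -> (gM q : R) != 0 -> (gT q : R) != 0 ->
  off_sheets q /\ model_color q =
    col (side_bit delta jB gB q) (side_bit delta jM gM q) (side_bit delta jT gT q).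
Let det_grad := det3 (grad gT p) (grad gM p) (grad gB p).
Hypothesis det_grad_neq0 : det_grad != 0.

Lemma triple_fiber : fiber D (h' p) = [set F jT uT; F jM uM; F jB uB].
Proof.
apply/seteqP; split => x.
  move=> /(fiberE _ Vp)[j [u [/fib[[-> ->]|[-> ->]|[-> ->]] <-]]].
  - by right.
  - by left; right.
  - by left; left.
case=> [[]|] ->; apply/fiberE => //.
- by exists jT, uT.
- by exists jM, uM.
- by exists jB, uB.
Qed.

Lemma triple_span bB bM bT : exists w, [/\ pos_if bB (dot (grad gB p) w),
  pos_if bM (dot (grad gM p) w) & pos_if bT (dot (grad gT p) w)].
Proof.
move: det_grad_neq0; rewrite /det_grad.
move: (grad gB p) (grad gM p) (grad gT p) => b m t d0.
set d := det3 t m b in d0.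
pose sn (x : bool) : R := (-1) ^+ (~~ x).
have sp x : pos_if x (sn x * (d * d)).
  by rewrite pos_if_sgn addbN addbb /= -expr2 exprn_even_gt0.
exists (d *: (sn bB *: cross t m + sn bM *: cross b t + sn bT *: cross m b)).
have e x : dot x (d *: (sn bB *: cross t m + sn bM *: cross b t + sn bT *: cross m b))
  = d * (sn bB * det3 x t m + sn bM * det3 x b t + sn bT * det3 x m b).
  by rewrite dotZr !dotDr !dotZr !dot_cross.
rewrite !e; split.
- rewrite (_ : _ * _ = sn bB * (d * d)); first exact: sp.
  by rewrite /d !det3E; ring.
- rewrite (_ : _ * _ = sn bM * (d * d)); first exact: sp.
  by rewrite /d !det3E; ring.
- rewrite (_ : _ * _ = sn bT * (d * d)); first exact: sp.
  by rewrite /d !det3E; ring.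
Qed.

(** The heights decide which of the three preimages is the top, the middle and
    the bottom one. *)
Lemma triple_heights x1 x2 x3 : fiber D (h' p) = [set x1; x2; x3] ->
  x3.2 < x2.2 /\ x2.2 < x1.2 ->
  [/\ x1 = F jT uT, x2 = F jM uM & x3 = F jB uB].
Proof.
have VT : V (f jT uT) by rewrite eT.
have VM : V (f jM uM) by rewrite eM.
have hTM : (F jM uM).2 < (F jT uT).2 by apply: F_height aTM; rewrite ?eT ?eM.
have hMB : (F jB uB).2 < (F jM uM).2 by apply: F_height aMB; rewrite ?eB ?eM.
rewrite triple_fiber => E [h32 h21].
have m1 : [set F jT uT; F jM uM; F jB uB] x1 by rewrite E; left; left.
have m2 : [set F jT uT; F jM uM; F jB uB] x2 by rewrite E; left; right.
have m3 : [set F jT uT; F jM uM; F jB uB] x3 by rewrite E; right.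
clear E; move: h32 h21 hTM hMB.
case: m1 => [[]|] ->; case: m2 => [[]|] ->; case: m3 => [[]|] -> => h1 h2 h3 h4;
  by [| exfalso; lra].
Qed.

(** By [conormal_grad] each normal contributes a factor [\det (jac h' p)], and
    passing from scalar products with the images of the basis vectors to a
    determinant divides by one such factor; an even number of them remains, and
    only the orientations of the sheets change the sign. *)
Lemma triple_sign vT vM vB : conormal D (F jT uT) vT ->
  conormal D (F jM uM) vM -> conormal D (F jB uB) vB ->
  (0 < det3 vT vM vB) = pos_if (~~ (eps jT (+) eps jM (+) eps jB)) det_grad.
Proof.
have VT : V (f jT uT) by rewrite eT.
have VM : V (f jM uM) by rewrite eM.
have VB : V (f jB uB) by rewrite eB.
move=> /(conormal_grad VT fT)[rT rT0 eqT] /(conormal_grad VM fM)[rM rM0 eqM].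
move=> /(conormal_grad VB fB)[rB rB0 eqB].
rewrite eT in eqT; rewrite eM in eqM; rewrite eB in eqB.
have := det3_gram vT vM vB ('d h' p (vec3 1 0 0)) ('d h' p (vec3 0 1 0))
  ('d h' p (vec3 0 0 1)).
rewrite -det_jac => E.
have d0 := det_jac_neq0 hh Vp.
set e1 := (-1) ^+ eps jT in eqT; set e2 := (-1) ^+ eps jM in eqM.
set e3 := (-1) ^+ eps jB in eqB.
move: d0 eqT eqM eqB E; rewrite /det_grad; move: (\det _) => d d0 eqT eqM eqB.
rewrite !eqT !eqM !eqB !mulrA det3_scale.
move: (det3 (grad _ _) _ _) (det3 vT _ _) => G N E.
have {E}-> : N = (rT * rM * rB * d ^+ 2) * (e1 * (e2 * (e3 * G))).
  by apply: (mulIf d0); rewrite E; ring.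
have k0 : 0 < rT * rM * rB * d ^+ 2.
  by apply: mulr_gt0; [apply: mulr_gt0 => //; exact: mulr_gt0 | rewrite exprn_even_gt0].
rewrite -[0 < _]/(pos_if true _) pos_ifM ?gt_eqF // (lt_gtF k0).
rewrite !pos_if_sgn; congr (pos_if _ _).
by case: (eps jT); case: (eps jM); case: (eps jB).
Qed.

Lemma triple_near_color vT vM vB bB bM bT (u0 : 'rV[R]_3) :
  conormal D (F jT uT) vT -> conormal D (F jM uM) vM -> conormal D (F jB uB) vB ->
  pos_if bB (dot u0 vB) -> pos_if bM (dot u0 vM) -> pos_if bT (dot u0 vT) ->
  \forall e \near (0 : R)^'+, off_sheets (h (h' p + e *: u0)) /\
    model_color (h (h' p + e *: u0)) = col bB bM bT.
Proof.
have VT : V (f jT uT) by rewrite eT.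
have VM : V (f jM uM) by rewrite eM.
have VB : V (f jB uB) by rewrite eB.
have dT : (\det (jac h' (f jT uT)) < 0) = delta by rewrite eT.
have dM : (\det (jac h' (f jM uM)) < 0) = delta by rewrite eM.
have dB : (\det (jac h' (f jB uB)) < 0) = delta by rewrite eB.
move=> cT cM cB sB sM sT.
have nB := side_near VB fB dB cB sB; rewrite eB in nB.
have nM := side_near VM fM dM cM sM; rewrite eM in nM.
have nT := side_near VT fT dT cT sT; rewrite eT in nT.
near=> e.
have [gB0 <-] : (gB (h (h' p + e *: u0)) : R) != 0 /\
  side_bit delta jB gB (h (h' p + e *: u0)) = bB by near: e; exact: nB.
have [gM0 <-] : (gM (h (h' p + e *: u0)) : R) != 0 /\
  side_bit delta jM gM (h (h' p + e *: u0)) = bM by near: e; exact: nM.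
have [gT0 <-] : (gT (h (h' p + e *: u0)) : R) != 0 /\
  side_bit delta jT gT (h (h' p + e *: u0)) = bT by near: e; exact: nT.
move: gB0 gM0 gT0; near: e.
by have := near_ray u0 near_col; apply: filterS => e [].
Unshelve. all: by end_near. Qed.

(** The direction witnessing [region_near] is arbitrary, but the color it sees is
    determined by the sides. *)
Lemma triple_region_color vT vM vB bB bM bT r :
  conormal D (F jT uT) vT -> conormal D (F jM uM) vM -> conormal D (F jB uB) vB ->
  region_near D (h' p) [:: (vB, bB); (vM, bM); (vT, bT)] r -> c r = col bB bM bT.
Proof.
move=> cT cM cB [u0 /= /and4P[sB sM sT _] Hr].
have H := triple_near_color cT cM cB sB sM sT.
near (0 : R)^'+ => e.
have [_ <-] : ~ image3 D (h' p + e *: u0) /\ region D (h' p + e *: u0) = r.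
  by near: e; exact: Hr.
have [_ <-] : off_sheets (h (h' p + e *: u0)) /\
    model_color (h (h' p + e *: u0)) = col bB bM bT by near: e; exact: H.
have [_ [he _]] : True /\ h' (h (h' p + e *: u0)) = h' p + e *: u0 /\
    V (h (h' p + e *: u0)).
  by near: e; exact: (@near_ray (fun=> True) u0 (filterE _ (fun=> I))).
by rewrite /model_color he.
Unshelve. all: by end_near. Qed.

(** The normals, the sign and the four regions at [h' p] are forced, so there is
    exactly one colored triple point over [p]. *)
Lemma triple_crossing t : t.1.1 = h' p -> colored_triple_points D c t <->
  t = (h' p, pos_if (~~ (eps jT (+) eps jM (+) eps jB)) det_grad,
    [tuple col false false false; col true false false; col true true false;
           col true true true]).
Proof.
have VT : V (f jT uT) by rewrite eT.
have VM : V (f jM uM) by rewrite eM.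
have VB : V (f jB uB) by rewrite eB.
have dT : (\det (jac h' (f jT uT)) < 0) = delta by rewrite eT.
have dM : (\det (jac h' (f jM uM)) < 0) = delta by rewrite eM.
have dB : (\det (jac h' (f jB uB)) < 0) = delta by rewrite eB.
case: t => -[y s] w /= ->; split.
  move=> [vT [vM [vB [r0 [r1 [r2 [r3 [/= tp -> [n0 n1] [n2 n3] ->]]]]]]]].
  have [xT [xM [xB [fx hx cT cM cB]]]] := tp.
  have [eqT eqM eqB] := triple_heights fx hx; subst xT xM xB.
  rewrite (triple_sign cT cM cB).
  by rewrite !(triple_region_color cT cM cB n0, triple_region_color cT cM cB n1,
    triple_region_color cT cM cB n2, triple_region_color cT cM cB n3).
move=> [-> ->].
have [w0 [wB wM wT]] := triple_span true true true.
have [vB cB] : exists v, conormal D (F jB uB) v.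
  apply: (conormal_exists VB fB (w := w0)); rewrite eB.
  by move: wB; rewrite pos_ifE => /andP[].
have [vM cM] : exists v, conormal D (F jM uM) v.
  apply: (conormal_exists VM fM (w := w0)); rewrite eM.
  by move: wM; rewrite pos_ifE => /andP[].
have [vT cT] : exists v, conormal D (F jT uT) v.
  apply: (conormal_exists VT fT (w := w0)); rewrite eT.
  by move: wT; rewrite pos_ifE => /andP[].
have reg bB bM bT : exists2 r,
    region_near D (h' p) [:: (vB, bB); (vM, bM); (vT, bT)] r & c r = col bB bM bT.
  have [w' [w1 w2 w3]] := triple_span (bB (+) eps jB (+) delta)
    (bM (+) eps jM (+) delta) (bT (+) eps jT (+) delta).
  pose u0 := 'd h' p w'.
  have sB : pos_if bB (dot u0 vB).
    by have := dot_conormal_sign VB fB dB w' bB cB; rewrite eB -/u0 => ->.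
  have sM : pos_if bM (dot u0 vM).
    by have := dot_conormal_sign VM fM dM w' bM cM; rewrite eM -/u0 => ->.
  have sT : pos_if bT (dot u0 vT).
    by have := dot_conormal_sign VT fT dT w' bT cT; rewrite eT -/u0 => ->.
  have [r Hr cr] := region_along (triple_near_color cT cM cB sB sM sT).
  exists r => //; exists u0 => //=.
  by apply/and4P; split; [exact: sB|exact: sM|exact: sT|].
have [r0 n0 <-] := reg false false false.
have [r1 n1 <-] := reg true false false.
have [r2 n2 <-] := reg true true false.
have [r3 n3 <-] := reg true true true.
exists vT, vM, vB, r0, r1, r2, r3; split => //=.
  exists (F jT uT), (F jM uM), (F jB uB); split => //; first exact: triple_fiber.
  by split; [apply: F_height aMB|apply: F_height aTM]; rewrite ?eT ?eM ?eB.
by rewrite (triple_sign cT cM cB).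
Qed.

End Triple.

End Crossings.

(** The three preimages have different heights. *)
Lemma triple_preimages (X : choiceType) (c : set 'rV[R]_3 -> X) p t : V p -> t.1.1 = h' p -> colored_triple_points D c t ->
  exists j1 u1 j2 u2 j3 u3, [/\ f j1 u1 = p, f j2 u2 = p & f j3 u3 = p] /\
   [/\ (j1, u1) <> (j2, u2), (j1, u1) <> (j3, u3) & (j2, u2) <> (j3, u3)] .
Proof.
move=> Vp e [vT [vM [vB [r0 [r1 [r2 [r3 [/= tp _ _ _ _]]]]]]]].
have [xT [xM [xB [fx [h1 h2] _ _ _]]]] := tp; rewrite e in fx.
have [jT [uT [eT FT]]] : exists j u, f j u = p /\ F j u = xT.
  by apply/fiberE => //; rewrite fx; left; left.
have [jM [uM [eM FM]]] : exists j u, f j u = p /\ F j u = xM.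
  by apply/fiberE => //; rewrite fx; left; right.
have [jB [uB [eB FB]]] : exists j u, f j u = p /\ F j u = xB.
  by apply/fiberE => //; rewrite fx; right.
exists jT, uT, jM, uM, jB, uB; split; split => //.
- by move=> [ej eu]; move: h2; rewrite -FT -FM ej eu ltxx.
- by move=> [ej eu]; move: (lt_trans h1 h2); rewrite -FT -FB ej eu ltxx.
- by move=> [ej eu]; move: h1; rewrite -FM -FB ej eu ltxx.
Qed.

End Modeled.

(** The same facts with the lift of the sheets hidden in [modeled]. *)
Section ModeledWrappers.
Variables (R : realType) (D : diagram R).
Variables (U V : set 'rV[R]_3) (h h' : 'rV[R]_3 -> 'rV[R]_3).
Hypothesis hh : diffeo U V h h'.
Variables (k : nat) (f : 'I_k -> 'rV[R]_2 -> 'rV[R]_3) (rk : {perm 'I_k})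
  (sg : bool) (eps : 'I_k -> bool).
Hypothesis hm : modeled D U V h' f rk sg eps.

Lemma modeled_path (y : R -> 'rV[R]_3) :
  (forall t : R, 0 <= t <= 1 -> {for t, continuous y}) ->
  (forall t : R, 0 <= t <= 1 -> V (y t) /\ off_sheets f (y t)) ->
  region D (h' (y 0)) = region D (h' (y 1)).
Proof. by have [F [F1 F2 F3 F4 F5]] := hm; exact: (model_path hh F1 F2). Qed.

Lemma modeled_segment p q :
  (forall t : R, 0 <= t <= 1 -> V (p + t *: (q - p)) /\
    off_sheets f (p + t *: (q - p))) ->
  region D (h' p) = region D (h' q).
Proof. by have [F [F1 F2 F3 F4 F5]] := hm; exact: (model_segment hh F1 F2). Qed.

Lemma modeled_preimages (X : choiceType) (c : set 'rV[R]_3 -> X) p t :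
  V p -> t.1.1 = h' p -> colored_triple_points D c t ->
  exists j1 u1 j2 u2 j3 u3, [/\ f j1 u1 = p, f j2 u2 = p & f j3 u3 = p] /\
   [/\ (j1, u1) <> (j2, u2), (j1, u1) <> (j3, u3) & (j2, u2) <> (j3, u3)].
Proof. by have [F [F1 F2 F3 F4 F5]] := hm; exact: (triple_preimages hh F1 F2). Qed.

Lemma modeled_off_image p : V p -> off_sheets f p -> ~ image3 D (h' p).
Proof. by have [F [F1 F2 F3 F4 F5]] := hm; exact: (off_image hh F1 F2). Qed.

Variables (X : choiceType) (T : X -> X -> X -> X) (c : set 'rV[R]_3 -> X).
Hypothesis hc : coloring T D c.
Variables (p : 'rV[R]_3) (delta : bool).
Hypotheses (Vp : V p) (pdelta : (\det (jac h' p) < 0) = delta).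

Lemma modeled_double (jU jO : 'I_k) (uU uO : 'rV[R]_2)
    (gU gO : 'rV[R]_3 -> R^o) (col : bool -> bool -> X) :
  f jU uU = p -> co_oriented (f jU) uU gU ->
  f jO uO = p -> co_oriented (f jO) uO gO ->
  above rk sg jO uO jU uU ->
  (forall j u, f j u = p -> j = jU /\ u = uU \/ j = jO /\ u = uO) ->
  (forall bU bO, exists w, pos_if bU (dot (grad gU p) w) /\
                           pos_if bO (dot (grad gO p) w)) ->
  (\forall q \near p, (gU q : R) != 0 -> (gO q : R) != 0 -> off_sheets f q /\
     model_color D h' c q = col (side_bit eps delta jU gU q) (side_bit eps delta jO gO q)) ->
  col false true = T (col false false) (col true false) (col true true).
Proof.
have [F [F1 F2 F3 F4 F5]] := hm.
exact: (double_crossing hh F1 F2 F3 F4 F5 hc Vp pdelta).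
Qed.

Lemma modeled_triple (jB jM jT : 'I_k) (uB uM uT : 'rV[R]_2)
    (gB gM gT : 'rV[R]_3 -> R^o) (col : bool -> bool -> bool -> X) :
  f jB uB = p -> f jM uM = p -> f jT uT = p ->
  co_oriented (f jB) uB gB -> co_oriented (f jM) uM gM ->
  co_oriented (f jT) uT gT ->
  above rk sg jT uT jM uM -> above rk sg jM uM jB uB ->
  (forall j u, f j u = p ->
    [\/ j = jB /\ u = uB, j = jM /\ u = uM | j = jT /\ u = uT]) ->
  (\forall q \near p,
    (gB q : R) != 0 -> (gM q : R) != 0 -> (gT q : R) != 0 ->
    off_sheets f q /\ model_color D h' c q =
      col (side_bit eps delta jB gB q) (side_bit eps delta jM gM q)
          (side_bit eps delta jT gT q)) ->
  det3 (grad gT p) (grad gM p) (grad gB p) != 0 ->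
  forall t, t.1.1 = h' p -> colored_triple_points D c t <->
  t = (h' p, pos_if (~~ (eps jT (+) eps jM (+) eps jB))
         (det3 (grad gT p) (grad gM p) (grad gB p)),
    [tuple col false false false; col true false false; col true true false;
           col true true true]).
Proof.
have [F [F1 F2 F3 F4 F5]] := hm => eB eM eT fB fM fT a1 a2 fib nc d0 t.
exact: (triple_crossing hh F1 F2 F3 F4 F5 Vp pdelta eB eM eT fB fM fT a1 a2 fib nc d0).
Qed.

End ModeledWrappers.

(** * Homologous chains and the outside of the ball *)

Section Chains.
Variables (K : comNzRingType) (X : choiceType) (T : X -> X -> X -> X).
Local Notation chain2 := {freeg (4.-tuple X) / K}.

Lemma degenerate_chain0 : @degenerate_chain X K T 2 0.
Proof. by exists [::] => //; rewrite big_nil. Qed.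

Lemma degenerate_chainD (z z' : chain2) : degenerate_chain T z ->
  degenerate_chain T z' -> degenerate_chain T (z + z').
Proof.
move=> [s hs ->] [s' hs' ->]; exists (s ++ s'); last by rewrite big_cat.
by move=> p; rewrite mem_cat => /orP[/hs|/hs'].
Qed.

Lemma degenerate_chainN (z : chain2) : degenerate_chain T z ->
  degenerate_chain T (- z).
Proof.
move=> [s hs ->]; exists [seq (- p.1, p.2) | p <- s].
  by move=> p /mapP[q /hs ? ->].
by rewrite big_map -sumrN; apply: eq_bigr => p _ /=; rewrite scaleNr.
Qed.

Lemma boundary3B (s s' : {freeg (5.-tuple X) / K}) :
  boundary3 T (s - s') = boundary3 T s - boundary3 T s'.
Proof. by rewrite /boundary3 lift_is_additive. Qed.

Lemma boundary3U w : boundary3 T (<< w >> : {freeg (5.-tuple X) / K}) =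
  boundary3_gen K T w.
Proof. by rewrite /boundary3 liftU scale1r. Qed.

Lemma boundary3_0 : boundary3 T (0 : {freeg (5.-tuple X) / K}) = 0.
Proof. by rewrite -(subrr 0) boundary3B subrr. Qed.

Lemma boundary3_sign (s : bool) w :
  boundary3 T ((-1) ^+ s *: << w >> : {freeg (5.-tuple X) / K}) =
  (-1) ^+ s *: boundary3_gen K T w.
Proof.
case: s; rewrite ?expr0 ?expr1 ?scale1r ?scaleN1r ?boundary3U //.
by rewrite -sub0r boundary3B boundary3_0 boundary3U sub0r.
Qed.

Definition homologous (z z' : chain2) : Prop :=
  exists s : {freeg (5.-tuple X) / K},
    @degenerate_chain X K T 2 (z' - z - boundary3 T s).

Lemma homologous_sym z z' : homologous z z' -> homologous z' z.
Proof.
move=> [s hs]; exists (0 - s); rewrite boundary3B boundary3_0.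
by have := degenerate_chainN hs; congr degenerate_chain; rewrite !opprB subr0 addrC.
Qed.

(** The two boundaries add up, and so do the two degenerate chains. *)
Lemma homologous_class z z' : homologous z z' ->
  homology_class T z = homology_class T z'.
Proof.
suff H (a b : chain2) : homologous a b -> homology_class T b `<=` homology_class T a.
  by move=> ab; apply/seteqP; split; apply: H => //; exact: homologous_sym.
move=> [s hs] y [s' hs']; exists (s' - (0 - s)).
rewrite !boundary3B boundary3_0 sub0r opprK.
have := degenerate_chainD hs' hs; congr degenerate_chain.
by rewrite opprD addrACA subrKA.
Qed.

End Chains.

Section Sums.
Variables (V : zmodType) (I : choiceType).

(** Two families that differ by finitely many terms: either the common part is
    summable, or both sums take the default value zero. *)
Lemma fsbig_diff (A A' : set I) (B : set I) (s s' : seq I) (F : I -> V) :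
  uniq s -> uniq s' ->
  (forall i, B i -> A i <-> i \in s) -> (forall i, B i -> A' i <-> i \in s') ->
  {in s, forall i, B i} -> {in s', forall i, B i} ->
  (forall i, ~ B i -> A i <-> A' i) ->
  \sum_(i \in A') F i - \sum_(i \in A) F i = 0 \/
  \sum_(i \in A') F i - \sum_(i \in A) F i =
    \sum_(i <- s') F i - \sum_(i <- s) F i.
Proof.
move=> us us' As As' sB sB' AA'.
have [fin|inf] := pselect (finite_set ((A `\` B) `&` F @^-1` [set~ 0])); last first.
  left; rewrite !fsbig_dflt ?subrr //.
    apply: contra_not inf; apply: sub_finite_set => i [[Ai Bi] Fi]; split => //.
  apply: contra_not inf; apply: sub_finite_set => i [[Ai Bi] Fi]; split => //.
  exact/(AA' _ Bi).
right.
have E (C : set I) (r : seq I) : uniq r -> (forall i, B i -> C i <-> i \in r) ->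
    {in r, forall i, B i} -> (forall i, ~ B i -> A i <-> C i) ->
    \sum_(i \in C) F i = \sum_(i <- r) F i +
      \sum_(i \in (A `\` B) `&` F @^-1` [set~ 0]) F i.
  move=> ur Cr rB AC.
  transitivity (\sum_(i \in [set` r] `|` ((A `\` B) `&` F @^-1` [set~ 0])) F i);
    last first.
    rewrite fsbigU0 ?(fsbig_seq _ _ ur) //.
    by move=> i [/= /rB Bi [[_ /(_ Bi)]]].
  apply/esym/fsbig_widen => i.
    case=> [/= ir|[[Ai Bi] _]]; first by apply/Cr => //; exact: rB.
    exact/AC.
  move=> [Ci nu]; apply: contrapT => Fi; apply: nu.
  have [Bi|Bi] := pselect (B i); first by left; exact/Cr.
  by right; split => //; split => //; exact/AC.
rewrite (E A' s') // (E A s) //.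
by rewrite opprD addrACA subrr addr0.
Qed.

End Sums.

Section Outside.
Variables (R : realType) (D D' : diagram R) (B : set 'rV[R]_3).
Hypotheses (Bc : closed B)
  (same : forall y, ~ B y -> same_diagram_at D D' y).
Variables (X : choiceType) (c c' : set 'rV[R]_3 -> X).
Hypothesis agree : forall y : 'rV[R]_3, ~ B y -> ~ image3 D y ->
  c (region D y) = c' (region D' y).

(** The ball is closed, so a short ray from [y] stays outside it, where the two
    colorings agree. *)
Lemma region_near_outside y N r : ~ B y -> region_near D y N r ->
  exists2 r', region_near D' y N r' & c r = c' r'.
Proof.
move=> By [u uN Hr].
have nB : \forall e \near (0 : R)^'+, ~ B (y + e *: u).
  have ray0 : (fun e : R => y + e *: u) @ 0^'+ --> y.
    apply: cvg_at_right_filter; rewrite -[X in _ --> X]addr0.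
    apply: cvgD; first exact: cvg_cst.
    by rewrite -[X in _ --> X](scale0r u); apply: cvgZr_tmp; exact: cvg_id.
  exact: (ray0 _ (open_nbhs_nbhs (conj (closed_openC Bc) By))).
have [|r' Hr'] := @region_ray R D' y u.
  near=> e; have Be : ~ B (y + e *: u) by near: e.
  have [ne _] : ~ image3 D (y + e *: u) /\ region D (y + e *: u) = r.
    by near: e; exact: Hr.
  by have [E _ _ _] := same Be; rewrite -E.
exists r'; first by exists u.
near (0 : R)^'+ => e.
have Be : ~ B (y + e *: u) by near: e.
have [ne <-] : ~ image3 D (y + e *: u) /\ region D (y + e *: u) = r.
  by near: e; exact: Hr.
have [_ <-] : ~ image3 D' (y + e *: u) /\ region D' (y + e *: u) = r'.
  by near: e; exact: Hr'.
exact: agree.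
Unshelve. all: by end_near. Qed.

Lemma triple_points_outside t : ~ B t.1.1 ->
  colored_triple_points D c t -> colored_triple_points D' c' t.
Proof.
move=> Bt [vT [vM [vB [r0 [r1 [r2 [r3 [tp sg [n0 n1] [n2 n3] tt]]]]]]]].
have [_ _ _ E] := same Bt.
have [q0 m0 e0] := region_near_outside Bt n0.
have [q1 m1 e1] := region_near_outside Bt n1.
have [q2 m2 e2] := region_near_outside Bt n2.
have [q3 m3 e3] := region_near_outside Bt n3.
exists vT, vM, vB, q0, q1, q2, q3; split => //; first exact/E.
by rewrite tt e0 e1 e2 e3.
Qed.

End Outside.

Lemma same_diagram_sym (R : realType) (D D' : diagram R) y :
  same_diagram_at D D' y -> same_diagram_at D' D y.
Proof. by move=> [a b d e]; split; intros; apply: iff_sym. Qed.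

Section Ball.
Variables (R : realType) (U V : set 'rV[R]_3) (h h' : 'rV[R]_3 -> 'rV[R]_3).
Hypotheses (hh : diffeo U V h h') (BV : [set q | dot q q <= 9] `<=` V).

(** A continuous image of a compact set. *)
Lemma ball3_closed : closed (h' @` [set q : 'rV[R]_3 | dot q q <= 9]).
Proof.
have dc : continuous (fun q : 'rV[R]_3 => dot q q : R).
  rewrite (_ : (fun q : 'rV[R]_3 => _) = fun q => q 0 0 * q 0 0 + q 0 1 * q 0 1 + q 0 2 * q 0 2);
    last by apply/funext => q; rewrite dotE.
  move=> q; have co i : {for q, continuous (fun q : 'rV[R]_3 => q 0 i : R)}.
    exact: coord_continuous.
  exact: (@continuousD R R^o _ _ _ _ (@continuousD R R^o _ _ _ _
    (continuousM (co 0) (co 0)) (continuousM (co 1) (co 1))) (continuousM (co 2) (co 2))).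
apply: compact_closed; first exact: norm_hausdorff.
apply: continuous_compact.
  apply: continuous_in_subspaceT => q; rewrite inE => /BV Vq.
  exact/differentiable_continuous/(diffeo_dif hh).
apply: bounded_closed_compact.
  exists 3; split; first exact: num_real.
  move=> M M3 q /= q9.
  apply: (le_trans _ (ltW M3)).
  rewrite /Num.Def.normr /= mx_normrE (bigmax_le _ (ler0n _ 3)) //= => -[i j] _ /=.
  rewrite -(@ler_pXn2r _ 2) ?nnegrE // -normrX ger0_norm ?sqr_ge0 //.
  rewrite (_ : 3 ^+ 2 = 9 :> R); last by ring.
  apply: le_trans q9; rewrite /dot (bigD1 j) //= ord1 -expr2.
  by rewrite lerDl sumr_ge0 // => l _; rewrite -expr2 sqr_ge0.
rewrite (_ : [set q | _] = (fun q => dot q q) @^-1` [set x | x <= 9]) //.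
by apply: closed_comp; [move=> ? _; exact: dc | exact: closed_le].
Qed.

Lemma ball3_convex (p q : 'rV[R]_3) (t : R) : dot p p <= 9 -> dot q q <= 9 ->
  0 <= t <= 1 -> dot (p + t *: (q - p)) (p + t *: (q - p)) <= 9.
Proof.
move=> p9 q9 /andP[t0 t1].
have E : dot (p + t *: (q - p)) (p + t *: (q - p)) =
  (1 - t) * dot p p + t * dot q q - t * (1 - t) * dot (q - p) (q - p).
  by rewrite !dotE !mxE; ring.
rewrite E; have := dot_ge0 (q - p); move: (dot (q - p) _) => x x0.
have : 0 <= t * (1 - t) * x by rewrite mulr_ge0 // mulr_ge0 // subr_ge0.
nra.
Qed.

(** The Jacobian determinant does not vanish on the convex ball. *)
Lemma ball3_delta : exists delta : bool,
  forall p, dot p p <= 9 -> (\det (jac h' p) < 0) = delta.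
Proof.
exists (\det (jac h' 0) < 0) => p p9.
apply: (@nonvanishing_sign R (fun q => \det (jac h' q)) [set q | dot q q <= 9]) => //=.
- by move=> q /BV; exact: (det_jac_continuous hh).
- by move=> q /BV; exact: (det_jac_neq0 hh).
- by move=> q q' t; exact: ball3_convex.
- by rewrite dotE !mxE; lra.
Qed.

End Ball.

Section MoveFrame.
Variables (R : realType) (K : comNzRingType) (X : choiceType)
    (T : X -> X -> X -> X) (D D' : diagram R) (c c' : set 'rV[R]_3 -> X).
Variables (U V : set 'rV[R]_3) (h h' : 'rV[R]_3 -> 'rV[R]_3).
Hypotheses (hh : diffeo U V h h') (BV : [set q | dot q q <= 9] `<=` V).
Local Notation B := (h' @` [set q : 'rV[R]_3 | dot q q <= 9]).
Hypothesis same : forall y, ~ B y -> same_diagram_at D D' y.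
Hypothesis hagree : forall y : 'rV[R]_3, ~ B y -> ~ image3 D y ->
  c (region D y) = c' (region D' y).

Definition signed_chain (t : 'rV[R]_3 * bool * 4.-tuple X) : {freeg (4.-tuple X) / K} :=
  (if t.1.2 then 1 else -1) *: << t.2 >>.

Lemma hagree_sym y : ~ B y -> ~ image3 D' y -> c' (region D' y) = c (region D y).
Proof.
move=> By iy; apply/esym/hagree => //.
by have [E _ _ _] := same By; rewrite E.
Qed.

(** Only the triple points in the ball, listed in [s] and [s'], contribute to the
    difference of the chains.  If infinitely many triple points lie outside, both
    chains are zero by convention. *)
Lemma move_homologous (s s' : seq ('rV[R]_3 * bool * 4.-tuple X)) :
  uniq s -> uniq s' ->
  (forall t, B t.1.1 -> colored_triple_points D c t <-> t \in s) ->
  (forall t, B t.1.1 -> colored_triple_points D' c' t <-> t \in s') ->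
  {in s, forall t, B t.1.1} -> {in s', forall t, B t.1.1} ->
  (exists z : {freeg (5.-tuple X) / K}, @degenerate_chain X K T 2
     (\sum_(t <- s') signed_chain t - \sum_(t <- s) signed_chain t - boundary3 T z)) ->
  homologous T (diagram_chain K D c) (diagram_chain K D' c').
Proof.
move=> us us' Ds Ds' sB sB' [z hz].
have out t : ~ B t.1.1 -> colored_triple_points D c t <-> colored_triple_points D' c' t.
  move=> Bt; split.
    exact: (triple_points_outside (ball3_closed hh BV) same hagree Bt).
  apply: (triple_points_outside (ball3_closed hh BV) _ hagree_sym Bt).
  by move=> y /same; exact: same_diagram_sym.
have := @fsbig_diff _ _ (colored_triple_points D c) (colored_triple_points D' c')
  [set t | B t.1.1] s s' signed_chain us us' Ds Ds' sB sB' out.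
rewrite -[\sum_(i \in colored_triple_points D c) _]/(diagram_chain K D c).
rewrite -[\sum_(i \in colored_triple_points D' c') _]/(diagram_chain K D' c').
case=> E.
  by exists 0; rewrite E boundary3_0 subrr; exact: degenerate_chain0.
by exists z; rewrite E.
Qed.

(** The point is joined, by a short radial segment off both images, to a point
    outside the ball, where the colorings agree. *)
Lemma sphere_agree p : dot p p = 9 ->
  (\forall q \near p, ~ image3 D (h' q) /\ ~ image3 D' (h' q)) ->
  c (region D (h' p)) = c' (region D' (h' p)).
Proof.
move=> p9 off; have [[_ oV] _ VU _ _] := hh.
have Vp : V p by apply: BV; rewrite /= p9.
have p0 : p != 0 by apply/eqP => e; move: p9; rewrite e dotE !mxE; lra.
have : \forall q \near p, V q /\ (~ image3 D (h' q) /\ ~ image3 D' (h' q)).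
  near=> q; split; near: q => //; exact: open_nbhs_nbhs.
move=> /nbhs_ballP[r /= r0 Hr].
have np : 0 < `|p| by rewrite normr_gt0.
pose e := r / (2 * `|p|).
have e0 : 0 < e by rewrite divr_gt0 // mulr_gt0.
pose y (t : R) := p + t *: (e *: p).
have yb (t : R) : 0 <= t <= 1 -> ball p r (y t).
  move=> /andP[t0 t1]; rewrite -ball_normE /= /y opprD addNKr normrN normrZ normrZ.
  rewrite ger0_norm // (gtr0_norm e0).
  have -> : e * `|p| = r / 2 by rewrite /e; field; rewrite gt_eqF.
  by nra.
have yc : continuous y.
  move=> t; apply: cvgD; first exact: cvg_cst.
  by apply: cvgZr_tmp; exact: cvg_id.
have hyc (t : R) : 0 <= t <= 1 -> {for t, continuous (h' \o y)}.
  move=> t01; apply: continuous_comp; first exact: yc.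
  by apply: differentiable_continuous; apply: (diffeo_dif hh); case: (Hr _ (yb t t01)).
have path (E : diagram R) : (forall t : R, 0 <= t <= 1 -> ~ image3 E (h' (y t))) ->
    region E (h' p) = region E (h' (y 1)).
  move=> offE; have y0 : y 0 = p by rewrite /y scale0r addr0.
  have := @region_path R E (h' \o y) 0 1 ler01 _ offE.
  rewrite /= y0; apply.
  by apply: continuous_in_subspaceT => t; rewrite inE /= in_itv /=; exact: hyc.
rewrite (path D); last by move=> t /yb/Hr[_ []].
rewrite (path D'); last by move=> t /yb/Hr[_ []].
have y1 := Hr _ (yb 1 (introT andP (conj ler01 (lexx 1)))).
apply: hagree; last by case: y1 => _ [].
move=> [q /= q9 eq].
have qy : q = y 1.
  have := congr1 h eq; rewrite (VU _ (BV q9)).2.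
  by rewrite (VU _ y1.1).2.
move: q9; rewrite qy.
have -> : y 1 = (1 + e) *: p by rewrite /y scale1r scalerDl scale1r.
rewrite (_ : dot _ _ = (1 + e) ^+ 2 * dot p p); last by rewrite !dotE !mxE; ring.
by rewrite p9; nra.
Unshelve. all: by end_near. Qed.

End MoveFrame.

(** * Sheets that are graphs, and the bump function *)

Section Graph.
Variable R : realType.
Implicit Types (p w n L a b m : 'rV[R]_3) (u v : 'rV[R]_2).

Definition vec2 (x y : R) : 'rV[R]_2 := \row_(i < 2) tnth [tuple x; y] i.

Lemma vec2E0 x y : vec2 x y 0 0 = x. Proof. by rewrite mxE. Qed.
Lemma vec2E1 x y : vec2 x y 0 1 = y. Proof. by rewrite mxE. Qed.
Definition vec2E := (vec2E0, vec2E1).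

Definition graph_sheet n L1 L2 (phi : 'rV[R]_2 -> R^o) u : 'rV[R]_3 :=
  u 0 0 *: L1 + u 0 1 *: L2 + (phi u : R) *: n.

(** When [m, a, b] are the coordinate forms dual to the basis [n, L1, L2], the
    point [p] is on the sheet if and only if its coordinate along [n] is the value
    of [phi] at the two other ones. *)
Definition graph_eq m a b (phi : 'rV[R]_2 -> R^o) p : R^o :=
  dot m p - (phi (vec2 (dot a p) (dot b p)) : R).

Definition dual_basis n L1 L2 m a b := forall w,
  w = dot a w *: L1 + dot b w *: L2 + dot m w *: n.

Lemma dual_basis_coord n L1 L2 m a b x y z : det3 n L1 L2 != 0 ->
  dual_basis n L1 L2 m a b ->
  let w := x *: L1 + y *: L2 + z *: n in
  [/\ dot a w = x, dot b w = y & dot m w = z].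
Proof.
move=> d0 db w.
have E : (dot a w - x) *: L1 + (dot b w - y) *: L2 + (dot m w - z) *: n = 0.
  rewrite !scalerBl.
  have -> : forall A B C A' B' C' : 'rV[R]_3, A - A' + (B - B') + (C - C') =
    (A + B + C) - (A' + B' + C').
    by move=> A B C A' B' C'; rewrite [A - A' + _]addrACA [LHS]addrACA -!opprD.
  by rewrite -db -/w subrr.
split; apply/eqP; rewrite -subr_eq0; apply/eqP; apply: (mulIf d0); rewrite mul0r.
- have -> : (dot a w - x) * det3 n L1 L2 = det3 n
    ((dot a w - x) *: L1 + (dot b w - y) *: L2 + (dot m w - z) *: n) L2.
    by rewrite !det3E !mxE; ring.
  by rewrite E !det3E !mxE; ring.
- have -> : (dot b w - y) * det3 n L1 L2 = det3 n L1
    ((dot a w - x) *: L1 + (dot b w - y) *: L2 + (dot m w - z) *: n).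
    by rewrite !det3E !mxE; ring.
  by rewrite E !det3E !mxE; ring.
- have -> : (dot m w - z) * det3 n L1 L2 = det3
    ((dot a w - x) *: L1 + (dot b w - y) *: L2 + (dot m w - z) *: n) L1 L2.
    by rewrite !det3E !mxE; ring.
  by rewrite E !det3E !mxE; ring.
Qed.

Lemma coord_diff k (x : 'rV[R]_k) i :
  is_diff x (fun y : 'rV[R]_k => y 0 i : R^o) (fun y => y 0 i).
Proof.
apply: DiffDef; first exact: differentiable_coord.
have @f : {linear 'rV[R]_k -> R^o}.
  by exists (fun y : 'rV[R]_k => y 0 i); do 2![eexists]; do ?[constructor];
     rewrite ?mxE// => ? *; rewrite ?mxE//; move=> ?; rewrite !mxE.
by rewrite (_ : (fun _ => _) = f) // diff_lin //; exact: coord_continuous.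
Qed.

Lemma dot_diff a p : differentiable (fun q => dot a q : R^o) p /\
  'd (fun q => dot a q : R^o) p = dot a :> (_ -> _).
Proof.
have @f : {linear 'rV[R]_3 -> R^o}.
  exists (fun q => dot a q : R^o); do 2![eexists]; do ?[constructor].
  - by rewrite dotE !mxE !mulr0 !addr0.
  - by move=> x y; rewrite dotDr.
  - by move=> k x; rewrite dotZr.
have fc : continuous f.
  move=> q; rewrite (_ : f = (fun q : 'rV[R]_3 =>
    a 0 0 * q 0 0 + a 0 1 * q 0 1 + a 0 2 * q 0 2) :> (_ -> _)); last first.
    by apply/funext => x; rewrite /f /= dotE.
  have co i : {for q, continuous (fun q : 'rV[R]_3 => a 0 i * q 0 i : R)}.
    apply: (@continuousM R); first by move=> ?; exact: cst_continuous.
    exact: coord_continuous.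
  exact: (@continuousD R R^o _ _ _ _ (@continuousD R R^o _ _ _ _ (co 0) (co 1)) (co 2)).
rewrite (_ : (fun q => _) = f) //.
by split; [exact: linear_differentiable|rewrite diff_lin].
Qed.

Definition proj2 a b p := vec2 (dot a p) (dot b p).

Lemma proj2_diff a b p : differentiable (proj2 a b) p /\
  'd (proj2 a b) p = proj2 a b :> (_ -> _).
Proof.
have [da dda] := dot_diff a p; have [db ddb] := dot_diff b p.
have E : proj2 a b = (fun q => (dot a q : R^o) *: vec2 1 0) +
    (fun q => (dot b q : R^o) *: vec2 0 1).
  apply/funext => q; apply: vec2_ext; rewrite /proj2 !mxE /= !(tnth_nth 0) /=; ring.
have d1 : differentiable (fun q => (dot a q : R^o) *: vec2 1 0) p.
  exact: differentiableZl.
have d2 : differentiable (fun q => (dot b q : R^o) *: vec2 0 1) p.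
  exact: differentiableZl.
split; first by rewrite E; exact: differentiableD.
apply/funext => w.
have e1 : 'd (fun q => (dot a q : R^o) *: vec2 1 0) p w = dot a w *: vec2 1 0.
  by have := congr1 (fun F : _ -> _ => F w) (diffZl (vec2 1 0) da); rewrite dda.
have e2 : 'd (fun q => (dot b q : R^o) *: vec2 0 1) p w = dot b w *: vec2 0 1.
  by have := congr1 (fun F : _ -> _ => F w) (diffZl (vec2 0 1) db); rewrite ddb.
have e3 := congr1 (fun F : _ -> _ => F w) (diffD d1 d2).
have -> : proj2 a b w = dot a w *: vec2 1 0 + dot b w *: vec2 0 1 by rewrite E.
exact: (etrans (congr1 (fun g : _ -> _ => 'd g p w) E) (etrans e3 (congr2 +%R e1 e2))).
Qed.

Section OneSheet.
Variables (n L1 L2 m a b : 'rV[R]_3) (phi : 'rV[R]_2 -> R^o).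
Hypothesis db : dual_basis n L1 L2 m a b.
Hypothesis det0 : det3 n L1 L2 != 0.
Local Notation f := (graph_sheet n L1 L2 phi).
Local Notation G := (graph_eq m a b phi).

Lemma graph_sheetP u p : f u = p <-> u = vec2 (dot a p) (dot b p) /\ G p = 0.
Proof.
split=> [<-|[-> Gp]].
  have [ea eb em] := dual_basis_coord (u 0 0) (u 0 1) (phi u : R) det0 db.
  rewrite /graph_eq /graph_sheet ea eb em.
  have -> : vec2 (u 0 0) (u 0 1) = u by apply: vec2_ext; rewrite vec2E.
  by split => //; exact: subrr.
rewrite [RHS]db /graph_sheet !vec2E; congr (_ + _ *: _).
by apply/esym/eqP; rewrite -subr_eq0; apply/eqP.
Qed.

Lemma graph_sheet_diff u (w : 'rV[R]_2) : differentiable phi u -> differentiable f u /\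
  'd f u w = w 0 0 *: L1 + w 0 1 *: L2 + ('d phi u w : R) *: n.
Proof.
move=> dphi.
pose c i : 'rV[R]_2 -> R^o := fun v => v 0 i.
have dc i : differentiable (c i) u by exact: differentiable_coord.
have cE i : 'd (c i) u w = w 0 i.
  exact: (congr1 (fun F : _ -> _ => F w) (@diff_val _ _ _ _ _ _ _ (coord_diff u i))).
have d1 : differentiable (fun v => c 0 v *: L1) u by exact: differentiableZl.
have d2 : differentiable (fun v => c 1 v *: L2) u by exact: differentiableZl.
have d3 : differentiable (fun v => phi v *: n) u by exact: differentiableZl.
have d12 : differentiable ((fun v => c 0 v *: L1) + (fun v => c 1 v *: L2)) u.
  exact: differentiableD.
split; first exact: (differentiableD d12 d3).
have e1 : 'd (fun v => c 0 v *: L1) u w = w 0 0 *: L1.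
  by have := congr1 (fun F : _ -> _ => F w) (diffZl L1 (dc 0)); rewrite cE.
have e2 : 'd (fun v => c 1 v *: L2) u w = w 0 1 *: L2.
  by have := congr1 (fun F : _ -> _ => F w) (diffZl L2 (dc 1)); rewrite cE.
have e3 : 'd (fun v => phi v *: n) u w = ('d phi u w : R) *: n.
  exact: (congr1 (fun F : _ -> _ => F w) (diffZl n dphi)).
have e12 := congr1 (fun F : _ -> _ => F w) (diffD d1 d2).
have e123 := congr1 (fun F : _ -> _ => F w) (diffD d12 d3).
exact: (etrans e123 (congr2 +%R (etrans e12 (congr2 +%R e1 e2)) e3)).
Qed.

Lemma graph_eq_diff p w : differentiable phi (proj2 a b p) ->
  differentiable G p /\
  'd G p w = dot m w - ('d phi (proj2 a b p) (proj2 a b w) : R).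
Proof.
move=> dphi.
have [dm ddm] := dot_diff m p; have [dp ddp] := proj2_diff a b p.
have dc : differentiable (phi \o proj2 a b) p by exact: differentiable_comp.
split; first exact: (differentiableB dm dc).
have e1 : 'd (fun q => dot m q : R^o) p w = dot m w by rewrite ddm.
have e2 : 'd (phi \o proj2 a b) p w = 'd phi (proj2 a b p) (proj2 a b w).
  have := congr1 (fun F : _ -> _ => F w) (diff_comp dp dphi).
  by rewrite [in X in _ = X -> _]/= ddp.
have e12 := congr1 (fun F : _ -> _ => F w) (diffB dm dc).
exact: (etrans e12 (congr2 (fun x y : R^o => x - y) e1 e2)).
Qed.

Lemma graph_eq_grad (e : bool) p w : differentiable phi (proj2 a b p) ->
  dot (grad (fun p => (-1) ^+ e * (G p : R) : R^o) p) w =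
    (-1) ^+ e * (dot m w - ('d phi (proj2 a b p) (proj2 a b w) : R)).
Proof.
move=> dphi; rewrite -gradE.
have [dG dGw] := graph_eq_diff w dphi.
apply: (etrans (congr1 (fun F : _ -> _ => F w) (diffZ ((-1) ^+ e) dG))).
by rewrite /= dGw.
Qed.

(** The normal of the graph is a multiple of the gradient of its equation, with
    the constant factor [det3 n L1 L2]. *)
Lemma graph_sheet_co_oriented (e : bool) u : differentiable phi u ->
  0 < (-1) ^+ e * det3 n L1 L2 ->
  co_oriented f u (fun p => (-1) ^+ e * (G p : R) : R^o).
Proof.
move=> dphi e0.
have [pu Gu] : u = proj2 a b (f u) /\ G (f u) = 0 by apply/graph_sheetP.
have dphi' : differentiable phi (proj2 a b (f u)) by rewrite -pu.
have GE : (fun p => (-1) ^+ e * (G p : R) : R^o) = ((-1) ^+ e : R) *: G by [].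
have [dG _] := graph_eq_diff 0 dphi'.
have [df _] := graph_sheet_diff 0 dphi.
split; first exact: df.
- by rewrite GE; exact: differentiableZ.
- by rewrite [G _]Gu mulr0.
exists ((-1) ^+ e * det3 n L1 L2) => // w.
have [_ d1] := graph_sheet_diff (delta_mx 0 0) dphi.
have [_ d2] := graph_sheet_diff (delta_mx 0 1) dphi.
rewrite d1 d2 !mxE /= !scale1r !scale0r addr0 add0r.
have -> : dot (grad (fun p => (-1) ^+ e * (G p : R) : R^o) (f u)) w =
    (-1) ^+ e * (dot m w - ('d phi u (proj2 a b w) : R)).
  apply: (etrans (graph_eq_grad e w dphi')).
  exact: (congr1 (fun v => (-1) ^+ e * (dot m w - ('d phi v (proj2 a b w) : R))) (esym pu)).
have -> : 'd phi u (proj2 a b w) = dot a w * ('d phi u (delta_mx 0 0) : R) +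
   dot b w * ('d phi u (delta_mx 0 1) : R) :> R.
  have -> : proj2 a b w = dot a w *: delta_mx 0 0 + dot b w *: delta_mx 0 1.
    by apply: vec2_ext; rewrite /proj2 !mxE /= !(tnth_nth 0) /=; ring.
  by rewrite linearD !linearZ.
move: ('d phi u _ : R) ('d phi u _ : R) => t1 t2.
rewrite {1}(db w).
move: (dot a w) (dot b w) (dot m w) => x y z.
have ee : ((-1) ^+ e * (-1) ^+ e : R) = 1 by rewrite -expr2 sqrr_sign.
move: ((-1) ^+ e) ee => s ss.
rewrite -[LHS]mul1r -ss !det3E !mxE; ring.
Qed.

End OneSheet.
End Graph.

Section Bump.
Variables (R : realType) (beta : R^o -> R^o).
Hypothesis hb : Defs.bump beta.

Lemma bump_ge0 (t : R) : 0 <= t -> 0 <= (beta t : R).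
Proof.
case: hb => _ _ dec van t0.
have [t1|t1] := leP 1 t; first by rewrite van.
by rewrite -(van 1 (lexx 1)); apply: dec => //; exact: ltW.
Qed.

Lemma bump_le1 (t : R) : 0 <= t -> (beta t : R) <= 1.
Proof.
case: hb => _ /andP[_ b1] dec van t0.
by apply: le_trans b1; exact: dec.
Qed.

Lemma bump_gt0 : 0 < (beta 0 : R). Proof. by case: hb => _ /andP[]. Qed.

Lemma bump_dif (t : R) : differentiable beta t.
Proof. by case: hb => s _ _ _; exact: (s [::] t I). Qed.

Lemma bump_dec (s t : R) : 0 <= s -> s <= t -> (beta t : R) <= (beta s : R).
Proof. by case: hb => _ _ + _; exact. Qed.

Lemma bump_out (t : R) : 1 <= t -> beta t = 0.
Proof. by case: hb => _ _ _; exact. Qed.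

(** A positive slope would contradict monotonicity. *)
Lemma bump_slope (t : R) : 0 < t -> ('d beta t 1 : R) <= 0.
Proof.
move=> t0; rewrite leNgt; apply/negP => d0.
pose g : R^o -> R^o := beta - cst (beta t).
have db := bump_dif t.
have dc : differentiable (cst (beta t) : R^o -> R^o) t by exact: differentiable_cst.
have dg : differentiable g t by exact: differentiableB.
have gt : g t = 0 by exact: subrr.
have g1 : 0 < ('d g t 1 : R).
  have e1 : 'd g t 1 = 'd beta t 1 - 'd (cst (beta t) : R^o -> R^o) t 1.
    exact: (congr1 (fun F : _ -> _ => F 1) (diffB db dc)).
  have e2 : 'd (cst (beta t) : R^o -> R^o) t 1 = 0.
    exact: (congr1 (fun F : _ -> _ => F 1) (diff_cst (beta t) t)).
  have e3 : 'd g t 1 = 'd beta t 1.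
    exact: (etrans e1 (etrans (congr1 (fun x => 'd beta t 1 - x) e2) (subr0 _))).
  exact: (eq_ind_r (fun x : R^o => 0 < (x : R)) d0 e3).
have H := ray_pos dg gt g1.
near (0 : R)^'+ => e.
have : 0 < (g (t + e *: (1 : R^o)) : R) by near: e; exact: H.
have e0 : 0 < e by near: e; exact: nbhs_right_gt.
have := @bump_dec t (t + e) (ltW t0); rewrite lerDl ltW // => /(_ isT).
rewrite /g /=.
have -> : (t + e *: (1 : R^o)) = t + e :> R by rewrite /GRing.scale /= mulr1.
rewrite -[((beta - cst (beta t)) (t + e) : R)]/((beta (t + e) : R) - beta t).
by rewrite subr_gt0 => /le_lt_trans /[apply]; rewrite ltxx.
Unshelve. all: by end_near. Qed.

Definition radial (u : 'rV[R]_2) : R^o := beta (u 0 0 ^+ 2 + u 0 1 ^+ 2).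

(** The chain rule, stated with values in [R] rather than in [R^o]. *)
Definition radial_diff_spec (u w : 'rV[R]_2) (d : R^o) : Prop :=
  d = 2 * (u 0 0 * w 0 0 + u 0 1 * w 0 1) *
    ('d beta (u 0 0 ^+ 2 + u 0 1 ^+ 2) 1 : R).

Lemma radial_diff (u w : 'rV[R]_2) : differentiable radial u /\
  radial_diff_spec u w ('d radial u w).
Proof.
pose c i : 'rV[R]_2 -> R^o := fun v => v 0 i.
have dc i : differentiable (c i) u by exact: differentiable_coord.
have cE i : 'd (c i) u w = w 0 i.
  exact: (congr1 (fun F : _ -> _ => F w) (@diff_val _ _ _ _ _ _ _ (coord_diff u i))).
have d1 : differentiable (c 0 * c 0 + c 1 * c 1) u.
  by apply: differentiableD; exact: differentiableM.
have E : radial = beta \o (c 0 * c 0 + c 1 * c 1).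
  by apply/funext => v; rewrite /radial /= !expr2.
have Eu : (c 0 * c 0 + c 1 * c 1) u = u 0 0 ^+ 2 + u 0 1 ^+ 2 :> R.
  by rewrite /= !expr2.
have db : differentiable beta ((c 0 * c 0 + c 1 * c 1) u) by exact: bump_dif.
have dsq := differentiable_comp d1 db.
split; first by rewrite E; exact: dsq.
have m0 : differentiable (c 0 * c 0) u by exact: differentiableM.
have m1 : differentiable (c 1 * c 1) u by exact: differentiableM.
have e0 i : 'd (c i * c i) u w = u 0 i * w 0 i + u 0 i * w 0 i :> R.
  have E0 := congr1 (fun F : _ -> _ => F w) (diffM (dc i) (dc i)).
  apply: (etrans E0).
  exact: (congr2 (fun x y : R => u 0 i * x + u 0 i * y) (cE i) (cE i)).
have e1 : 'd (c 0 * c 0 + c 1 * c 1) u w =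
    2 * (u 0 0 * w 0 0 + u 0 1 * w 0 1) :> R.
  apply: (etrans (congr1 (fun F : _ -> _ => F w) (diffD m0 m1))).
  by apply: (etrans (congr2 +%R (e0 0) (e0 1))); ring.
have e2 := congr1 (fun F : _ -> _ => F w) (diff_comp d1 db).
have lb (x s : R^o) : 'd beta s x = x *: 'd beta s 1.
  by rewrite -linearZ /GRing.scale /= mulr1.
have e3 : 'd radial u w = 'd (beta \o (c 0 * c 0 + c 1 * c 1)) u w.
  exact: (congr1 (fun g : _ -> _ => 'd g u w) E).
apply: (etrans e3); apply: (etrans e2).
apply: (etrans (lb _ _)); rewrite /GRing.scale /=.
by congr (_ * _) => //; rewrite Eu.
Qed.

Lemma radial_slope (u : 'rV[R]_2) : ('d radial u u : R) <= 0.
Proof.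
have [_ ->] := radial_diff u u.
rewrite -!expr2; set q := u 0 0 ^+ 2 + _.
have q0 : 0 <= q by rewrite addr_ge0 ?sqr_ge0.
have [q1|q1] := ltP 0 q; last by rewrite (le_anti (introT andP (conj q1 q0))) mulr0 mul0r.
by apply: mulr_ge0_le0; [rewrite mulr_ge0 | exact: bump_slope].
Qed.

End Bump.

(** * The four-dimensional cube *)

Section Cube.
Variables (K : comNzRingType) (X : choiceType) (T : X -> X -> X -> X).
Variable F : bool -> bool -> bool -> bool -> X.
Local Notation O := false.
Local Notation I := true.
Hypothesis F01 : forall s t, F O I s t = T (F O O s t) (F I O s t) (F I I s t).
Hypothesis F02 : forall s t, F O s I t = T (F O s O t) (F I s O t) (F I s I t).
Hypothesis F03 : forall s t, F O s t I = T (F O s t O) (F I s t O) (F I s t I).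
Hypothesis F12 : forall s t, F s O I t = T (F s O O t) (F s I O t) (F s I I t).
Hypothesis F13 : forall s t, F s O t I = T (F s O t O) (F s I t O) (F s I t I).
Hypothesis F23 : forall s t, F s t O I = T (F s t O O) (F s t I O) (F s t I I).

(** The colored path of a triple point on the facet where the [r]-th coordinate
    is [b]: the other coordinates are switched on in the order of their indices. *)
Definition facet (r : nat) (b : bool) : 4.-tuple X :=
  match r with
  | 0%N => [tuple F b O O O; F b I O O; F b I I O; F b I I I]
  | 1%N => [tuple F O b O O; F I b O O; F I b I O; F I b I I]
  | 2%N => [tuple F O O b O; F I O b O; F I I b O; F I I b I]
  | _ => [tuple F O O O b; F I O O b; F I I O b; F I I I b]
  end.

(** Here [F] gives the colors of the 16 regions cut out by four sheets, ordered by
    height from the bottom one, a coordinate telling on which side of a sheet the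
    region lies.  The coloring rule at the double lines computes all the colors
    which occur in the facets from the five ones along the main path, and the
    eight terms of the boundary of this path are the paths of the eight facets. *)
Lemma cube_boundary :
  boundary3_gen K T [tuple F O O O O; F I O O O; F I I O O; F I I I O; F I I I I] =
  \sum_(r < 4) (-1) ^+ r *:
    (<< facet r true >> - << facet r false >> : {freeg (4.-tuple X) / K}).
Proof.
rewrite !big_ord_recl big_ord0 /boundary3_gen !(tnth_nth (F O O O O)) /=.
rewrite /= !expr0 !expr1 !scale1r /bump /= expr2 mulrNN mulr1 scale1r.
rewrite [(-1) ^+ (1 + _)]exprS expr2 mulrNN !mulr1 !scaleN1r.
rewrite !(F03, F13, F23, F02, F12, F01) addr0 !opprB !addrA.
by rewrite [LHS]addrAC [X in X + _ - _ + _ - _]addrAC.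
Qed.

End Cube.

(** Comparing faces: in a quasigroup three corners of a face determine the
    fourth one. *)
Lemma face_corner (X : Type) (T : X -> X -> X -> X) (F F' : bool -> bool -> X) :
  ternary_quasigroup T ->
  F false true = T (F false false) (F true false) (F true true) ->
  F' false true = T (F' false false) (F' true false) (F' true true) ->
  forall s t, (forall s' t', (s', t') <> (s, t) -> F s' t' = F' s' t') ->
  F s t = F' s t.
Proof.
move=> [q1 q2 q3] e e' [] [] E.
- have [x [_ u]] := q3 (F false false) (F true false) (F false true).
  rewrite -(u (F true true)); last exact/esym.
  by apply: u; rewrite [F false false]E // [F true false]E // [F false true]E.
- have [x [_ u]] := q2 (F false false) (F true true) (F false true).
  rewrite -(u (F true false)); last exact/esym.
  by apply: u; rewrite [F false false]E // [F true true]E // [F false true]E.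
- by rewrite e e' [F false false]E // [F true false]E // [F true true]E.
- have [x [_ u]] := q1 (F true false) (F true true) (F false true).
  rewrite -(u (F false false)); last exact/esym.
  by apply: u; rewrite [F true false]E // [F true true]E // [F false true]E.
Qed.

(** Signs of the determinants of the normals of three of four planes, the
    fourth normal being a positive combination of the first three. *)
Section DetSigns.
Variable R : realType.

(** The normals of the coordinate planes and of a fourth sheet. *)
Definition tetra_normal (g : 'rV[R]_3) (j : nat) : 'rV[R]_3 :=
  match j with
  | 0%N => vec3 1 0 0 | 1%N => vec3 0 1 0 | 2%N => vec3 0 0 1 | _ => g
  end.

(** The sign of the permutation ordering the three normals [x, y, z], corrected by
    the sign with which the [i]-th coordinate appears when the fourth normal
    replaces the [i]-th one. *)
Definition tetra_det_pos (i x y z : nat) : bool :=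
  ~~ ((i == 1)%N (+) (y < x)%N (+) (z < x)%N (+) (z < y)%N).

Lemma tetra_det_sign (g : 'rV[R]_3) (i x y z : 'I_4) :
  uniq [:: i; x; y; z] ->
  (i != 3 :> nat -> 0 < g 0 (inord i)) ->
  pos_if (tetra_det_pos i x y z)
    (det3 (tetra_normal g x) (tetra_normal g y) (tetra_normal g z)).
Proof.
have e0 : inord 0 = 0 :> 'I_3 by apply: val_inj; rewrite /= inordK.
have e1 : inord 1 = 1 :> 'I_3 by apply: val_inj; rewrite /= inordK.
have e2 : inord 2 = 2 :> 'I_3 by apply: val_inj; rewrite /= inordK.
case: i => -[|[|[|[|//]]]] i4; case: x => -[|[|[|[|//]]]] x4;
 case: y => -[|[|[|[|//]]]] y4; case: z => -[|[|[|[|//]]]] z4 //= _;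
 rewrite ?e0 ?e1 ?e2 => gi; rewrite /pos_if /tetra_det_pos /= !det3E !vec3E;
 rewrite !(mulr0, mul0r, mulr1, mul1r, subr0, sub0r, addr0, add0r, oppr_gt0,
   oppr_lt0, mulrN, mulNr, opprK, oppr0, ltr01, ltrN10) ?gi //.
Qed.

(** Removing the [r]-th of four planes: the sign of the remaining determinant
    alternates with [r], up to the orientation of the relation between normals. *)
Lemma tetra_sign_const (j0 j1 j2 j3 : 'I_4) : uniq [:: j0; j1; j2; j3] ->
  exists s : bool, [/\ tetra_det_pos j0 j3 j2 j1 (+) (j0 == 3 :> nat) = s,
    tetra_det_pos j1 j3 j2 j0 (+) (j1 == 3 :> nat) = ~~ s,
    tetra_det_pos j2 j3 j1 j0 (+) (j2 == 3 :> nat) = s &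
    tetra_det_pos j3 j2 j1 j0 (+) (j3 == 3 :> nat) = ~~ s].
Proof.
move=> u; exists (tetra_det_pos j0 j3 j2 j1 (+) (j0 == 3 :> nat)); move: u.
case: j0 => -[|[|[|[|//]]]] i4; case: j1 => -[|[|[|[|//]]]] x4;
 case: j2 => -[|[|[|[|//]]]] y4; case: j3 => -[|[|[|[|//]]]] z4 //.
Qed.

End DetSigns.

Section CubeGlue.
Variables (K : comNzRingType) (X : choiceType) (T : X -> X -> X -> X).

(** Functions on the vertices of the cube, as functions of four booleans. *)
Definition on_bits (G : ('I_4 -> bool) -> X) t0 t1 t2 t3 : X :=
  G (fun r : 'I_4 => nth false [:: t0; t1; t2; t3] r).

(** The coloring rule at a double line of the sheets [a] below and [b] above; the
    sides of the other sheets are those in [t]. *)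
Definition face_at (G : ('I_4 -> bool) -> X) (a b : 'I_4) (t : 'I_4 -> bool) :=
  let g x y := G (fun r => if r == a then x else if r == b then y else t r) in
  g false true = T (g false false) (g true false) (g true true).

Variables (G G' : ('I_4 -> bool) -> X) (m sgn : 'I_4 -> bool) (s : bool).
Hypothesis agree : forall t, (exists r, t r != m r) -> (exists r, t r = m r) -> G t = G' t.
Hypothesis faces : forall (a b : 'I_4) t, (a < b)%N ->
  (exists r, [/\ r != a, r != b & t r != m r]) -> face_at G a b t.
Hypothesis faces' : forall (a b : 'I_4) t, (a < b)%N ->
  (exists r, [/\ r != a, r != b & t r = m r]) -> face_at G' a b t.
Hypothesis sgnE : forall r, sgn r (+) m r (+) odd r = s.

(** [G] has no meaningful value at the vertex [m], nor [G'] at the opposite one. *)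
Definition cube_glue t := if [forall r, t r == m r] then G' t else G t.

Lemma glueG t : (exists r, t r != m r) -> cube_glue t = G t.
Proof.
by move=> [r rm]; rewrite /cube_glue; case: forallP => // /(_ r); rewrite (negbTE rm).
Qed.

Lemma glueG' t : (exists r, t r = m r) -> cube_glue t = G' t.
Proof.
move=> er; rewrite /cube_glue; case: ifPn => // /forallPn[r rm].
by apply: agree => //; exists r.
Qed.

(** No square face contains both [m] and the opposite vertex, so each face comes
    entirely from [G] or entirely from [G']. *)
Lemma glue_face (a b : 'I_4) t : (a < b)%N -> face_at cube_glue a b t.
Proof.
move=> ab; rewrite /face_at /=.
have [r /and3P[ra rb rm]|none] := pickP (fun r => [&& r != a, r != b & t r != m r]).
  have gE x y : cube_glue (fun r => if r == a then x else if r == b then y else t r) =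
    G (fun r => if r == a then x else if r == b then y else t r).
    by apply: glueG; exists r; rewrite (negbTE ra) (negbTE rb).
  by rewrite !gE; apply: faces => //; exists r.
have [r ra rb] : exists2 r : 'I_4, r != a & r != b.
  exists (if (0 != a) && (0 != b) then 0 else if (1 != a) && (1 != b) then 1 else 2 : 'I_4).
    by case: (a) ab none => -[|[|[|[|//]]]] ?; case: (b) => -[|[|[|[|//]]]] ?.
  by case: (a) ab none => -[|[|[|[|//]]]] ?; case: (b) => -[|[|[|[|//]]]] ?.
have rm : t r = m r by have := none r; rewrite ra rb /= => /negbFE/eqP.
have gE x y : cube_glue (fun r => if r == a then x else if r == b then y else t r) =
  G' (fun r => if r == a then x else if r == b then y else t r).
  by apply: glueG'; exists r; rewrite (negbTE ra) (negbTE rb).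
by rewrite !gE; apply: faces' => //; exists r; split.
Qed.

Local Notation F := (on_bits cube_glue).

Lemma on_bits_face (a b : 'I_4) (t : 'I_4 -> bool) : (a < b)%N ->
  forall x0 x1 x2 x3 y0 y1 y2 y3 z0 z1 z2 z3 w0 w1 w2 w3,
  (forall r : 'I_4, nth false [:: x0; x1; x2; x3] r =
    if r == a then false else if r == b then true else t r) ->
  (forall r : 'I_4, nth false [:: y0; y1; y2; y3] r =
    if r == a then false else if r == b then false else t r) ->
  (forall r : 'I_4, nth false [:: z0; z1; z2; z3] r =
    if r == a then true else if r == b then false else t r) ->
  (forall r : 'I_4, nth false [:: w0; w1; w2; w3] r =
    if r == a then true else if r == b then true else t r) ->
  F x0 x1 x2 x3 = T (F y0 y1 y2 y3) (F z0 z1 z2 z3) (F w0 w1 w2 w3).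
Proof.
move=> ab x0 x1 x2 x3 y0 y1 y2 y3 z0 z1 z2 z3 w0 w1 w2 w3 ex ey ez ew.
rewrite /on_bits (funext ex) (funext ey) (funext ez) (funext ew).
exact: (glue_face t ab).
Qed.

Lemma facet_eq (H H' : ('I_4 -> bool) -> X) (r : 'I_4) b :
  (forall t : 'I_4 -> bool, t r = b -> H t = H' t) ->
  facet (on_bits H) r b = facet (on_bits H') r b.
Proof.
by move=> E; case: r E => -[|[|[|[|//]]]] r4 E; apply: val_inj; rewrite /= /on_bits !E.
Qed.

(** The facets not containing [m] are those of [G], the opposite ones contain [m]
    and are those of [G']; by [sgnE] their signs are the alternating signs of the
    boundary of the cube. *)
Lemma glue_boundary :
  \sum_(r < 4) (if sgn r then 1 else -1 : K) *: << facet (on_bits G') r (m r) >>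
  - \sum_(r < 4) (if sgn r then 1 else -1 : K) *: << facet (on_bits G) r (~~ m r) >>
  = (-1) ^+ s *: boundary3_gen K T
     [tuple F false false false false; F true false false false;
       F true true false false; F true true true false; F true true true true].
Proof.
rewrite (@cube_boundary K X T F); first last.
all: try by move=> x y; apply: (@on_bits_face 2 3 (fun r => nth false [:: x; y; false; false] r)) => // -[[|[|[|[|//]]]] ?].
all: try by move=> x y; apply: (@on_bits_face 1 3 (fun r => nth false [:: x; false; y; false] r)) => // -[[|[|[|[|//]]]] ?].
all: try by move=> x y; apply: (@on_bits_face 1 2 (fun r => nth false [:: x; false; false; y] r)) => // -[[|[|[|[|//]]]] ?].
all: try by move=> x y; apply: (@on_bits_face 0 3 (fun r => nth false [:: false; x; y; false] r)) => // -[[|[|[|[|//]]]] ?].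
all: try by move=> x y; apply: (@on_bits_face 0 2 (fun r => nth false [:: false; x; false; y] r)) => // -[[|[|[|[|//]]]] ?].
all: try by move=> x y; apply: (@on_bits_face 0 1 (fun r => nth false [:: false; false; x; y] r)) => // -[[|[|[|[|//]]]] ?].
rewrite scaler_sumr -sumrB; apply: eq_bigr => r _.
have -> : facet (on_bits G) r (~~ m r) = facet F r (~~ m r).
  by apply: facet_eq => t tr; rewrite glueG //; exists r; rewrite tr; case: (m r).
have -> : facet (on_bits G') r (m r) = facet F r (m r).
  by apply: facet_eq => t tr; rewrite glueG' //; exists r.
rewrite scalerA -(sgnE r) -[(-1) ^+ (r : nat)]signr_odd -signr_addb -scalerBr.
case: (sgn r); case: (m r); case: (odd r); rewrite ?scale1r ?scaleN1r ?opprB //.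
Qed.

End CubeGlue.

(** * Tetrahedral move: sheets and connectedness of the sides *)

(** The four sheets as graphs: normal direction, a basis of the plane of
    parameters, and the dual basis. *)
Section TetraSheets.
Variables (R : realType).

Definition tet_n (j : nat) : 'rV[R]_3 := match j with
  | 0%N => vec3 1 0 0 | 1%N => vec3 0 1 0 | 2%N => vec3 0 0 1
  | _ => vec3 3^-1 3^-1 3^-1 end.
Definition tet_L1 (j : nat) : 'rV[R]_3 := match j with
  | 0%N => vec3 0 1 0 | 1%N => vec3 1 0 0 | 2%N => vec3 1 0 0
  | _ => vec3 1 0 (-1) end.
Definition tet_L2 (j : nat) : 'rV[R]_3 := match j with
  | 0%N => vec3 0 0 1 | 1%N => vec3 0 0 1 | 2%N => vec3 0 1 0
  | _ => vec3 0 1 (-1) end.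
Definition tet_m (j : nat) : 'rV[R]_3 := match j with
  | 0%N => vec3 1 0 0 | 1%N => vec3 0 1 0 | 2%N => vec3 0 0 1
  | _ => vec3 1 1 1 end.
Definition tet_a (j : nat) : 'rV[R]_3 := match j with
  | 0%N => vec3 0 1 0 | 1%N => vec3 1 0 0 | 2%N => vec3 1 0 0
  | _ => vec3 (2 / 3) (- 3^-1) (- 3^-1) end.
Definition tet_b (j : nat) : 'rV[R]_3 := match j with
  | 0%N => vec3 0 0 1 | 1%N => vec3 0 0 1 | 2%N => vec3 0 1 0
  | _ => vec3 (- 3^-1) (2 / 3) (- 3^-1) end.

Lemma tet_dual j :
  dual_basis (tet_n j) (tet_L1 j) (tet_L2 j) (tet_m j) (tet_a j) (tet_b j).
Proof.
move=> w; case: j => [|[|[|j]]]; apply: vec3_ext;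
  rewrite /= !mxE !dotE !vec3E /= !(tnth_nth 0) /=; by field.
Qed.

Lemma tet_det j : 0 < (-1) ^+ (j == 1)%N * det3 (tet_n j) (tet_L1 j) (tet_L2 j).
Proof.
case: j => [|[|[|j]]]; rewrite /= ?expr0 ?expr1 !det3E !vec3E; lra.
Qed.

Lemma tet_det_neq0 j : det3 (tet_n j) (tet_L1 j) (tet_L2 j) != 0.
Proof.
by have := tet_det j; apply: contraTneq => ->; rewrite mulr0 ltxx.
Qed.

Variable (beta : R^o -> R^o).

Definition tet_phi (side : bool) (j : nat) (u : 'rV[R]_2) : R^o :=
  match j with 0%N | 1%N | 2%N => 0
  | _ => (if side then (radial beta u : R) else - (radial beta u : R)) end.

Lemma tet_sheetE side (j : 'I_4) u :
  @side_sheet R beta Tetrahedral side j u =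
  graph_sheet (tet_n j) (tet_L1 j) (tet_L2 j) (tet_phi side j) u.
Proof.
rewrite /side_sheet /graph_sheet /tet_phi -/(radial beta u).
case: j => -[|[|[|[|//]]]] j4 /=; apply: vec3_ext;
  rewrite !mxE /= !(tnth_nth 0) /=; case: side; by field.
Qed.

Definition tet_eq side j : 'rV[R]_3 -> R^o :=
  graph_eq (tet_m j) (tet_a j) (tet_b j) (tet_phi side j).

Hypothesis hb : Defs.bump beta.

Lemma tet_phi_dif side j u : differentiable (tet_phi side j) u.
Proof.
have [d _] := radial_diff hb u 0.
case: j => [|[|[|j]]]; rewrite /tet_phi; try exact: differentiable_cst.
case: side => //; exact: differentiableN.
Qed.

Lemma tet_eq_dif side j p : differentiable (tet_eq side j) p.
Proof.
by have [] := @graph_eq_diff R (tet_m j) (tet_a j) (tet_b j) (tet_phi side j) p 0 (tet_phi_dif _ _ _).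
Qed.

End TetraSheets.

Section TetraHat.
Variables (R : realType) (beta : R^o -> R^o).
Hypothesis hb : Defs.bump beta.
Implicit Types (P Q d : 'rV[R]_3).

(** With [tsum], [tquad] and [tgap] the fourth sheet on the side [t > 0] is the zero
    set of [tgap]: [tquad] is the value of [a ^ 2 + b ^ 2] at the parameters of the
    projection along the diagonal. *)
Definition tsum P : R := P 0 0 + P 0 1 + P 0 2.
Definition tquad P : R :=
  ((2 * P 0 0 - P 0 1 - P 0 2) / 3) ^+ 2 + ((2 * P 0 1 - P 0 0 - P 0 2) / 3) ^+ 2.
Definition tgap P : R := tsum P - (beta (tquad P) : R).

Lemma tsumZ k P : tsum (k *: P) = k * tsum P.
Proof. by rewrite /tsum !mxE; ring. Qed.
Lemma tquadZ k P : tquad (k *: P) = k ^+ 2 * tquad P.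
Proof. by rewrite /tquad !mxE; ring. Qed.
Lemma tquad_ge0 P : 0 <= tquad P.
Proof. by rewrite addr_ge0 ?sqr_ge0. Qed.
Lemma dotZZ k P : dot (k *: P) (k *: P) = k ^+ 2 * dot P P.
Proof. by rewrite !dotE !mxE; ring. Qed.

Lemma tgap_le_sum P : tgap P <= tsum P.
Proof. by rewrite /tgap gerBl (bump_ge0 hb) ?tquad_ge0. Qed.

Lemma beta_shrink k P : 0 <= k <= 1 ->
  (beta (tquad P) : R) <= (beta (tquad (k *: P)) : R).
Proof.
move=> /andP[k0 k1]; apply: (bump_dec hb); rewrite ?tquad_ge0 // tquadZ.
by rewrite ler_piMl ?tquad_ge0 // expr_le1.
Qed.

Lemma beta_grow k P : 1 <= k ->
  (beta (tquad (k *: P)) : R) <= (beta (tquad P) : R).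
Proof.
move=> k1; apply: (bump_dec hb); rewrite ?tquad_ge0 // tquadZ.
by rewrite ler_peMl ?tquad_ge0 // exprn_ege1.
Qed.

(** Shrinking towards the origin decreases a nonnegative sum and does not decrease
    the bump. *)
Lemma tgap_shrink k P : 0 < k <= 1 -> tgap P < 0 -> tgap (k *: P) < 0.
Proof.
move=> /andP[k0 k1] G0; have [s0|s0] := leP 0 (tsum P); last first.
  by apply: le_lt_trans (tgap_le_sum _) _; rewrite tsumZ pmulr_rlt0.
apply: le_lt_trans G0; rewrite /tgap lerB ?beta_shrink ?(ltW k0) ?k1 //.
by rewrite tsumZ ler_piMl.
Qed.

Lemma tgap_grow k P : 1 <= k -> 0 < tgap P -> 0 < tgap (k *: P).
Proof.
move=> k1 G0; have s0 : 0 < tsum P by apply: lt_le_trans G0 (tgap_le_sum _).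
by apply: lt_le_trans G0 _; rewrite /tgap lerB ?beta_grow // tsumZ ler_peMl // ltW.
Qed.

Lemma tet_eq3 P : tet_eq beta true 3 P = tgap P.
Proof.
rewrite /tet_eq /graph_eq /tgap /tsum /= /tet_phi /radial !vec2E !dotE !vec3E.
congr (_ - beta _); first by ring.
by rewrite /tquad; field.
Qed.

Lemma tgap_continuous P : {for P, continuous tgap}.
Proof.
have -> : tgap = tet_eq beta true 3 by apply/funext => Q; rewrite tet_eq3.
exact/differentiable_continuous/tet_eq_dif.
Qed.

Lemma tet_eqE j P : tet_eq beta true j P =
  match j with 0%N => P 0 0 | 1%N => P 0 1 | 2%N => P 0 2 | _ => tgap P end.
Proof.
case: j => [|[|[|j]]]; last exact: tet_eq3.
all: by rewrite /tet_eq /graph_eq /= dotE !vec3E; ring.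
Qed.

Lemma tet_eq_mirror j P : tet_eq beta false j (- P) = - (tet_eq beta true j P : R) :> R.
Proof.
rewrite tet_eqE.
case: j => [|[|[|j]]]; rewrite /tet_eq /graph_eq /= !dotE ?vec3E ?mxE; [ring|ring|ring|].
rewrite /radial !vec2E /tgap /tsum.
have -> : (2 / 3 * - P 0 0 + - 3^-1 * - P 0 1 + - 3^-1 * - P 0 2) ^+ 2 +
     (- 3^-1 * - P 0 0 + 2 / 3 * - P 0 1 + - 3^-1 * - P 0 2) ^+ 2 = tquad P.
  by rewrite /tquad; field.
by move: (beta _ : R) => x; ring.
Qed.

(** Along the ray the sum grows linearly, while the bump does not increase. *)
Lemma tgap_ray d : 0 < tsum d -> exists k : R, [/\ 0 < k, k * tsum d <= 1,
  tgap (k *: d) = 0,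
  forall t : R, t < k -> tgap (t *: d) < 0 &
  forall t : R, k < t -> 0 < tgap (t *: d)].
Proof.
move=> d0; pose f (t : R) := tgap (t *: d).
have f0 : f 0 < 0.
  by rewrite /f /tgap tsumZ tquadZ !expr2 !mul0r sub0r oppr_lt0 (bump_gt0 hb).
have f1 : 0 <= f (tsum d)^-1.
  by rewrite /f /tgap tsumZ mulVf ?gt_eqF // subr_ge0 (bump_le1 hb) ?tquad_ge0.
have i0 : 0 <= (tsum d)^-1 by rewrite invr_ge0 ltW.
have [||k k01 fk] := @IVT R f 0 (tsum d)^-1 0 i0 _ _.
- apply: continuous_in_subspaceT => t _.
  apply: (@continuous_comp _ _ _ (fun t : R => t *: d) tgap).
    by apply: cvgZr_tmp; exact: cvg_id.
  exact: tgap_continuous.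
- by rewrite ge_min le_max (ltW f0) f1 orbT.
move: k01; rewrite in_itv /= => /andP[k0 k1].
have {}k0 : 0 < k.
  rewrite lt0r k0 andbT; apply/negP => /eqP e; rewrite e in fk.
  by rewrite fk ltxx in f0.
have kd : 0 < tsum (k *: d) by rewrite tsumZ mulr_gt0.
exists k; split => //.
- by rewrite -ler_pdivlMr // mul1r.
- move=> t tk; have [t0|t0] := leP t 0.
    rewrite /tgap tsumZ -oppr_gt0 opprB.
    have := bump_ge0 hb (tquad_ge0 (t *: d)).
    move: t0; rewrite le_eqVlt => /predU1P[->|t0] b0.
      by rewrite mul0r subr0 tquadZ expr2 !mul0r (bump_gt0 hb).
    by rewrite ltr_wpDl // oppr_gt0 pmulr_llt0.
  have tE : t *: d = (t / k) *: (k *: d) by rewrite scalerA divfK ?gt_eqF.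
  rewrite tE.
  have tk1 : 0 <= t / k <= 1.
    by rewrite divr_ge0 ?(ltW t0) ?(ltW k0) //= ler_pdivrMr // mul1r ltW.
  apply: (@lt_le_trans _ _ (tgap (k *: d))); last by rewrite -/(f k) fk.
  apply: (@lt_le_trans _ _ (tsum (k *: d) - (beta (tquad ((t / k) *: (k *: d))) : R))).
    by rewrite /tgap ltrD2r [tsum (_ *: (_ *: _))]tsumZ gtr_pMl // ltr_pdivrMr // mul1r.
  by rewrite /tgap lerB // beta_shrink.
- move=> t kt.
  have t0 : 0 < t by exact: lt_trans kt.
  have tE : t *: d = (t / k) *: (k *: d) by rewrite scalerA divfK ?gt_eqF.
  rewrite tE -[X in X < _]fk -/(f k).
  have tk1 : 1 < t / k by rewrite ltr_pdivlMr // mul1r.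
  apply: (@lt_le_trans _ _ (tsum ((t / k) *: (k *: d)) - (beta (tquad (k *: d)) : R))).
    by rewrite /f /tgap ltrD2r [tsum (_ *: (_ *: _))]tsumZ ltr_pMl.
  by rewrite /tgap lerB // beta_grow // ltW.
Qed.

(** The bump is positive at the origin, so the fourth sheet stays away from it. *)
Lemma tetra_box : exists eta : R, 0 < eta <= 1 /\
  forall P, `|P 0 0| <= eta -> `|P 0 1| <= eta -> `|P 0 2| <= eta -> tgap P < 0.
Proof.
have [|k [k0 k1 Gk _ _]] := @tgap_ray (vec3 0 0 1).
  by rewrite /tsum !vec3E; lra.
have {}k1 : k <= 1 by move: k1; rewrite /tsum !vec3E; lra.
have bk : (beta (2 / 9 * k ^+ 2) : R) = k.
  move: Gk; rewrite /tgap tsumZ tquadZ /tsum /tquad !vec3E => Gk.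
  have -> : 2 / 9 * k ^+ 2 = k ^+ 2 *
    (((2 * 0 - 0 - 1) / 3) ^+ 2 + ((2 * 0 - 0 - 1) / 3) ^+ 2) :> R by field.
  by move: (beta _ : R) Gk => x; lra.
exists (k / 4); split; first by lra.
move=> P; rewrite !ler_norml => /andP[x0 x1] /andP[y0 y1] /andP[z0 z1].
have s : tsum P < k by rewrite /tsum; lra.
apply: (@lt_le_trans _ _ (k - (beta (tquad P) : R))); first by rewrite ltrD2r.
rewrite subr_le0 -bk; apply: (bump_dec hb); rewrite ?tquad_ge0 //.
have q (a : R) : - (k / 3) <= a -> a <= k / 3 -> a ^+ 2 <= k ^+ 2 / 9 by nra.
rewrite (_ : 2 / 9 * k ^+ 2 = k ^+ 2 / 9 + k ^+ 2 / 9); last by field.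
by rewrite lerD // q //; lra.
Qed.

(** Points of the boundary sphere with prescribed signs of the coordinates, so far
    out that they are on the positive side of the fourth sheet; the value for
    three negative signs is a dummy. *)
Definition tout (sx sy sz : bool) : 'rV[R]_3 :=
  match sx, sy, sz with
  | true, true, true => vec3 2 2 1
  | true, true, false => vec3 2 2 (-1)
  | true, false, true => vec3 2 (-1) 2
  | false, true, true => vec3 (-1) 2 2
  (* (36, 9, 12) has length 39 = 3 * 13 *)
  | true, false, false => vec3 (36 / 13) (- (9 / 13)) (- (12 / 13))
  | false, true, false => vec3 (- (9 / 13)) (36 / 13) (- (12 / 13))
  | false, false, true => vec3 (- (9 / 13)) (- (12 / 13)) (36 / 13)
  | false, false, false => 0
  end.

Lemma toutP sx sy sz : [|| sx, sy | sz] -> let b := tout sx sy sz in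
  [/\ dot b b = 9, 1 < tsum b &
   [/\ pos_if sx (b 0 0), pos_if sy (b 0 1) & pos_if sz (b 0 2)]].
Proof.
by case: sx; case: sy; case: sz => //= _; rewrite /tsum dotE !vec3E /pos_if;
  (split; [by field | by lra | by split; lra]).
Qed.

Definition octant (sx sy sz : bool) P :=
  [/\ pos_if sx (P 0 0), pos_if sy (P 0 1) & pos_if sz (P 0 2)].

Lemma octant_conv sx sy sz P Q (t : R) : octant sx sy sz P -> octant sx sy sz Q ->
  0 <= t <= 1 -> octant sx sy sz (P + t *: (Q - P)).
Proof.
by move=> [a1 a2 a3] [b1 b2 b3] t01; split; rewrite !mxE; exact: pos_if_conv.
Qed.

Lemma octantZ sx sy sz P (k : R) : 0 < k -> octant sx sy sz P -> octant sx sy sz (k *: P).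
Proof. by move=> k0 [a1 a2 a3]; split; rewrite !mxE pos_if_pmul. Qed.

(** The cone on which moving outwards along rays crosses the fourth sheet
    before leaving the ball. *)
Definition tcone P := 0 < tsum P /\ dot P P < 8 * tsum P ^+ 2.

Variables (X : Type) (C : 'rV[R]_3 -> X).
Hypothesis C_segment : forall P Q, (forall t : R, 0 <= t <= 1 ->
   dot (P + t *: (Q - P)) (P + t *: (Q - P)) <= 9 /\
   forall j, tet_eq beta true j (P + t *: (Q - P)) != 0) -> C P = C Q.

Lemma C_pattern sx sy sz s3 P Q : dot P P <= 9 -> dot Q Q <= 9 ->
  octant sx sy sz P -> octant sx sy sz Q ->
  (forall t, 0 <= t <= 1 -> pos_if s3 (tgap (P + t *: (Q - P)))) -> C P = C Q.
Proof.
move=> P9 Q9 oP oQ g; apply: C_segment => t t01; split; first exact: ball3_convex.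
have [h1 h2 h3] := octant_conv oP oQ t01.
have nz (b : bool) (x : R) : pos_if b x -> x != 0 by rewrite pos_ifE => /andP[].
case=> [|[|[|j]]]; rewrite tet_eqE; [exact: nz h1|exact: nz h2|exact: nz h3|].
exact: nz (g t t01).
Qed.

Lemma scale_segment P (k t : R) : P + t *: (k *: P - P) = (1 + t * (k - 1)) *: P.
Proof. by apply/rowP => i; rewrite !mxE; ring. Qed.

Section Corner.
Variable eta : R.
Hypothesis eta01 : 0 < eta <= 1.
Hypothesis etaP : forall P, `|P 0 0| <= eta -> `|P 0 1| <= eta -> `|P 0 2| <= eta -> tgap P < 0.

Definition tcorner (sx sy sz : bool) : 'rV[R]_3 :=
  vec3 ((-1) ^+ (~~ sx) * eta) ((-1) ^+ (~~ sy) * eta) ((-1) ^+ (~~ sz) * eta).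

(** Shrinking brings the point into the box around the origin, where the octants
    do not meet the fourth sheet. *)
Lemma negative_side sx sy sz P : dot P P <= 9 -> octant sx sy sz P -> tgap P < 0 ->
  C P = C (tcorner sx sy sz).
Proof.
move=> P9 oP gP; have /andP[e0 e1] := eta01.
pose k := eta / 3.
have k01 : 0 < k <= 1 by rewrite /k; lra.
have /andP[k0 k1] := k01.
have kP9 : dot (k *: P) (k *: P) <= 9.
  rewrite dotZZ; apply: le_trans P9; rewrite ler_piMl ?dot_ge0 //.
  by rewrite expr_le1 // ltW.
transitivity (C (k *: P)).
  apply: (@C_pattern sx sy sz false) => //; first exact: octantZ.
  move=> t t01; rewrite scale_segment; apply: tgap_shrink => //; nra.
have sgn1 (s : bool) : `|(-1) ^+ (~~ s) * eta| = eta :> R.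
  by rewrite normrM normr_sign mul1r gtr0_norm.
have box (Q : 'rV[R]_3) i : dot Q Q <= 9 -> `|Q 0 i| <= 3.
  move=> Q9; rewrite -(@ler_pXn2r _ 2) ?nnegrE // -normrX ger0_norm ?sqr_ge0 //.
  rewrite (_ : 3 ^+ 2 = 9 :> R); last by ring.
  apply: le_trans Q9; rewrite /dot (bigD1 i) //= -expr2.
  by rewrite lerDl sumr_ge0 // => l _; rewrite -expr2 sqr_ge0.
have boxk i : `|(k *: P) 0 i| <= eta.
  rewrite mxE normrM gtr0_norm // /k mulrAC ler_pdivrMr // ler_pM2l //.
  exact: box.
apply: (@C_pattern sx sy sz false) => //.
- have sq (s : bool) : ((-1) ^+ (~~ s) * eta) * ((-1) ^+ (~~ s) * eta) = eta * eta :> R.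
    by case: s; rewrite /= ?expr0 ?expr1; ring.
  by rewrite dotE !vec3E !sq; nra.
- exact: octantZ.
- by rewrite /octant !vec3E !pos_if_sgn !addbN !addbb; split; exact: e0.
move=> t t01; apply: etaP; rewrite !mxE /= !(tnth_nth 0) /= -/(nth _ _ _).
all: set y := (-1) ^+ _ * eta; set x := k * _.
all: have xe : `|x| <= eta by [have := boxk 0; rewrite mxE | have := boxk 1; rewrite mxE | have := boxk 2; rewrite mxE].
all: have ye : `|y| <= eta by rewrite /y sgn1.
all: move: xe ye; rewrite !ler_norml; move: t01 => /andP[t0 t1] /andP[x1 x2] /andP[y1 y2].
all: by apply/andP; split; nra.
Qed.

(** Scaling outwards brings the point to where the sum exceeds the maximal value of
    the bump, and the condition defining [tcone] keeps it in the ball; there the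
    octant is convex. *)
Lemma positive_side sx sy sz P : [|| sx, sy | sz] -> dot P P <= 9 ->
  octant sx sy sz P -> 0 < tgap P -> tcone P -> C P = C (tout sx sy sz).
Proof.
move=> sxyz P9 oP gP [s0 sc].
have [b9 b1 bo] := toutP sxyz.
pose k := Num.max 1 ((21 / 20) / tsum P).
have k1 : 1 <= k by rewrite le_max lexx.
have k0 : 0 < k by exact: lt_le_trans k1.
have kP9 : dot (k *: P) (k *: P) <= 9.
  rewrite /k; case: (leP 1 ((21 / 20) / tsum P)) => [h|h]; last by rewrite scale1r.
  rewrite dotZZ expr_div_n mulrAC ler_pdivrMr ?exprn_gt0 //.
  by move: (dot P P) sc => x; nra.
have ks : 1 < tsum (k *: P).
  rewrite tsumZ /k; case: (leP 1 ((21 / 20) / tsum P)) => [h|h].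
    by rewrite divfK ?gt_eqF //; lra.
  by move: h; rewrite ltr_pdivrMr // !mul1r; lra.
transitivity (C (k *: P)).
  apply: (@C_pattern sx sy sz true) => //; first exact: octantZ.
  move=> t /andP[t0 t1]; rewrite scale_segment; apply: tgap_grow => //.
  by rewrite lerDl mulr_ge0 // subr_ge0.
apply: (@C_pattern sx sy sz true) => //.
- by rewrite b9.
- exact: octantZ.
move=> t /andP[t0 t1].
have s1 : 1 < tsum (k *: P + t *: (tout sx sy sz - k *: P)).
  have -> : tsum (k *: P + t *: (tout sx sy sz - k *: P)) =
    (1 - t) * tsum (k *: P) + t * tsum (tout sx sy sz).
    by rewrite /tsum !mxE; ring.
  have := @pos_if_conv R true (tsum (k *: P) - 1) (tsum (tout sx sy sz) - 1) t.
  rewrite /pos_if !subr_gt0 t0 t1 => /(_ ks b1 isT).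
  by move: (tsum _) (tsum _) => x y; lra.
rewrite /pos_if /tgap subr_gt0; apply: le_lt_trans s1.
by rewrite (bump_le1 hb) ?tquad_ge0.
Qed.

End Corner.

End TetraHat.

Section TetraGrad.
Variables (R : realType) (beta : R^o -> R^o).
Hypothesis hb : Defs.bump beta.
Implicit Types (P Q w : 'rV[R]_3).

(** The central symmetry exchanges the two sides of the tetrahedral move, so that
    both are studied through the equations for [t > 0]. *)
Definition mirror (side : bool) P := if side then P else - P.

Lemma mirrorK side : involutive (mirror side).
Proof. by case: side => P //=; rewrite opprK. Qed.

Lemma dot_mirror side P : dot (mirror side P) (mirror side P) = dot P P.
Proof. by case: side; rewrite //= !dotE !mxE; ring. Qed.

Lemma mirror_continuous side P : {for P, continuous (mirror side)}.
Proof. by case: side; [exact: cvg_id | apply: opp_continuous]. Qed.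

Lemma tet_eq_mirrorE side j P : tet_eq beta side j (mirror side P) =
  (-1) ^+ (~~ side) * (tet_eq beta true j P : R) :> R.
Proof.
by case: side; rewrite ?expr0 ?expr1 ?mul1r ?mulN1r //= tet_eq_mirror.
Qed.

Definition tet_or side j (p : 'rV[R]_3) : R^o :=
  (-1) ^+ (j == 1)%N * (tet_eq beta side j p : R).

Lemma tet_or_co_oriented side (j : 'I_4) u :
  co_oriented (@side_sheet R beta Tetrahedral side j) u (tet_or side j).
Proof.
rewrite (_ : side_sheet _ _ _ = graph_sheet (tet_n R j) (tet_L1 R j) (tet_L2 R j) (tet_phi beta side j)); last first.
  by apply/funext => v; exact: tet_sheetE.
apply: graph_sheet_co_oriented.
- exact: tet_dual.
- exact: tet_det_neq0.
- exact: tet_phi_dif.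
- exact: tet_det.
Qed.

Lemma tet_sheetP side (j : 'I_4) u p :
  @side_sheet R beta Tetrahedral side j u = p <->
  u = proj2 (tet_a R j) (tet_b R j) p /\ tet_eq beta side j p = 0.
Proof.
by rewrite tet_sheetE; apply: graph_sheetP; [exact: tet_dual | exact: tet_det_neq0].
Qed.

Definition tgrad Q : 'rV[R]_3 := grad (tet_eq beta true 3) Q.

Lemma tgrad_dot Q w : dot (tgrad Q) w = dot (vec3 1 1 1) w -
  ('d (radial beta) (proj2 (tet_a R 3) (tet_b R 3) Q) (proj2 (tet_a R 3) (tet_b R 3) w) : R).
Proof.
have [_ E] := @graph_eq_diff R (tet_m R 3) (tet_a R 3) (tet_b R 3)
  (tet_phi beta true 3) Q w (tet_phi_dif hb _ _ _).
exact: (etrans (esym (gradE _ _ _)) E).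
Qed.

Lemma tet_or_grad side (j : 'I_4) Q w :
  dot (grad (tet_or side j) (mirror side Q)) w =
  (-1) ^+ (j == 1 :> nat) * dot (tetra_normal (tgrad Q) j) w.
Proof.
have H := @graph_eq_grad R (tet_m R j) (tet_a R j) (tet_b R j) (tet_phi beta side j)
  (j == 1 :> nat) (mirror side Q) w (tet_phi_dif hb _ _ _).
apply: (etrans H); congr (_ * _).
have c0 (u v : 'rV[R]_2) : 'd (fun=> 0 : R^o) u v = 0.
  exact: (congr1 (fun F : _ -> _ => F v) (diff_cst (0 : R^o) u)).
have z0 (m : 'rV[R]_3) (v v' : 'rV[R]_2) :
    dot m w - ('d (fun=> 0 : R^o) v v' : R) = dot m w.
  exact: (etrans (congr1 (fun x : R => dot m w - x) (c0 v v')) (subr0 _)).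
case: j {H} => -[|[|[|[|//]]]] j4; try exact: z0.
set v := proj2 (tet_a R 3) (tet_b R 3) w.
have E : 'd (tet_phi beta side 3) (proj2 (tet_a R 3) (tet_b R 3) (mirror side Q)) v =
    'd (radial beta) (proj2 (tet_a R 3) (tet_b R 3) Q) v.
  have e0 : tet_phi beta true 3 = radial beta by [].
  case: side; first exact: (congr1 (fun f : _ -> _ => 'd f _ v) e0).
  have -> : proj2 (tet_a R 3) (tet_b R 3) (mirror false Q) =
      - proj2 (tet_a R 3) (tet_b R 3) Q.
    by apply: vec2_ext; rewrite !mxE /= !(tnth_nth 0) /= !dotE !mxE; ring.
  move: (proj2 _ _ Q) => u.
  have [dr _] := radial_diff hb (- u) v.
  have [_ e1] := radial_diff hb (- u) v; have [_ e2] := radial_diff hb u v.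
  have e3 : 'd (tet_phi beta false 3) (- u) v = - 'd (radial beta) (- u) v.
    exact: (congr1 (fun F : _ -> _ => F v) (diffN dr)).
  apply: (etrans e3); apply: (etrans (congr1 -%R e1)); apply: esym; apply: (etrans e2).
  by rewrite !mxE !sqrrN; ring.
exact: (etrans (congr1 (fun x : R => dot (vec3 1 1 1) w - x) E) (esym (tgrad_dot Q w))).
Qed.

(** The sum is linear and the radial derivative of the bump is not positive. *)
Lemma tgrad_radial Q : tsum Q <= dot (tgrad Q) Q.
Proof.
rewrite tgrad_dot.
have := radial_slope hb (proj2 (tet_a R 3) (tet_b R 3) Q).
have -> : dot (vec3 1 1 1) Q = tsum Q by rewrite dotE !vec3E /tsum; ring.
by move: ('d _ _ _ : R) => x x0; rewrite lerBrDr gerDl.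
Qed.

(** At a crossing with the fourth sheet the radial direction is tangent to the
    coordinate plane and transverse to this sheet by [tgrad_radial]. *)
Lemma tet_span (j k : 'I_4) Q b b' : j != k ->
  tet_eq beta true j Q = 0 -> tet_eq beta true k Q = 0 ->
  (j == 3 :> nat) || (k == 3 :> nat) ==> (0 < tsum Q) ->
  exists w, pos_if b (dot (tetra_normal (tgrad Q) j) w) /\
            pos_if b' (dot (tetra_normal (tgrad Q) k) w).
Proof.
have sg (x : bool) : pos_if x ((-1) ^+ (~~ x) : R).
  by rewrite -[(-1) ^+ _]mulr1 pos_if_sgn addbN addbb /pos_if ltr01.
have key (j' : 'I_4) (c c' : bool) : j' != 3 :> nat -> tet_eq beta true j' Q = 0 ->
    0 < tsum Q -> exists w, pos_if c (dot (tetra_normal (tgrad Q) j') w) /\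
       pos_if c' (dot (tgrad Q) w).
  move=> j3 ej s0.
  have g0 : 0 < dot (tgrad Q) Q by apply: lt_le_trans (tgrad_radial Q).
  pose n := tetra_normal (tgrad Q) j'.
  have nn : dot n n = 1.
    by rewrite /n; case: j' j3 {ej n} => -[|[|[|[|//]]]] ? //= _; rewrite dotE !vec3E; ring.
  have nQ : dot n Q = 0.
    have : dot n Q = tet_eq beta true j' Q.
      rewrite tet_eqE /n.
      by case: j' j3 {ej nn n} => -[|[|[|[|//]]]] ? //= _; rewrite dotE !vec3E; ring.
    by rewrite ej.
  pose M := (`|dot (tgrad Q) n| + 1) / dot (tgrad Q) Q.
  exists ((-1) ^+ (~~ c) *: n + ((-1) ^+ (~~ c') * M) *: Q).
  rewrite !dotDr !dotZr -/n nn nQ mulr0 addr0 mulr1; split; first exact: sg.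
  rewrite -mulrA /M divfK ?gt_eqF //.
  set x := dot (tgrad Q) n.
  have : `|(-1) ^+ (~~ c) * x| = `|x| by rewrite normrM normr_sign mul1r.
  move: (_ * x) => y yx.
  have := ler_norm y; have := ler_norm (- y); rewrite normrN yx.
  by case: c'; rewrite /pos_if /= ?expr0 ?expr1; lra.
move=> jk ej ek.
have [j3|j3] := boolP (j == 3 :> nat).
  move=> /= s0; have k3 : k != 3 :> nat.
    by apply: contra jk => k3; apply/eqP/val_inj; rewrite /= (eqP j3) (eqP k3).
  have [w [w1 w2]] := key k b' b k3 ek s0; exists w; split => //.
  by case: j j3 {jk ej} => -[|[|[|[|//]]]] ?.
have [k3|k3] := boolP (k == 3 :> nat).
  move=> /= s0.
  have [w [w1 w2]] := key j b b' j3 ej s0; exists w; split => //.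
  by case: k k3 {jk ek} => -[|[|[|[|//]]]] ?.
move=> _.
pose s (i : nat) : R := (-1) ^+ (if i == j then ~~ b else ~~ b').
exists (vec3 (s 0) (s 1) (s 2)).
have nE (i : 'I_4) : i != 3 :> nat ->
    dot (tetra_normal (tgrad Q) i) (vec3 (s 0) (s 1) (s 2)) = s i.
  by case: i => -[|[|[|[|//]]]] ? //= _; rewrite dotE !vec3E; ring.
rewrite !nE // /s eqxx; split; first exact: sg.
by rewrite ifN ?sg //; apply: contra jk => /eqP e; apply/eqP/val_inj.
Qed.

End TetraGrad.

(** * Tetrahedral move: crossings *)

Lemma ord4_cover (i x y z j : 'I_4) : uniq [:: i; x; y; z] -> j \in [:: i; x; y; z].
Proof.
move=> un; have /subset_cardP H : #|[:: i; x; y; z]| = #|'I_4|.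
  by rewrite (card_uniqP un) card_ord.
have sub : [:: i; x; y; z] \subset 'I_4 by apply/fintype.subsetP.
by move/H: sub => ->.
Qed.

Section TetraSide.
Variables (R : realType) (beta : R^o -> R^o).
Hypothesis hb : Defs.bump beta.
Variables (D : diagram R) (U V : set 'rV[R]_3) (h h' : 'rV[R]_3 -> 'rV[R]_3).
Hypotheses (hh : diffeo U V h h') (BV : [set q | dot q q <= 9] `<=` V).
Variables (side : bool) (rk : {perm 'I_4}) (sg : bool) (eps : 'I_4 -> bool).
Local Notation sheet := (@side_sheet R beta Tetrahedral side).
Hypothesis hm : @modeled R D U V h' 4 sheet rk sg eps.
Variables (X : choiceType) (T : X -> X -> X -> X) (c : set 'rV[R]_3 -> X).
Hypothesis hc : coloring T D c.
Variable delta : bool.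
Hypothesis hdelta : forall p, dot p p <= 9 -> (\det (jac h' p) < 0) = delta.
Implicit Types (P Q : 'rV[R]_3).

Definition hat_color P : X := c (region D (h' (mirror side P))).

Lemma mirror_V P : dot P P <= 9 -> V (mirror side P).
Proof. by move=> P9; apply: BV; rewrite /= dot_mirror. Qed.

Lemma tet_eq_neq0 (j : 'I_4) P : (tet_eq beta side j (mirror side P) == 0 :> R) =
  (tet_eq beta true j P == 0 :> R).
Proof. by rewrite (tet_eq_mirrorE beta) mulf_eq0 signr_eq0. Qed.

Lemma tet_off P : (forall j : 'I_4, tet_eq beta true j P != 0 :> R) ->
  off_sheets sheet (mirror side P).
Proof.
move=> nz j u /tet_sheetP[_ e].
by have := nz j; rewrite -tet_eq_neq0 e eqxx.
Qed.

Lemma hat_segment P Q : (forall t : R, 0 <= t <= 1 ->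
   dot (P + t *: (Q - P)) (P + t *: (Q - P)) <= 9 /\
   forall j, tet_eq beta true j (P + t *: (Q - P)) != 0) ->
  hat_color P = hat_color Q.
Proof.
move=> H; congr c; apply: (modeled_segment hh hm) => t /H[t9 nz].
have -> : mirror side P + t *: (mirror side Q - mirror side P) =
    mirror side (P + t *: (Q - P)).
  by case: (side) => //=; apply/rowP => i; rewrite !mxE; ring.
by split; [exact: mirror_V|apply: tet_off => j; exact: nz].
Qed.

Variable eta : R.
Hypothesis eta01 : 0 < eta <= 1.
Hypothesis etaP : forall P, `|P 0 0| <= eta -> `|P 0 1| <= eta ->
  `|P 0 2| <= eta -> tgap beta P < 0.

(** The color of a base point for each sign pattern. *)
Definition tet_col (s : 'I_4 -> bool) : X :=
  if s 3 then hat_color (tout R (s 0) (s 1) (s 2))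
  else hat_color (tcorner eta (s 0) (s 1) (s 2)).

Definition hat_pattern P (j : 'I_4) : bool := 0 < (tet_eq beta true j P : R).

(** A point where the region is determined by the sides of the four sheets. *)
Definition tame P := dot P P < 9 /\ (tgap beta P < 0 \/ tcone P).

Lemma tet_col_pattern P : tame P -> (forall j : 'I_4, tet_eq beta true j P != 0 :> R) ->
  hat_color P = tet_col (hat_pattern P).
Proof.
move=> [P9 gP] nz.
have sgP (j : 'I_4) : pos_if (hat_pattern P j) (tet_eq beta true j P : R).
  by rewrite pos_ifE nz /= eqxx.
have oP : octant (hat_pattern P 0) (hat_pattern P 1) (hat_pattern P 2) P.
  by split; [have := sgP 0|have := sgP 1|have := sgP 2]; rewrite tet_eqE.
have g3 := sgP 3; rewrite tet_eqE /= in g3.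
rewrite /tet_col; case: (hat_pattern P 3) g3 => g3.
  have [s0 sc] : tcone P by case: gP => // g; move: (lt_trans g3 g); rewrite ltxx.
  apply: (positive_side hb hat_segment) => //; last exact: ltW.
  move: oP => [].
  case: (hat_pattern P 0) => //; case: (hat_pattern P 1) => //.
  case: (hat_pattern P 2) => //= x0 y0 z0.
  by move: s0; rewrite /tsum -(addr0 0) -(addr0 (0 + 0)) ltNge !lerD // ltW.
by apply: (negative_side hb hat_segment eta01 etaP) => //; exact: ltW.
Qed.

(** The correction from sides of oriented sheets to signs of the equations: the
    second plane and the mirror image reverse the sign, as do the orientation of
    the sheet and the one of the coordinates. *)
Definition orient (j : 'I_4) : bool :=
  (j == 1 :> nat) (+) ~~ side (+) eps j (+) delta.

Lemma tet_side_bit (j : 'I_4) (q : 'rV[R]_3) : (tet_or beta side j q : R) != 0 ->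
  hat_pattern (mirror side q) j = side_bit eps delta j (tet_or beta side j) q (+) orient j.
Proof.
rewrite -[q](mirrorK side); move: (mirror side q) => P; rewrite mirrorK.
rewrite /side_bit /tet_or /hat_pattern /orient tet_eq_mirrorE.
set x := (tet_eq _ _ _ _ : R) => nz.
have {}nz : x != 0 by apply: contraNneq nz => ->; rewrite !mulr0.
have E (a b : bool) : (0 < (-1) ^+ a * ((-1) ^+ b * x)) = (0 < x) (+) a (+) b.
  rewrite -[LHS]/(pos_if true _) !pos_if_sgn pos_ifE nz.
  by case: (0 < x); case: a; case: b.
rewrite E.
by case: (0 < x); case: (j == 1 :> nat)%N; case: (side); case: (eps j); case: (delta).
Qed.

Lemma near_mirror (A : 'rV[R]_3 -> Prop) Q : (\forall P \near Q, A P) ->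
  \forall q \near mirror side Q, A (mirror side q).
Proof.
move=> H; have := @mirror_continuous R side (mirror side Q).
by move=> /(_ A); rewrite /continuous_at mirrorK; apply.
Qed.

Lemma near_tame Q : tame Q -> \forall P \near Q, tame P.
Proof.
move=> [Q9 gQ].
have co i : {for Q, continuous (fun q : 'rV[R]_3 => q 0 i : R)} by exact: coord_continuous.
have sc : {for Q, continuous (@tsum R)}.
  exact: (@continuousD R R^o _ _ _ _ (@continuousD R R^o _ _ _ _ (co 0) (co 1)) (co 2)).
have dc : {for Q, continuous (fun q : 'rV[R]_3 => dot q q : R)}.
  have E : (fun q : 'rV[R]_3 => dot q q : R) =
     (fun q => q 0 0 * q 0 0 + q 0 1 * q 0 1 + q 0 2 * q 0 2).
    by apply/funext => q; rewrite dotE.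
  rewrite E.
  exact: (@continuousD R R^o _ _ _ _ (@continuousD R R^o _ _ _ _
    (continuousM (co 0) (co 0)) (continuousM (co 1) (co 1))) (continuousM (co 2) (co 2))).
have n9 : \forall P \near Q, dot P P < 9 by exact: (cvgr_lt _ dc).
case: gQ => [gQ|[s0 s8]].
  have ng : \forall P \near Q, tgap beta P < 0.
    exact: (cvgr_lt _ (tgap_continuous hb (P := Q))).
  by near=> P; split; [near: P; exact: n9|left; near: P; exact: ng].
have n1 : \forall P \near Q, 0 < tsum P by exact: (cvgr_gt _ sc).
have n2 : \forall P \near Q, 0 < 8 * (tsum P * tsum P) - dot P P.
  have cc : {for Q, continuous (cst 8 : 'rV[R]_3 -> R)} by move=> ?; exact: cst_continuous.
  apply: (cvgr_gt _ (@continuousB R R^o _ _ _ _ (continuousM cc (continuousM sc sc)) dc)).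
  by rewrite -[X in 0 < X]/(8 * (tsum Q * tsum Q) - dot Q Q) subr_gt0 -expr2.
near=> P; split; first by near: P; exact: n9.
right; split; first by near: P; exact: n1.
by rewrite -subr_gt0 expr2; near: P; exact: n2.
Unshelve. all: by end_near. Qed.

Lemma near_sign (j : 'I_4) b Q : pos_if b (tet_eq beta true j Q : R) ->
  \forall P \near Q, pos_if b (tet_eq beta true j P : R).
Proof.
have ct : {for Q, continuous (tet_eq beta true j)}.
  exact/differentiable_continuous/tet_eq_dif.
by case: b => Qb; [exact: (cvgr_gt _ ct)|exact: (cvgr_lt _ ct)].
Qed.

(** [A] is the set of the sheets that may pass through the point; the other ones
    keep their signs nearby. *)
Lemma tet_near_color (A : pred 'I_4) (s : 'I_4 -> bool) Q : tame Q ->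
  (forall j, ~~ A j -> pos_if (s j) (tet_eq beta true j Q : R)) ->
  \forall q \near mirror side Q,
    (forall j, A j -> (tet_or beta side j q : R) != 0) ->
    off_sheets sheet q /\ model_color D h' c q =
      tet_col (fun j => if A j then
        side_bit eps delta j (tet_or beta side j) q (+) orient j else s j).
Proof.
move=> tQ sQ.
have nP : \forall P \near Q, tame P /\
    forall j, ~~ A j -> pos_if (s j) (tet_eq beta true j P : R).
  have H : \forall P \near Q, forall j, ~~ A j -> pos_if (s j) (tet_eq beta true j P : R).
    have Hj (j : 'I_4) : \forall P \near Q, ~~ A j -> pos_if (s j) (tet_eq beta true j P : R).
      have [Aj|Aj] := boolP (A j); first by near=> P.
      have Sj := near_sign (sQ j Aj).
      by near=> P; move=> _; near: P; exact: Sj.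
    exact: (filter_forall _ Hj).
  near=> P; split; first by near: P; exact: near_tame.
  by near: P; exact: H.
have := near_mirror nP; apply: filterS => q [tq sq] nz.
have nzq (j : 'I_4) : tet_eq beta true j (mirror side q) != 0 :> R.
  rewrite -tet_eq_neq0 mirrorK; have [Aj|Aj] := boolP (A j).
    by apply: contraNneq (nz j Aj) => e; rewrite /tet_or e mulr0.
  by move: (sq j Aj); rewrite pos_ifE => /andP[+ _]; rewrite -tet_eq_neq0 mirrorK.
rewrite -[q in off_sheets _ q](mirrorK side); split; first exact: tet_off.
have -> : model_color D h' c q = hat_color (mirror side q).
  by rewrite /hat_color mirrorK.
rewrite tet_col_pattern //; congr tet_col; apply/funext => j.
case: ifPn => Aj; first by apply: tet_side_bit; exact: nz.
by move: (sq j Aj); rewrite pos_ifE /hat_pattern => /andP[_ /eqP].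
Unshelve. all: by end_near. Qed.

Lemma tet_face (jU jO : 'I_4) (s : 'I_4 -> bool) Q : jU != jO ->
  (rk jU < rk jO)%N -> tame Q ->
  tet_eq beta true jU Q = 0 -> tet_eq beta true jO Q = 0 ->
  (forall j, j != jU -> j != jO -> pos_if (s j) (tet_eq beta true j Q : R)) ->
  (jU == 3 :> nat) || (jO == 3 :> nat) ==> (0 < tsum Q) ->
  let col bU bO := tet_col (fun j => if j == jU then bU (+) orient jU
    else if j == jO then bO (+) orient jO else s j) in
  col false true = T (col false false) (col true false) (col true true).
Proof.
move=> jUO rUO tQ eU eO sQ s3 col.
have Q9 : dot Q Q <= 9 by apply: ltW; case: tQ.
have pd : (\det (jac h' (mirror side Q)) < 0) = delta by apply: hdelta; rewrite dot_mirror.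
have eU' : tet_eq beta side jU (mirror side Q) = 0.
  by apply/eqP; rewrite tet_eq_neq0 eU.
have eO' : tet_eq beta side jO (mirror side Q) = 0.
  by apply/eqP; rewrite tet_eq_neq0 eO.
have fU := (tet_sheetP beta side jU _ _).2 (conj erefl eU').
have fO := (tet_sheetP beta side jO _ _).2 (conj erefl eO').
apply: (modeled_double hh hm hc (mirror_V Q9) pd fU (tet_or_co_oriented hb _ _ _)
  fO (tet_or_co_oriented hb _ _ _)).
- by rewrite /above eq_sym (negbTE jUO).
- move=> j u /tet_sheetP[-> ej].
  have [->|jU'] := eqVneq j jU; first by left.
  have [->|jO'] := eqVneq j jO; first by right.
  have := sQ j jU' jO'; rewrite pos_ifE => /andP[+ _].
  by rewrite -tet_eq_neq0 ej eqxx.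
- move=> bU bO.
  have [w [w1 w2]] := tet_span hb (bU (+) (jU == 1 :> nat)) (bO (+) (jO == 1 :> nat))
    jUO eU eO s3.
  have g1 := tet_or_grad hb side jU Q w; have g2 := tet_or_grad hb side jO Q w.
  by exists w; split; [rewrite g1 | rewrite g2]; rewrite pos_if_sgn.
have sA (j : 'I_4) : ~~ ((j == jU) || (j == jO)) -> pos_if (s j) (tet_eq beta true j Q : R).
  by rewrite negb_or => /andP[]; exact: sQ.
have := tet_near_color tQ sA; apply: filterS => q Hq nU nO.
have [|off ->] := Hq _; first by move=> j /orP[/eqP->|/eqP->].
split => //; rewrite /col; congr tet_col; apply/funext => j.
have [->//|_] := eqVneq j jU.
by have [->|] := eqVneq j jO.
Qed.

Lemma tet_triple (i jB jM jT : 'I_4) P : uniq [:: i; jT; jM; jB] ->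
  (rk jB < rk jM)%N -> (rk jM < rk jT)%N -> tame P ->
  (forall j, j != i -> tet_eq beta true j P = 0) ->
  pos_if (i != 3 :> nat) (tet_eq beta true i P : R) ->
  (i != 3 :> nat -> 0 < tgrad beta P 0 (inord i)) ->
  let col bB bM bT := tet_col (fun j => if j == i then i != 3 :> nat else
    (if j == jB then bB else if j == jM then bM else bT) (+) orient j) in
  forall t, t.1.1 = h' (mirror side P) -> colored_triple_points D c t <->
  t = (h' (mirror side P),
    ((eps jT (+) (jT == 1 :> nat)) (+) (eps jM (+) (jM == 1 :> nat))
     (+) (eps jB (+) (jB == 1 :> nat))) (+) tetra_det_pos i jT jM jB,
    [tuple col false false false; col true false false; col true true false;
           col true true true]).
Proof.
move=> un rBM rMT tP zP sP gP col t et.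
have P9 : dot P P <= 9 by apply: ltW; case: tP.
have pd : (\det (jac h' (mirror side P)) < 0) = delta by apply: hdelta; rewrite dot_mirror.
have ez j : j != i -> tet_eq beta side j (mirror side P) = 0.
  by move=> ji; apply/eqP; rewrite tet_eq_neq0 zP.
have [iT iM iB] : [/\ jT != i, jM != i & jB != i].
  by move: un; rewrite /= !inE !negb_or => /andP[/and3P[? ? ?] _]; rewrite ![_ == i]eq_sym; split.
have [TM TB MB] : [/\ jT != jM, jT != jB & jM != jB].
  by move: un; rewrite /= !inE !negb_or => /and4P[_ /andP[? ?] ? _]; split.
have cover j : j != i -> [\/ j = jB, j = jM | j = jT].
  move=> ji; have : j \in [:: i; jT; jM; jB].
    exact: ord4_cover.
  by rewrite !inE (negbTE ji) /= => /or3P[]/eqP->; [constructor 3|constructor 2|constructor 1].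
have fB := (tet_sheetP beta side jB _ _).2 (conj erefl (ez _ iB)).
have fM := (tet_sheetP beta side jM _ _).2 (conj erefl (ez _ iM)).
have fT := (tet_sheetP beta side jT _ _).2 (conj erefl (ez _ iT)).
have gradE (j : 'I_4) : grad (tet_or beta side j) (mirror side P) =
    (-1) ^+ (j == 1 :> nat) *: tetra_normal (tgrad beta P) j.
  have H w : dot (grad (tet_or beta side j) (mirror side P)) w =
    dot ((-1) ^+ (j == 1 :> nat) *: tetra_normal (tgrad beta P) j) w.
    by apply: (etrans (tet_or_grad hb side j P w)); rewrite [RHS]dotC dotZr dotC.
  by apply: vec3_ext; [have := H (vec3 1 0 0)|have := H (vec3 0 1 0)|have := H (vec3 0 0 1)];
    rewrite !dotE !vec3E !mulr0 !mulr1 ?addr0 ?add0r.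
have dg : det3 (grad (tet_or beta side jT) (mirror side P))
    (grad (tet_or beta side jM) (mirror side P)) (grad (tet_or beta side jB) (mirror side P))
  = (-1) ^+ (jT == 1 :> nat) * ((-1) ^+ (jM == 1 :> nat) * ((-1) ^+ (jB == 1 :> nat) *
    det3 (tetra_normal (tgrad beta P) jT) (tetra_normal (tgrad beta P) jM)
      (tetra_normal (tgrad beta P) jB))).
  by rewrite !gradE !det3E !mxE; ring.
have sd := tetra_det_sign un gP.
have dne : det3 (tetra_normal (tgrad beta P) jT) (tetra_normal (tgrad beta P) jM)
      (tetra_normal (tgrad beta P) jB) != 0 by move: sd; rewrite pos_ifE => /andP[].
have := modeled_triple hh hm (c := c) (col := col) (mirror_V P9) pd fB fM fT
  (tet_or_co_oriented hb _ _ _) (tet_or_co_oriented hb _ _ _) (tet_or_co_oriented hb _ _ _).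
rewrite {1 2}/above (negbTE TM) (negbTE MB).
move=> /(_ rMT rBM _ _ _ t et) ->; first last.
- by rewrite dg !mulf_neq0 ?signr_eq0.
- have sA (j : 'I_4) : ~~ (j != i) -> pos_if (i != 3 :> nat) (tet_eq beta true j P : R).
    by rewrite negbK => /eqP->.
  have := @tet_near_color (fun j => j != i) (fun=> i != 3 :> nat) P tP sA.
  apply: filterS => q Hq nB nM nT.
  have [|off ->] := Hq _; first by move=> j /cover[]->.
  split => //; rewrite /col; congr tet_col; apply/funext => j.
  have [//|ji] := eqVneq j i.
  case: (cover j ji) => ->; rewrite ?eqxx //.
    by rewrite (negbTE MB).
  by rewrite (negbTE TB) (negbTE TM).
- move=> j u /tet_sheetP[-> ej].
  have [ji|ji] := eqVneq j i.
    by move: sP; rewrite pos_ifE -ji => /andP[+ _]; rewrite -tet_eq_neq0 ej eqxx.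
  by case: (cover j ji) => ->; [constructor 1|constructor 2|constructor 3].
suff -> : pos_if (~~ (eps jT (+) eps jM (+) eps jB)) (det3 (grad (tet_or beta side jT) (mirror side P))
    (grad (tet_or beta side jM) (mirror side P)) (grad (tet_or beta side jB) (mirror side P)))
  = (eps jT (+) (jT == 1 :> nat)) (+) (eps jM (+) (jM == 1 :> nat))
     (+) (eps jB (+) (jB == 1 :> nat)) (+) tetra_det_pos i jT jM jB by [].
rewrite dg !pos_if_sgn; move: sd; rewrite !pos_ifE dne /= => /eqP ->.
case: (eps jT); case: (eps jM); case: (eps jB); case: (jT == 1 :> nat)%N;
  case: (jM == 1 :> nat)%N; case: (jB == 1 :> nat)%N; by case: (tetra_det_pos _ _ _ _).
Qed.

End TetraSide.

Section TetraPoints.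
Variables (R : realType) (beta : R^o -> R^o).
Hypothesis hb : Defs.bump beta.
Implicit Types (P Q d : 'rV[R]_3).

Lemma tet_ray_point d : tcone d -> exists k : R,
  [/\ 0 < k, tame beta (k *: d), tgap beta (k *: d) = 0,
      forall t : R, t < k -> tgap beta (t *: d) < 0 &
      forall t : R, tgap beta (t *: d) = 0 -> t = k].
Proof.
move=> [s0 sc]; have [k [k0 k1 Gk lo hi]] := tgap_ray hb s0.
have kd : 0 < tsum (k *: d) by rewrite tsumZ mulr_gt0.
have kc : tcone (k *: d).
  by split => //; rewrite dotZZ tsumZ exprMn mulrCA ltr_pM2l // exprn_gt0.
exists k; split => //.
- split; last by right.
  apply: lt_trans (kc.2) _; apply: (@le_lt_trans _ _ 8); last by lra.
  by rewrite tsumZ ler_piMr // expr_le1 // mulr_ge0 // ltW.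
- move=> t Gt; apply/eqP; rewrite eq_le !leNgt; apply/andP; split; apply/negP.
  + by move=> /hi; rewrite Gt ltxx.
  + by move=> /lo; rewrite Gt ltxx.
Qed.

Lemma ord4_cases (j : 'I_4) : [\/ j = 0, j = 1, j = 2 | j = 3].
Proof.
case: j => -[|[|[|[|//]]]] ?; [constructor 1|constructor 2|constructor 3|constructor 4];
  exact: val_inj.
Qed.

Lemma tame_gap0 P : tame beta P -> tgap beta P = 0 -> 0 < tsum P.
Proof. by move=> [_ [|[]]] // + e; rewrite e ltxx. Qed.

(** The crossing is sought on a line through the origin, where [tgap_ray] finds the
    fourth sheet.  The excluded signs of the two other sheets are those of the
    pattern for which there is no region on this side of the move. *)
Lemma tet_face_point (j k : 'I_4) (s : 'I_4 -> bool) : j != k ->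
  (exists l, [/\ l != j, l != k & s l != (l == 3 :> nat)]) ->
  exists Q, [/\ tame beta Q, tet_eq beta true j Q = 0, tet_eq beta true k Q = 0,
    (forall l, l != j -> l != k -> pos_if (s l) (tet_eq beta true l Q : R)) &
    (j == 3 :> nat) || (k == 3 :> nat) ==> (0 < tsum Q)].
Proof.
have with3 (j' : 'I_4) : j' != 3 ->
  (exists l, [/\ l != j', l != 3 & s l != (l == 3 :> nat)]) ->
  exists Q, [/\ tame beta Q, tet_eq beta true j' Q = 0, tgap beta Q = 0 &
    (forall l, l != j' -> l != 3 -> pos_if (s l) (tet_eq beta true l Q : R))].
  move=> j3 el.
  pose v (b : bool) : R := if b then 1 else - (1 / 2).
  pose e (i : 'I_4) : R := if i == j' then 0 else v (s i).
  pose d := vec3 (e 0) (e 1) (e 2).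
  have vE b : pos_if b (v b) by case: b; rewrite /v /pos_if; lra.
  have cd : tcone d.
    move: el => [l [l1 l2]]; rewrite /tcone /tsum dotE /d !vec3E /e /v.
    by case: (ord4_cases j') j3 l1 => -> // _; case: (ord4_cases l) l2 => -> //= _ _;
      case: (s 0); case: (s 1); case: (s 2) => //= _; split; lra.
  have [k' [k0 tk Gk sk _]] := tet_ray_point cd.
  have coord (l : 'I_4) : l != 3 -> tet_eq beta true l (k' *: d) = k' * e l :> R.
    rewrite tet_eqE; case: (ord4_cases l) => -> //= _; by rewrite !mxE.
  exists (k' *: d); split => //.
    by rewrite (coord _ j3) /e eqxx mulr0.
  move=> l lj l3; rewrite coord // pos_if_pmul // /e (negbTE lj); exact: vE.
move=> jk el.
have [k3|k3] := eqVneq k 3.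
  have [||Q [tQ ej ek sQ]] := with3 j; first by rewrite -k3.
    by move: el => [l [l1 l2 l3]]; exists l; rewrite -k3.
  exists Q; split => //; first by rewrite k3 tet_eqE.
    by move=> l l1 l2; apply: sQ => //; rewrite -k3.
  by apply/implyP => _; exact: tame_gap0.
have [j3|j3] := eqVneq j 3.
  have [||Q [tQ ej ek sQ]] := with3 k; first by rewrite -j3 eq_sym.
    by move: el => [l [l1 l2 l3]]; exists l; rewrite -j3.
  exists Q; split => //; first by rewrite j3 tet_eqE.
    by move=> l l1 l2; apply: sQ => //; rewrite -j3.
  by apply/implyP => _; exact: tame_gap0.
pose e (i : 'I_4) : R := if (i == j) || (i == k) then 0 else 1.
pose d := vec3 (e 0) (e 1) (e 2).
have ds : tsum d = 1.
  rewrite /tsum /d !vec3E /e.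
  by case: (ord4_cases j) j3 jk => -> // _; case: (ord4_cases k) k3 => -> //= _ _; lra.
have dd : dot d d = 1.
  rewrite dotE /d !vec3E /e.
  by case: (ord4_cases j) j3 jk => -> // _; case: (ord4_cases k) k3 => -> //= _ _; lra.
have cd : tcone d by rewrite /tcone ds dd; split; lra.
have coord (t : R) (l : 'I_4) : l != 3 -> tet_eq beta true l (t *: d) = t * e l :> R.
  by rewrite tet_eqE; case: (ord4_cases l) => -> //= _; rewrite !mxE.
have el0 : forall l, l != j -> l != k -> e l = 1.
  by move=> l l1 l2; rewrite /e (negbTE l1) (negbTE l2).
have fin (t : R) (b : bool) : (forall l, l != 3 -> l != j -> l != k -> s l = b) ->
    tame beta (t *: d) -> pos_if b t -> pos_if (s 3) (tgap beta (t *: d)) ->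
  exists Q, [/\ tame beta Q, tet_eq beta true j Q = 0, tet_eq beta true k Q = 0,
    (forall l, l != j -> l != k -> pos_if (s l) (tet_eq beta true l Q : R)) &
    (j == 3 :> nat) || (k == 3 :> nat) ==> (0 < tsum Q)].
  move=> sb tt bt gt; exists (t *: d); split => //.
  - by rewrite coord // /e eqxx mulr0.
  - by rewrite coord // /e eqxx orbT mulr0.
  - move=> l l1 l2; have [->|l3] := eqVneq l 3; first by rewrite tet_eqE.
    by rewrite coord // el0 // mulr1 sb.
  - have -> : (j == 3 :> nat)%N = false.
      by apply/negbTE; apply: contra j3 => /eqP e3; apply/eqP/val_inj.
    have -> // : (k == 3 :> nat)%N = false.
      by apply/negbTE; apply: contra k3 => /eqP e3; apply/eqP/val_inj.
have [l [l3 [lj lk]]] : exists l, l != 3 /\ l != j /\ l != k.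
  case: (ord4_cases j) j3 jk => -> // _; case: (ord4_cases k) k3 => -> //= _ _;
   by [exists 0|exists 1|exists 2].
have lu l' : l' != 3 -> l' != j -> l' != k -> s l' = s l.
  move: l3 lj lk.
  case: (ord4_cases j) j3 jk => -> // _; case: (ord4_cases k) k3 => -> //= _ _;
   case: (ord4_cases l) => -> //= _ _ _; by case: (ord4_cases l') => ->.
have [k' [k0 tk Gk sk _]] := tet_ray_point cd.
have gapd (t : R) : tgap beta (t *: d) <= t.
  by apply: le_trans (tgap_le_sum hb _) _; rewrite tsumZ ds mulr1.
have d9 (t : R) : dot (t *: d) (t *: d) = t ^+ 2 by rewrite dotZZ dd mulr1.
case sl : (s l).
  case s3 : (s 3).
    have g2 : 0 < tgap beta (2 *: d).
      rewrite /tgap tsumZ ds mulr1.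
      by have := bump_le1 hb (tquad_ge0 (2 *: d)); move: (beta _ : R) => x; lra.
    apply: (fin 2 true) => //.
    - by move=> l' *; rewrite lu.
    - split; first by rewrite d9; lra.
      by right; rewrite /tcone d9 tsumZ ds; split; lra.
    - by rewrite /pos_if; lra.
    - by rewrite s3.
  have [k1 [k10 [k19 _] _ lo _]] := tet_ray_point cd.
  have k2 : k1 / 2 < k1 by rewrite ltr_pdivrMr //; lra.
  apply: (fin (k1 / 2) true) => //.
  - by move=> l' *; rewrite lu.
  - split; last by left; exact: lo.
    by move: k19; rewrite !d9 expr_div_n; move: (k1 ^+ 2) (sqr_ge0 k1) => x; lra.
  - by rewrite /pos_if divr_gt0.
  - by rewrite s3; exact: lo.
have s3 : s 3 = false.
  apply/negbTE/negP => s3; move: el => [l' [l1 l2]].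
  have [->|l3'] := eqVneq l' 3; first by rewrite s3.
  rewrite lu // sl.
  have -> // : (l' == 3 :> nat)%N = false.
  by apply/negbTE; apply: contra l3' => /eqP e3; apply/eqP/val_inj.
have g1 : tgap beta ((-1) *: d) < 0 by apply: le_lt_trans (gapd _) _; lra.
apply: (fin (-1) false) => //.
- by move=> l' *; rewrite lu.
- by split; [rewrite d9; lra|left].
- by rewrite /pos_if; lra.
- by rewrite s3.
Qed.

(** These are the origin and one point on each axis. *)
Lemma tet_triple_point (i : 'I_4) : exists P, [/\ tame beta P,
  forall j, j != i -> tet_eq beta true j P = 0,
  pos_if (i != 3 :> nat) (tet_eq beta true i P : R),
  i != 3 :> nat -> 0 < tgrad beta P 0 (inord i) &
  forall Q, (forall j, j != i -> tet_eq beta true j Q = 0) -> Q = P].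
Proof.
have zE Q (j : 'I_4) : j != 3 -> tet_eq beta true j Q = Q 0 (inord j) :> R.
  rewrite tet_eqE; case: (ord4_cases j) => -> //= _; congr (Q 0 _); apply: val_inj;
    by rewrite /= inordK.
have in0 : inord 0 = 0 :> 'I_3 by apply: val_inj; rewrite /= inordK.
have in1 : inord 1 = 1 :> 'I_3 by apply: val_inj; rewrite /= inordK.
have in2 : inord 2 = 2 :> 'I_3 by apply: val_inj; rewrite /= inordK.
have [->|i3] := eqVneq i 3.
  exists 0; split => //.
  - split; first by rewrite dotE !mxE; lra.
    left; rewrite /tgap -(scale0r 0) tsumZ tquadZ expr2 !mul0r sub0r oppr_lt0.
    exact: bump_gt0.
  - by move=> j j3; rewrite zE // mxE.
  - rewrite tet_eqE /= /tgap -(scale0r 0) tsumZ tquadZ expr2 !mul0r sub0r oppr_lt0.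
    exact: bump_gt0.
  move=> Q HQ; apply: vec3_ext; rewrite mxE.
  - by rewrite -in0 -(zE Q 0) // HQ.
  - by rewrite -in1 -(zE Q 1) // HQ.
  - by rewrite -in2 -(zE Q 2) // HQ.
pose e (j : 'I_4) : R := (j == i)%:R.
pose d := vec3 (e 0) (e 1) (e 2).
have cd : tcone d.
  rewrite /tcone /tsum dotE /d !vec3E /e.
  by case: (ord4_cases i) i3 => -> //= _; split; lra.
have dE (k : R) (j : 'I_4) : j != 3 -> tet_eq beta true j (k *: d) = k * e j :> R.
  by rewrite tet_eqE; case: (ord4_cases j) => -> //= _; rewrite !mxE.
have [k [k0 tk Gk lo uk]] := tet_ray_point cd.
exists (k *: d); split => //.
- move=> j ji; have [->|j3] := eqVneq j 3; first by rewrite tet_eqE.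
  by rewrite dE // /e (negbTE ji) mulr0.
- have -> : (i != 3 :> nat)%N by apply: contra i3 => /eqP e3; apply/eqP/val_inj.
  by rewrite dE // /e eqxx mulr1.
- move=> _; have := tgrad_radial hb (k *: d).
  have -> : dot (tgrad beta (k *: d)) (k *: d) = k * tgrad beta (k *: d) 0 (inord i).
    rewrite dotZr; congr (_ * _); move: (tgrad beta _) => g.
    rewrite dotE /d !vec3E /e.
    case: (ord4_cases i) i3 => -> //= _; rewrite ?in0 ?in1 ?in2;
      by rewrite !(mulr0, mulr1, addr0, add0r).
  move=> H; rewrite -(pmulr_rgt0 _ k0); apply: lt_le_trans H.
  exact: tame_gap0.
- move=> Q HQ.
  have QE : Q = Q 0 (inord i) *: d.
    apply: vec3_ext; rewrite !mxE /= !(tnth_nth 0) /= /e.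
    + have [<-|n] := eqVneq 0 i; first by rewrite in0 mulr1.
      by rewrite mulr0 -in0 -(zE Q 0) // HQ.
    + have [<-|n] := eqVneq 1 i; first by rewrite in1 mulr1.
      by rewrite mulr0 -in1 -(zE Q 1) // HQ.
    + have [<-|n] := eqVneq 2 i; first by rewrite in2 mulr1.
      by rewrite mulr0 -in2 -(zE Q 2) // HQ.
  rewrite QE; congr (_ *: _); apply: uk; rewrite -QE.
  by have := HQ 3; rewrite tet_eqE /= => -> //; rewrite eq_sym.
Qed.

End TetraPoints.

(** * Tetrahedral move: the chains *)

Section TetraRank.
Variables (R : realType) (beta : R^o -> R^o).
Hypothesis hb : Defs.bump beta.
Variables (D : diagram R) (U V : set 'rV[R]_3) (h h' : 'rV[R]_3 -> 'rV[R]_3).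
Hypotheses (hh : diffeo U V h h') (BV : [set q | dot q q <= 9] `<=` V).
Variables (side : bool) (rk : {perm 'I_4}) (sg : bool) (eps : 'I_4 -> bool).
Local Notation sheet := (@side_sheet R beta Tetrahedral side).
Hypothesis hm : @modeled R D U V h' 4 sheet rk sg eps.
Variables (X : choiceType) (T : X -> X -> X -> X) (c : set 'rV[R]_3 -> X).
Hypothesis hc : coloring T D c.
Variable delta : bool.
Hypothesis hdelta : forall p, dot p p <= 9 -> (\det (jac h' p) < 0) = delta.
Variable eta : R.
Hypothesis eta01 : 0 < eta <= 1.
Hypothesis etaP : forall P : 'rV[R]_3, `|P 0 0| <= eta -> `|P 0 1| <= eta ->
  `|P 0 2| <= eta -> tgap beta P < 0.
Variable P : 'I_4 -> 'rV[R]_3.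
Hypothesis HP : forall i, [/\ tame beta (P i),
  forall j, j != i -> tet_eq beta true j (P i) = 0,
  pos_if (i != 3 :> nat) (tet_eq beta true i (P i) : R),
  i != 3 :> nat -> 0 < tgrad beta (P i) 0 (inord i) &
  forall Q, (forall j, j != i -> tet_eq beta true j Q = 0) -> Q = P i].

Local Notation J := (rk^-1)%g.
Local Notation or_ := (orient side eps delta).

(** The colors, with the sheets indexed by height and their sides measured by the
    co-orientations. *)
Definition rank_color (t : 'I_4 -> bool) : X :=
  tet_col D h' side c eta (fun j => t (rk j) (+) or_ j).

Lemma rank_face (a b : 'I_4) t : (a < b)%N ->
  (exists r, [/\ r != a, r != b & t r != (J r == 3 :> nat) (+) or_ (J r)]) ->
  face_at T rank_color a b t.
Proof.
move=> ab [r [ra rb rt]].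
have jab : J a != J b by apply: contraTneq ab => /perm_inj->; rewrite ltnn.
pose s j := t (rk j) (+) or_ j.
have [|Q [tQ ea eb sQ s3]] := tet_face_point hb (s := s) jab.
  exists (J r); split.
  - by apply: contraNneq ra => /perm_inj->.
  - by apply: contraNneq rb => /perm_inj->.
  - by rewrite /s permKV; apply: contraNneq rt => <-; rewrite -addbA addbb addbF.
have := tet_face hb hh BV hm hc hdelta eta01 etaP jab _ tQ ea eb sQ s3.
rewrite !permKV => /(_ ab); rewrite /face_at /rank_color /= => E.
have cE x y : (fun j => (if rk j == a then x else if rk j == b then y else t (rk j)) (+) or_ j)
  = (fun j => if j == J a then x (+) or_ (J a) else if j == J b then y (+) or_ (J b) else s j).
  apply/funext => j; rewrite -(inj_eq (@perm_inj _ J)) permK.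
  have [->//|_] := eqVneq j (J a).
  rewrite -(inj_eq (@perm_inj _ J)) permK.
  by have [->|] := eqVneq j (J b).
by rewrite !cE.
Qed.

(** The sign of the triple point which is not on the sheet of height [r], as given
    by [tet_triple]. *)
Definition rank_sign (r : 'I_4) : bool :=
  let w j := eps j (+) (j == 1 :> nat) in
  match val r with
  | 0%N => w (J 3) (+) w (J 2) (+) w (J 1) (+) tetra_det_pos (J 0) (J 3) (J 2) (J 1)
  | 1%N => w (J 3) (+) w (J 2) (+) w (J 0) (+) tetra_det_pos (J 1) (J 3) (J 2) (J 0)
  | 2%N => w (J 3) (+) w (J 1) (+) w (J 0) (+) tetra_det_pos (J 2) (J 3) (J 1) (J 0)
  | _ => w (J 2) (+) w (J 1) (+) w (J 0) (+) tetra_det_pos (J 3) (J 2) (J 1) (J 0)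
  end.

Lemma J_uniq : uniq [:: J 0; J 1; J 2; J 3].
Proof. by rewrite -(map_inj_uniq (@perm_inj _ rk)) /= !permKV. Qed.

(** By [tetra_sign_const] the determinants alternate; the orientations of the four
    sheets enter symmetrically once the side of the missing sheet is included. *)
Lemma rank_sign_const : exists s, forall r,
  rank_sign r (+) ((J r == 3 :> nat) (+) or_ (J r)) (+) odd r = s.
Proof.
have [s [s0 s1 s2 s3]] := tetra_sign_const J_uniq.
pose w j := eps j (+) (j == 1 :> nat).
exists (w (J 0) (+) w (J 1) (+) w (J 2) (+) w (J 3) (+) ~~ side (+) delta (+) s) => r.
rewrite /rank_sign /orient -/(w _) -/(w _) -/(w _) -/(w _).
case: (ord4_cases r) => -> /=.
- rewrite -s0 /w; case: (J 0 == 3 :> nat); case: (J 0 == 1 :> nat); case: (eps (J 0)); case: (side); case: (delta); case: (eps (J 1) (+) _); case: (eps (J 2) (+) _); case: (eps (J 3) (+) _); by case: (tetra_det_pos _ _ _ _).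
- rewrite -[s]negbK -s1 /w; case: (J 1 == 3 :> nat); case: (J 1 == 1 :> nat); case: (eps (J 1)); case: (side); case: (delta); case: (eps (J 0) (+) _); case: (eps (J 2) (+) _); case: (eps (J 3) (+) _); by case: (tetra_det_pos _ _ _ _).
- rewrite -s2 /w; case: (J 2 == 3 :> nat); case: (J 2 == 1 :> nat); case: (eps (J 2)); case: (side); case: (delta); case: (eps (J 0) (+) _); case: (eps (J 1) (+) _); case: (eps (J 3) (+) _); by case: (tetra_det_pos _ _ _ _).
- rewrite -[s]negbK -s3 /w; case: (J 3 == 3 :> nat); case: (J 3 == 1 :> nat); case: (eps (J 3)); case: (side); case: (delta); case: (eps (J 0) (+) _); case: (eps (J 1) (+) _); case: (eps (J 2) (+) _); by case: (tetra_det_pos _ _ _ _).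
Qed.

Definition rank_point (r : 'I_4) : 'rV[R]_3 * bool * 4.-tuple X :=
  (h' (mirror side (P (J r))), rank_sign r,
   facet (on_bits rank_color) r (~~ ((J r == 3 :> nat) (+) or_ (J r)))).

(** Three sheets meet once, and the fourth one has there a definite sign: the
    colored path is that of a facet of the cube. *)
Lemma rank_triple (r : 'I_4) t : t.1.1 = h' (mirror side (P (J r))) ->
  colored_triple_points D c t <-> t = rank_point r.
Proof.
have [tP zP sP gP _] := HP (J r); rewrite /rank_point /rank_sign.
have lt_J (a b : 'I_4) : (a < b)%N -> (rk (J a) < rk (J b))%N by rewrite !permKV.
have neqJ (a b : 'I_4) : (J a == J b) = (a == b) by rewrite (inj_eq (@perm_inj _ J)).
have uJ (a b d e : 'I_4) : uniq [:: a; b; d; e] -> uniq [:: J a; J b; J d; J e].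
  move=> u; have E : uniq (map J [:: a; b; d; e]) = uniq [:: a; b; d; e].
    exact: map_inj_uniq (@perm_inj _ J) _.
  by move: E; rewrite u.
have colE (i a b d : 'I_4) x y z (u : 'I_4 -> bool) :
   uniq [:: i; a; b; d] -> u i = ~~ ((J i == 3 :> nat) (+) or_ (J i)) ->
   u a = x -> u b = y -> u d = z ->
   tet_col D h' side c eta (fun j => if j == J i then J i != 3 :> nat else
    (if j == J a then x else if j == J b then y else z) (+) or_ j) = rank_color u.
  move=> un ui ua ub ud; rewrite /rank_color; congr tet_col; apply/funext => j.
  have : j \in [:: J i; J a; J b; J d] by apply: ord4_cover; exact: uJ.
  move: un; rewrite /= !inE !negb_or => /and4P[/and3P[n1 n2 n3] /andP[n4 n5] n6 _].
  case/or4P => /eqP->; rewrite ?eqxx ?permKV ?neqJ.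
  - by rewrite ui; case: (J i == 3 :> nat); case: (or_ _).
  - by rewrite eq_sym (negbTE n1) ua.
  - by rewrite eq_sym (negbTE n2) eq_sym (negbTE n4) ub.
  - by rewrite eq_sym (negbTE n3) eq_sym (negbTE n5) eq_sym (negbTE n6) ud.
move=> et.
case: (ord4_cases r) tP zP sP gP et => -> tP zP sP gP et /=.
- rewrite (tet_triple hb hh BV hm c hdelta eta01 etaP (uJ 0 3 2 1 isT) (lt_J 1 2 isT) (lt_J 2 3 isT) tP zP sP gP et).
  have e x y z := colE 0 1 2 3 x y z (fun r : 'I_4 => nth false
    [:: ~~ ((J 0 == 3 :> nat) (+) or_ (J 0)); x; y; z] r) isT erefl erefl erefl erefl.
  by rewrite !e.
- rewrite (tet_triple hb hh BV hm c hdelta eta01 etaP (uJ 1 3 2 0 isT) (lt_J 0 2 isT) (lt_J 2 3 isT) tP zP sP gP et).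
  have e x y z := colE 1 0 2 3 x y z (fun r : 'I_4 => nth false
    [:: x; ~~ ((J 1 == 3 :> nat) (+) or_ (J 1)); y; z] r) isT erefl erefl erefl erefl.
  by rewrite !e.
- rewrite (tet_triple hb hh BV hm c hdelta eta01 etaP (uJ 2 3 1 0 isT) (lt_J 0 1 isT) (lt_J 1 3 isT) tP zP sP gP et).
  have e x y z := colE 2 0 1 3 x y z (fun r : 'I_4 => nth false
    [:: x; y; ~~ ((J 2 == 3 :> nat) (+) or_ (J 2)); z] r) isT erefl erefl erefl erefl.
  by rewrite !e.
- rewrite (tet_triple hb hh BV hm c hdelta eta01 etaP (uJ 3 2 1 0 isT) (lt_J 0 1 isT) (lt_J 1 2 isT) tP zP sP gP et).
  have e x y z := colE 3 0 1 2 x y z (fun r : 'I_4 => nth false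
    [:: x; y; z; ~~ ((J 3 == 3 :> nat) (+) or_ (J 3))] r) isT erefl erefl erefl erefl.
  by rewrite !e.
Qed.

Local Notation B := (h' @` [set q : 'rV[R]_3 | dot q q <= 9]).

Lemma rank_in_ball r : dot (mirror side (P r)) (mirror side (P r)) <= 9.
Proof. by rewrite dot_mirror ltW //; have [[]] := HP r. Qed.

Lemma rank_points_uniq : uniq [seq rank_point r | r <- enum 'I_4].
Proof.
have [_ _ VU _ _] := hh.
rewrite map_inj_uniq ?enum_uniq // => r r' [e _ _].
have {}e : mirror side (P (J r)) = mirror side (P (J r')).
  have := congr1 h e.
  by rewrite (VU _ (BV (rank_in_ball _))).2 (VU _ (BV (rank_in_ball _))).2.
have {}e : P (J r) = P (J r') by rewrite -[LHS](mirrorK side) e mirrorK.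
apply/eqP/negPn/negP => rr'.
have [_ zP _ _ _] := HP (J r'); have [_ _ sP _ _] := HP (J r).
move: sP; rewrite e zP; last by rewrite (inj_eq (@perm_inj _ J)).
by rewrite pos_ifE eqxx.
Qed.

Lemma rank_points_in t : t \in [seq rank_point r | r <- enum 'I_4] -> B t.1.1.
Proof. by move=> /mapP[r _ ->]; exists (mirror side (P (J r))) => //; exact: rank_in_ball. Qed.

Lemma rank_points_all t : B t.1.1 ->
  colored_triple_points D c t <-> t \in [seq rank_point r | r <- enum 'I_4].
Proof.
move=> [p /= p9 ep]; split; last first.
  move=> /mapP[r _ tE]; apply/(rank_triple (r := r)) => //.
  by rewrite tE.
move=> tc.
have [j1 [u1 [j2 [u2 [j3 [u3 [[e1 e2 e3] [n12 n13 n23]]]]]]]] :=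
  modeled_preimages hh hm (BV p9) (esym ep) tc.
have [v1 z1] := (tet_sheetP _ _ _ _ _).1 e1.
have [v2 z2] := (tet_sheetP _ _ _ _ _).1 e2.
have [v3 z3] := (tet_sheetP _ _ _ _ _).1 e3.
have d12 : j1 != j2 by apply/eqP => e; apply: n12; rewrite v1 v2 e.
have d13 : j1 != j3 by apply/eqP => e; apply: n13; rewrite v1 v3 e.
have d23 : j2 != j3 by apply/eqP => e; apply: n23; rewrite v2 v3 e.
have [i un] : exists i : 'I_4, uniq [:: i; j1; j2; j3].
  have : (#|[set: 'I_4] :\: [set j1; j2; j3]| > 0)%N.
    rewrite cardsD cardsT card_ord subn_gt0.
    apply: leq_ltn_trans (subset_leq_card (subsetIr _ _)) _.
    by rewrite -finset.setUA cardsU1 cards2; case: (_ \notin _); case: (_ != _).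
  move=> /card_gt0P[i]; rewrite !inE andbT !negb_or => /andP[/andP[i1 i2] i3].
  by exists i; rewrite /= !inE !negb_or i1 i2 i3 d12 d13 d23.
have [_ _ _ _ uP] := HP i.
have E : mirror side p = P i.
  apply: uP => j ji; have : j \in [:: i; j1; j2; j3] by exact: ord4_cover.
  have z (j' : 'I_4) : tet_eq beta side j' p = 0 -> tet_eq beta true j' (mirror side p) = 0.
    move=> ej; apply/eqP; rewrite -(tet_eq_neq0 beta side) mirrorK ej eqxx //.
  by rewrite !inE (negbTE ji) /= => /or3P[]/eqP->; exact: z.
apply/mapP; exists (rk i); first by rewrite mem_enum.
by apply/(rank_triple (r := rk i)) => //; rewrite permK -E mirrorK.
Qed.

End TetraRank.

Section TetraMove.
Variables (R : realType) (beta : R^o -> R^o).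
Hypothesis hb : Defs.bump beta.
Variables (K : comNzRingType) (X : choiceType) (T : X -> X -> X -> X).
Variables (D D' : diagram R) (c c' : set 'rV[R]_3 -> X).
Hypotheses (hc : coloring T D c) (hc' : coloring T D' c').
Variables (U V : set 'rV[R]_3) (h h' : 'rV[R]_3 -> 'rV[R]_3).
Hypotheses (hh : diffeo U V h h') (BV : [set q | dot q q <= 9] `<=` V).
Variables (rk : {perm 'I_4}) (sg : bool) (eps : 'I_4 -> bool).
Hypothesis hm : @modeled R D U V h' 4 (@side_sheet R beta Tetrahedral true) rk sg eps.
Hypothesis hm' : @modeled R D' U V h' 4 (@side_sheet R beta Tetrahedral false) rk sg eps.
Local Notation B := (h' @` [set q : 'rV[R]_3 | dot q q <= 9]).
Hypothesis same : forall y, ~ B y -> same_diagram_at D D' y.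
Hypothesis hagree : forall y : 'rV[R]_3, ~ B y -> ~ image3 D y ->
  c (region D y) = c' (region D' y).
Implicit Types (p q : 'rV[R]_3).

(** Where the sum exceeds 1 in absolute value, the fourth sheets of both sides are
    out of reach of the bump. *)
Lemma sphere_color p : dot p p = 9 -> 1 < `|tsum p| ->
  (forall i, p 0 i != 0) -> c (region D (h' p)) = c' (region D' (h' p)).
Proof.
move=> p9 p1 pi; apply: (sphere_agree hh BV hagree) => //.
have Vp : V p by apply: BV; rewrite /= p9.
have [[_ oV] _ _ _ _] := hh.
have nz (j : 'I_4) (sd : bool) : tet_eq beta true j (mirror sd p) != 0 :> R.
  have b0 := bump_ge0 hb (tquad_ge0 (mirror sd p)).
  have b1 := bump_le1 hb (tquad_ge0 (mirror sd p)).
  rewrite tet_eqE; case: (ord4_cases j) => -> /=.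
  - by case: sd {b0 b1} => /=; rewrite ?mxE ?oppr_eq0.
  - by case: sd {b0 b1} => /=; rewrite ?mxE ?oppr_eq0.
  - by case: sd {b0 b1} => /=; rewrite ?mxE ?oppr_eq0.
  have s1 : 1 < `|tsum (mirror sd p)|.
    case: sd {b0 b1} => //=; rewrite (_ : tsum (- p) = - tsum p) ?normrN //.
    by rewrite /tsum !mxE; ring.
  rewrite /tgap; move: s1 b0 b1; move: (beta _ : R) (tsum _) => x y s1 b0 b1.
  apply/eqP => e; have {}e : y = x by lra.
  by move: s1; rewrite e ger0_norm //; lra.
have near_nz (sd : bool) : \forall q \near p, forall j : 'I_4,
    tet_eq beta true j (mirror sd q) != 0 :> R.
  have H : \forall P \near mirror sd p, forall j : 'I_4, tet_eq beta true j P != 0 :> R.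
    have Hj (j : 'I_4) : \forall P \near mirror sd p, tet_eq beta true j P != 0 :> R.
      have s1 : pos_if (0 < (tet_eq beta true j (mirror sd p) : R)) (tet_eq beta true j (mirror sd p) : R).
        by rewrite pos_ifE nz eqxx.
      have := near_sign hb s1; apply: filterS => P.
      by rewrite pos_ifE => /andP[].
    exact: (filter_forall _ Hj).
  by have := near_mirror sd H; rewrite mirrorK.
near=> q.
have Vq : V q by near: q; exact: open_nbhs_nbhs.
split.
  apply: (modeled_off_image hh hm Vq).
  rewrite -[q](mirrorK true); apply: tet_off; near: q; exact: near_nz.
apply: (modeled_off_image hh hm' Vq).
rewrite -[q](mirrorK false); apply: tet_off; near: q; exact: near_nz.
Unshelve. all: by end_near. Qed.

(** On the patterns common to both sides the two colorings have a common base point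
    on the sphere, which gives the hypotheses of [glue_boundary]. *)
Lemma tetra_homologous : homologous T (diagram_chain K D c) (diagram_chain K D' c').
Proof.
have [eta [eta01 etaP]] := tetra_box hb.
have [delta hdelta] := ball3_delta hh BV.
have [P HP] := choice (tet_triple_point hb).
pose J := (rk^-1)%g.
pose m r := (J r == 3 :> nat) (+) orient true eps delta (J r).
have or' j : orient false eps delta j = ~~ orient true eps delta j.
  by rewrite /orient; case: (j == 1 :> nat); case: (eps j); case: (delta).
pose G := rank_color D h' true rk eps c delta eta.
pose G' := rank_color D' h' false rk eps c' delta eta.
have [s sgnE] := rank_sign_const true rk eps delta.
have outE (x y z : bool) : [|| x, y | z] ->
    c (region D (h' (tout R x y z))) = c' (region D' (h' (tout R x y z))) /\
    c (region D (h' (- tout R x y z))) = c' (region D' (h' (- tout R x y z))).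
  move=> xyz; have [t9 t1 [t2 t3 t4]] := toutP R xyz.
  have nz i : tout R x y z 0 i != 0.
    case: i => -[|[|[|//]]] i3.
    - by rewrite (_ : Ordinal i3 = 0); [move: t2; rewrite pos_ifE => /andP[]|apply: val_inj].
    - by rewrite (_ : Ordinal i3 = 1); [move: t3; rewrite pos_ifE => /andP[]|apply: val_inj].
    - by rewrite (_ : Ordinal i3 = 2); [move: t4; rewrite pos_ifE => /andP[]|apply: val_inj].
  split; apply: sphere_color => //.
  - by apply: lt_le_trans t1 (ler_norm _).
  - by rewrite dotE !mxE -t9 dotE; ring.
  - rewrite (_ : tsum (- _) = - tsum (tout R x y z)); last by rewrite /tsum !mxE; ring.
    by rewrite normrN; apply: lt_le_trans t1 (ler_norm _).
  - by move=> i; rewrite mxE oppr_eq0.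
have negout (E : diagram R) (e : set 'rV[R]_3 -> X) sd (x y z : bool)
    (hE : @modeled R E U V h' 4 (@side_sheet R beta Tetrahedral sd) rk sg eps) :
    [|| x, y | z] ->
    e (region E (h' (mirror sd (- tout R x y z)))) =
    e (region E (h' (mirror sd (tcorner eta (~~ x) (~~ y) (~~ z))))).
  move=> xyz; have [t9 t1 [t2 t3 t4]] := toutP R xyz.
  apply: (negative_side hb (@hat_segment _ _ _ _ _ _ _ hh BV _ _ _ _ hE _ e) eta01 etaP (C := hat_color E h' sd e)).
  - by rewrite dotE !mxE; move: t9; rewrite dotE; lra.
  - by rewrite /octant !mxE !pos_ifN !negbK.
  apply: le_lt_trans (tgap_le_sum hb _) _.
  by rewrite (_ : tsum (- _) = - tsum (tout R x y z)); [lra|rewrite /tsum !mxE; ring].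
have agree t : (exists r, t r != m r) -> (exists r, t r = m r) -> G t = G' t.
  move=> [r1 n1] [r2 n2].
  rewrite /G /G' /rank_color.
  pose u j := t (rk j) (+) orient true eps delta j.
  have -> : (fun j => t (rk j) (+) orient false eps delta j) = (fun j => ~~ u j).
    by apply/funext => j; rewrite or' addbN.
  rewrite -/u.
  have ur r : u (J r) = t r (+) m r (+) (J r == 3 :> nat).
    by rewrite /u /m permKV; case: (t r); case: (orient _ _ _ _); case: (_ == _).
  have u1 : u (J r1) != (J r1 == 3 :> nat).
    rewrite ur; move: n1; move: (J r1 == 3 :> nat) (t r1) (m r1).
    by move=> [] [] [].
  have u2 : u (J r2) = (J r2 == 3 :> nat) by rewrite ur n2 addbb addFb.
  rewrite /tet_col /hat_color.
  case u3 : (u 3) => /=.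
    have xyz : [|| u 0, u 1 | u 2].
      move: u1; case: (ord4_cases (J r1)) => ->; rewrite ?u3 //=;
        by case: (u 0); case: (u 1); case: (u 2).
    have [-> _] := outE _ _ _ xyz.
    have := negout D' c' false _ _ _ hm' xyz.
    by rewrite /mirror opprK.
  have xyz : [|| ~~ u 0, ~~ u 1 | ~~ u 2].
    move: u2; case: (ord4_cases (J r2)) => ->; rewrite ?u3 //=;
      by case: (u 0); case: (u 1); case: (u 2).
  have [_ <-] := outE _ _ _ xyz.
  have := negout D c true _ _ _ hm xyz.
  by rewrite /mirror !negbK.
pose S := [seq rank_point D h' true rk eps c delta eta P r | r <- enum 'I_4].
pose S' := [seq rank_point D' h' false rk eps c' delta eta P r | r <- enum 'I_4].
apply: (@move_homologous R K X T D D' c c' U V h h' hh BV same hagree S S').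
- by apply: rank_points_uniq HP; [exact: hh|exact: BV].
- by apply: rank_points_uniq HP; [exact: hh|exact: BV].
- exact: (rank_points_all hb hh BV hm c hdelta eta01 etaP HP).
- exact: (rank_points_all hb hh BV hm' c' hdelta eta01 etaP HP).
- move=> t; exact: (rank_points_in HP).
- move=> t; exact: (rank_points_in HP).
(* the main path of the glued cube *)
exists ((-1) ^+ s *: << [tuple on_bits (cube_glue G G' m) false false false false;
    on_bits (cube_glue G G' m) true false false false; on_bits (cube_glue G G' m) true true false false;
    on_bits (cube_glue G G' m) true true true false; on_bits (cube_glue G G' m) true true true true] >>).
have bS : \sum_(t <- S) signed_chain K t =
    \sum_(r < 4) (if rank_sign rk eps r then 1 else -1 : K) *: << facet (on_bits G) r (~~ m r) >>.
  by rewrite /S big_map big_enum.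
have bS' : \sum_(t <- S') signed_chain K t =
    \sum_(r < 4) (if rank_sign rk eps r then 1 else -1 : K) *: << facet (on_bits G') r (m r) >>.
  rewrite /S' big_map big_enum; apply: eq_bigr => r _.
  rewrite /signed_chain /rank_point /= or' addbN negbK -/(m r) //.
rewrite bS bS'.
have E := @glue_boundary K X T G G' m (rank_sign rk eps) s agree _ _ sgnE.
rewrite E; last first.
- move=> a b t ab [r [ra rb rt]].
  apply: (rank_face hb hh BV hm' hc' hdelta eta01 etaP ab).
  by exists r; split => //; rewrite or' rt /m; case: (J r == 3 :> nat); case: (orient _ _ _ _).
- move=> a b t ab [r [ra rb rt]].
  apply: (rank_face hb hh BV hm hc hdelta eta01 etaP ab).
  by exists r; split.
rewrite boundary3_sign subrr; exact: degenerate_chain0.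
Qed.

End TetraMove.

(** * Birth of a pair of triple points *)

Section PairSheets.
Variables (R : realType) (beta : R^o -> R^o).
Hypothesis hb : Defs.bump beta.
Implicit Types (P Q p w : 'rV[R]_3).

(** The three sheets as graphs: [pr_n] is the direction of the graph, [pr_L1] and
    [e3] span the plane of the parameters, and [pr_m], [pr_a], [e3] are the dual
    coordinate forms. *)
Definition pr_n (j : nat) : 'rV[R]_3 := match j with
  | 0%N => vec3 1 0 0 | 1%N => vec3 0 1 0 | _ => vec3 2^-1 2^-1 0 end.
Definition pr_L1 (j : nat) : 'rV[R]_3 := match j with
  | 0%N => vec3 0 1 0 | 1%N => vec3 1 0 0 | _ => vec3 2^-1 (- 2^-1) 0 end.
Definition pr_m (j : nat) : 'rV[R]_3 := match j with
  | 0%N => vec3 1 0 0 | 1%N => vec3 0 1 0 | _ => vec3 1 1 0 end.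
Definition pr_a (j : nat) : 'rV[R]_3 := match j with
  | 0%N => vec3 0 1 0 | 1%N => vec3 1 0 0 | _ => vec3 1 (-1) 0 end.
Local Notation e3 := (vec3 0 0 1 : 'rV[R]_3).

Lemma pr_dual j : dual_basis (pr_n j) (pr_L1 j) e3 (pr_m j) (pr_a j) e3.
Proof.
move=> w; case: j => [|[|j]]; apply: vec3_ext;
  rewrite /= !mxE !dotE !vec3E /= !(tnth_nth 0) /=; by field.
Qed.

Lemma pr_det j : 0 < (-1) ^+ (j != 0)%N * det3 (pr_n j) (pr_L1 j) e3.
Proof. case: j => [|[|j]]; rewrite /= ?expr0 ?expr1 !det3E !vec3E; lra. Qed.

Lemma pr_det_neq0 j : det3 (pr_n j) (pr_L1 j) e3 != 0.
Proof. by have := pr_det j; apply: contraTneq => ->; rewrite mulr0 ltxx. Qed.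

Definition pr_phi (side : bool) (j : nat) (u : 'rV[R]_2) : R^o :=
  match j with 0%N | 1%N => 0
  | _ => u 0 1 ^+ 2 - (if side then (radial beta u : R) else - (radial beta u : R)) end.

Lemma pr_sheetE side (j : 'I_3) u :
  @side_sheet R beta TriplePair side j u =
  graph_sheet (pr_n j) (pr_L1 j) e3 (pr_phi side j) u.
Proof.
rewrite /side_sheet /graph_sheet /pr_phi -/(radial beta u).
case: j => -[|[|[|//]]] j3 /=; apply: vec3_ext;
  rewrite !mxE /= !(tnth_nth 0) /=; case: side; by field.
Qed.

Lemma pr_phi_diff side (j : nat) u : differentiable (pr_phi side j) u.
Proof.
have [d _] := radial_diff hb u 0.
case: j => [|[|j]]; rewrite /pr_phi; try exact: differentiable_cst.
pose cc : 'rV[R]_2 -> R^o := fun v => v 0 1.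
have dc : differentiable cc u by exact: differentiable_coord.
have dcc : differentiable (cc ^+ 2) u by exact: differentiableX.
case: side; first exact: (differentiableB dcc d).
exact: (differentiableB dcc (differentiableN d)).
Qed.

Definition pr_eq side j : 'rV[R]_3 -> R^o :=
  graph_eq (pr_m j) (pr_a j) e3 (pr_phi side j).

(** The equation of the third sheet. *)
Definition pgap (side : bool) P : R := P 0 0 + P 0 1 - P 0 2 ^+ 2 +
  (if side then 1 else -1) * (beta ((P 0 0 - P 0 1) ^+ 2 + P 0 2 ^+ 2) : R).

Lemma pr_eqE side j P : pr_eq side j P = match j with
  0%N => P 0 0 | 1%N => P 0 1 | _ => pgap side P end.
Proof.
case: j => [|[|j]]; rewrite /pr_eq /graph_eq /pgap /= !dotE !vec3E;
  rewrite ?subr0; try by ring.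
rewrite /pr_phi /radial !vec2E.
have -> : 1 * P 0 0 + -1 * P 0 1 + 0 * P 0 2 = P 0 0 - P 0 1 by ring.
have -> : 0 * P 0 0 + 0 * P 0 1 + 1 * P 0 2 = P 0 2 by ring.
by case: side; move: (beta _ : R) => x; ring.
Qed.

Lemma pr_eq_diff side j p : differentiable (pr_eq side j) p.
Proof.
by have [] := @graph_eq_diff R (pr_m j) (pr_a j) e3 (pr_phi side j) p 0 (pr_phi_diff _ _ _).
Qed.

Definition pr_or side j (p : 'rV[R]_3) : R^o :=
  (-1) ^+ (j != 0)%N * (pr_eq side j p : R).

Lemma pr_or_co_oriented side (j : 'I_3) u :
  co_oriented (@side_sheet R beta TriplePair side j) u (pr_or side j).
Proof.
rewrite (_ : side_sheet _ _ _ = graph_sheet (pr_n j) (pr_L1 j) e3 (pr_phi side j)); last first.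
  by apply/funext => v; exact: pr_sheetE.
apply: graph_sheet_co_oriented.
- exact: pr_dual.
- exact: pr_det_neq0.
- exact: pr_phi_diff.
- exact: pr_det.
Qed.

Lemma pr_sheetP side (j : 'I_3) u p :
  @side_sheet R beta TriplePair side j u = p <->
  u = proj2 (pr_a j) e3 p /\ pr_eq side j p = 0.
Proof.
by rewrite pr_sheetE; apply: graph_sheetP; [exact: pr_dual | exact: pr_det_neq0].
Qed.

(** The term [z ^ 2] and the bump contribute to the vertical derivative with the same
    sign, since the bump does not increase with the distance. *)
Lemma pr_grad_vertical P : P 0 2 != 0 -> exists2 k : R, 1 <= k &
  grad (pr_eq true 2) P 0 2 = - (2 * k * P 0 2).
Proof.
move=> z0; set u := proj2 (pr_a 2) e3 P; set v := proj2 (pr_a 2) e3 e3.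
have u1 : u 0 1 = P 0 2 by rewrite /u /proj2 vec2E dotE !vec3E; ring.
have v0 : v 0 0 = 0 by rewrite /v /proj2 vec2E dotE !vec3E; ring.
have v1 : v 0 1 = 1 by rewrite /v /proj2 vec2E dotE !vec3E; ring.
have [dr er] := radial_diff hb u v.
pose cc : 'rV[R]_2 -> R^o := fun v => v 0 1.
have dc : differentiable cc u by exact: differentiable_coord.
have cE : 'd cc u v = v 0 1.
  exact: (congr1 (fun F : _ -> _ => F v) (@diff_val _ _ _ _ _ _ _ (coord_diff u 1))).
have dcc : differentiable (cc * cc) u by exact: differentiableM.
have eM : 'd (cc * cc) u v = u 0 1 * v 0 1 + u 0 1 * v 0 1 :> R.
  apply: (etrans (congr1 (fun F : _ -> _ => F v) (diffM dc dc))).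
  exact: (congr2 (fun x y : R => u 0 1 * x + u 0 1 * y) cE cE).
set b1 := ('d beta (u 0 0 ^+ 2 + u 0 1 ^+ 2) 1 : R) in er.
have b10 : b1 <= 0.
  apply: (bump_slope hb); rewrite ltr_wpDl ?sqr_ge0 //.
  by rewrite u1 exprn_even_gt0.
exists (1 - b1); first by rewrite lerDl oppr_ge0.
have phiE : pr_phi true 2 = cc * cc - radial beta.
  by apply/funext => x; rewrite /pr_phi expr2.
have [_ E] := @graph_eq_diff R (pr_m 2) (pr_a 2) e3 (pr_phi true 2) P e3 (pr_phi_diff _ _ _).
have arith (x0 x1 y0 y1 z b : R) : x1 = z -> y0 = 0 -> y1 = 1 ->
    x1 * y1 + x1 * y1 - 2 * (x0 * y0 + x1 * y1) * b = 2 * z * (1 - b).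
  by move=> -> -> ->; ring.
have e4 : 'd (pr_phi true 2) u v = 2 * P 0 2 * (1 - b1) :> R.
  apply: (etrans (congr1 (fun g : _ -> _ => 'd g u v) phiE)).
  apply: (etrans (congr1 (fun F : _ -> _ => F v) (diffB dcc dr))).
  apply: (etrans (congr2 (fun x y : R => x - y) eM er)).
  exact: (arith _ _ _ _ _ b1 u1 v0 v1).
rewrite /grad vec3E; apply: (etrans E).
apply: (etrans (congr1 (fun x : R => dot (pr_m 2) e3 - x) e4)).
by rewrite /= dotE !vec3E; ring.
Qed.

(** The sheets [x = 0] and [y = 0] meet the third one where [t ^ 2] equals the bump;
    the first increases and the second decreases with the height. *)
Lemma pair_height : exists z : R, [/\ 0 < z <= 1, (beta (z ^+ 2) : R) = z ^+ 2 &
  forall t : R, (beta (t ^+ 2) : R) = t ^+ 2 -> t = z \/ t = - z].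
Proof.
pose f (t : R) := (beta (t ^+ 2) : R) - t ^+ 2.
have fc : continuous f.
  move=> t; have c1 : {for t, continuous (fun t : R => t ^+ 2 : R)} by exact: exprn_continuous.
  have c2 : {for t, continuous (fun t : R => beta (t ^+ 2) : R)}.
    apply: (@continuous_comp _ _ _ (fun t : R => t ^+ 2) beta); first exact: c1.
    exact/differentiable_continuous/(bump_dif hb).
  exact: (@continuousB R R^o _ _ _ _ c2 c1).
have f0 : 0 < f 0 by rewrite /f expr2 mul0r subr0 (bump_gt0 hb).
have f1 : f 1 <= 0.
  by rewrite /f expr1n (bump_out hb) // sub0r oppr_le0.
have [||z] := @IVT R f 0 1 0 ler01 _ _.
- exact: continuous_subspaceT.
- by rewrite ge_min le_max f1 orbT (ltW f0).
rewrite in_itv /= => /andP[z0 z1] fz.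
have bz : (beta (z ^+ 2) : R) = z ^+ 2 by apply/eqP; rewrite -subr_eq0; apply/eqP.
have {}z0 : 0 < z.
  rewrite lt0r z0 andbT; apply/negP => /eqP e; rewrite e in fz; by move: f0; rewrite fz ltxx.
exists z; split; rewrite ?z0 ?z1 // => t bt.
suff E : t ^+ 2 = z ^+ 2.
  have : (t - z) * (t + z) = 0 by rewrite -subr_sqr E subrr.
  by move=> /eqP; rewrite mulf_eq0 => /orP[] /eqP e; [left|right]; lra.
apply/eqP; rewrite eq_le !leNgt; apply/andP; split; apply/negP => lt.
  have := bump_dec hb (sqr_ge0 z) (ltW lt); rewrite bt bz leNgt lt //.
by have := bump_dec hb (sqr_ge0 t) (ltW lt); rewrite bt bz leNgt lt.
Qed.

End PairSheets.

Lemma ord3_cases (j : 'I_3) : [\/ j = 0, j = 1 | j = 2].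
Proof.
by case: j => -[|[|[|//]]] ?; [constructor 1|constructor 2|constructor 3]; exact: val_inj.
Qed.

Section PairSide.
Variables (R : realType) (beta : R^o -> R^o).
Hypothesis hb : Defs.bump beta.
Variables (D : diagram R) (U V : set 'rV[R]_3) (h h' : 'rV[R]_3 -> 'rV[R]_3).
Hypotheses (hh : diffeo U V h h') (BV : [set q | dot q q <= 9] `<=` V).
Variables (rk : {perm 'I_3}) (sg : bool) (eps : 'I_3 -> bool).
Local Notation sheet := (@side_sheet R beta TriplePair true).
Hypothesis hm : @modeled R D U V h' 3 sheet rk sg eps.
Variables (X : choiceType) (T : X -> X -> X -> X) (c : set 'rV[R]_3 -> X).
Hypotheses (hT : ternary_quasigroup T) (hc : coloring T D c).
Variable delta : bool.
Hypothesis hdelta : forall p, dot p p <= 9 -> (\det (jac h' p) < 0) = delta.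
Variable z0 : R.
Hypotheses (z01 : 0 < z0 <= 1) (bz0 : (beta (z0 ^+ 2) : R) = z0 ^+ 2).
Implicit Types (P Q : 'rV[R]_3) (s : 'I_3 -> bool).

Local Notation eqn := (pr_eq beta true).
Local Notation gap := (pgap beta true).

Let r : R := z0 ^+ 2 / 8.

Let r01 : 0 < r <= 1 / 8.
Proof.
have [z1 z2] := andP z01; have : 0 < z0 ^+ 2 <= 1.
  by rewrite exprn_gt0 //= expr_le1 // ltW.
by rewrite /r => /andP[]; move: (z0 ^+ 2) => x; lra.
Qed.

Let color P : X := c (region D (h' P)).

Lemma pair_off P : (forall j : 'I_3, eqn j P != 0 :> R) -> off_sheets sheet P.
Proof. by move=> nz j u /pr_sheetP[_ e]; have := nz j; rewrite e eqxx. Qed.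

Lemma pair_segment s P Q : dot P P <= 9 -> dot Q Q <= 9 ->
  pos_if (s 0) (P 0 0) -> pos_if (s 1) (P 0 1) ->
  pos_if (s 0) (Q 0 0) -> pos_if (s 1) (Q 0 1) ->
  (forall t : R, 0 <= t <= 1 -> pos_if (s 2) (gap (P + t *: (Q - P)))) ->
  color P = color Q.
Proof.
move=> P9 Q9 P0 P1 Q0 Q1 G; congr c; apply: (modeled_segment hh hm) => t t01.
split; first by apply: BV; exact: ball3_convex.
apply: pair_off => j; rewrite pr_eqE.
have nz b (x : R) : pos_if b x -> x != 0 by rewrite pos_ifE => /andP[].
case: (ord3_cases j) => -> /=; last exact: nz (G t t01).
  by apply: (nz (s 0)); rewrite !mxE; exact: pos_if_conv.
by apply: (nz (s 1)); rewrite !mxE; exact: pos_if_conv.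
Qed.

Lemma pgap_anti P Q : Q 0 0 + Q 0 1 - Q 0 2 ^+ 2 <= P 0 0 + P 0 1 - P 0 2 ^+ 2 ->
  (P 0 0 - P 0 1) ^+ 2 + P 0 2 ^+ 2 <= (Q 0 0 - Q 0 1) ^+ 2 + Q 0 2 ^+ 2 ->
  gap Q <= gap P.
Proof.
move=> h1 h2; rewrite /pgap !mul1r; apply: lerD => //; apply: (bump_dec hb) => //.
by rewrite addr_ge0 ?sqr_ge0.
Qed.

Lemma pgap_far P : P 0 0 + P 0 1 - P 0 2 ^+ 2 < -1 -> gap P < 0.
Proof.
move=> h1; have d0 : 0 <= (P 0 0 - P 0 1) ^+ 2 + P 0 2 ^+ 2 by rewrite addr_ge0 ?sqr_ge0.
have := bump_le1 hb d0; rewrite /pgap; move: (beta _ : R) => x; lra.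
Qed.

(** The radius is chosen so that the bump, which is at least [z0 ^ 2] there,
    dominates [x + y]. *)
Lemma pgap_mid P : `|P 0 0| <= r -> `|P 0 1| <= r -> P 0 2 = 0 -> 0 < gap P.
Proof.
have [r0 r1] := andP r01.
rewrite !ler_norml => /andP[x1 x2] /andP[y1 y2] z0'.
rewrite /pgap z0' expr0n addr0 subr0 mul1r.
have le : (P 0 0 - P 0 1) ^+ 2 <= z0 ^+ 2.
  have -> : z0 ^+ 2 = 8 * r by rewrite /r; field.
  by nra.
have := bump_dec hb (sqr_ge0 _) le; rewrite bz0.
by have -> : z0 ^+ 2 = 8 * r by [rewrite /r; field]; move: (beta _ : R) => x; lra.
Qed.

Let hw (b : bool) : R := (if b then 1 else -1) * (r / 2).

Let hwP b : [/\ pos_if b (hw b), - (r / 2) <= hw b & hw b <= r / 2].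
Proof. by have [r0 r1] := andP r01; rewrite /hw /pos_if; case: b; split; lra. Qed.

(** A base point for each sign pattern.  Only for two positive signs and the negative
    side of the third sheet does it depend on the sign [sz] of the height: this
    is the sector cut by the third sheet into two regions. *)
Definition pair_base (sz : bool) s : 'rV[R]_3 :=
  if s 2 then vec3 (hw (s 0)) (hw (s 1)) 0
  else match s 0, s 1 with
  | true, true => vec3 (hw true) (hw true) ((if sz then 1 else -1) * (5 / 2))
  | false, true => vec3 (- 2) (hw true) 0
  | true, false => vec3 (hw true) (- 2) 0
  | false, false => vec3 (- 1) (- 1) 0
  end.

Definition pair_col sz s : X := color (pair_base sz s).

Definition pair_tame (sz : bool) P :=
  [/\ `|P 0 0| < r, `|P 0 1| < r, `|P 0 2| < 2 & pos_if sz (P 0 2)].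

Lemma pair_tame_ball sz P : pair_tame sz P -> dot P P <= 9.
Proof.
have [r0 r1] := andP r01.
rewrite /pair_tame !ltr_norml dotE => -[/andP[? ?] /andP[? ?] /andP[? ?] _]; nra.
Qed.

(** Above the third sheet the height is contracted to zero, which increases the
    equation.  Below it the point is moved away, in a horizontal direction that
    increases the distance of [x] and [y], or upwards when both are positive. *)
Lemma pair_color_pattern sz s P : pair_tame sz P ->
  (forall j : 'I_3, pos_if (s j) (eqn j P : R)) -> color P = pair_col sz s.
Proof.
move=> tP sP; have P9 := pair_tame_ball tP; move: tP => [x1 x2 x3 zP].
have [r0 r1] := andP r01.
have X0 := sP 0; have Y0 := sP 1; have G0 := sP 2; move: X0 Y0 G0; rewrite !pr_eqE /=.
move=> X0 Y0 G0; rewrite /pair_col /pair_base.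
have [t1 l1 u1] := hwP true; have [t2 l2 u2] := hwP false.
have P2 : P 0 2 ^+ 2 <= 4.
  move: x3; rewrite ltr_norml => /andP[? ?]; have -> : 4 = 2 ^+ 2 :> R by ring.
  by nra.
move: x1 x2; rewrite !ltr_norml => /andP[a1 a2] /andP[b1 b2].
case s2 : (s 2) G0 => G0.
  have [ts ls us] := hwP (s 0); have [tt lt ut] := hwP (s 1).
  pose Q := vec3 (P 0 0) (P 0 1) 0.
  have nQ : dot Q Q <= 9 by rewrite dotE !vec3E; nra.
  transitivity (color Q).
    apply: (pair_segment (s := s)) => //; rewrite ?vec3E // s2 => t /andP[t0 t1'].
    apply: lt_le_trans G0 _; apply: pgap_anti; rewrite !mxE /= !(tnth_nth 0) /=.
      move: (P 0 0) (P 0 1) (P 0 2) => x y z.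
      have -> : x + t * (x - x) + (y + t * (y - y)) - (z + t * (0 - z)) ^+ 2 =
        x + y - (1 - t) ^+ 2 * z ^+ 2 by ring.
      have : (1 - t) ^+ 2 * z ^+ 2 <= z ^+ 2.
        by apply: ler_piMl; [exact: sqr_ge0|apply: exprn_ile1; lra].
      by lra.
    move: (P 0 0) (P 0 1) (P 0 2) => x y z.
    have -> : (x + t * (x - x) - (y + t * (y - y))) ^+ 2 + (z + t * (0 - z)) ^+ 2 =
        (x - y) ^+ 2 + (1 - t) ^+ 2 * z ^+ 2 by ring.
    have : (1 - t) ^+ 2 * z ^+ 2 <= z ^+ 2.
      by apply: ler_piMl; [exact: sqr_ge0|apply: exprn_ile1; lra].
    by lra.
  apply: (pair_segment (s := s)) => //; rewrite ?vec3E //.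
    by rewrite dotE !vec3E; nra.
  rewrite s2 => t /andP[t0 t1']; apply: pgap_mid; rewrite !mxE /= !(tnth_nth 0) /= ?ler_norml.
  - by apply/andP; split; nra.
  - by apply/andP; split; nra.
  - by ring.
have low (Q W : 'rV[R]_3) : dot Q Q <= 9 -> dot W W <= 9 ->
    pos_if (s 0) (Q 0 0) -> pos_if (s 1) (Q 0 1) ->
    pos_if (s 0) (W 0 0) -> pos_if (s 1) (W 0 1) ->
    (forall t : R, 0 <= t <= 1 -> gap (P + t *: (Q - P)) <= gap P) ->
    (forall t : R, 0 <= t <= 1 -> gap (Q + t *: (W - Q)) < 0) ->
    color P = color W.
  move=> Q9 W9 Q0 Q1 W0 W1 GQ GW; transitivity (color Q).
    apply: (pair_segment (s := s)) => //; rewrite s2 => t t01.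
    by apply: le_lt_trans (GQ t t01) G0.
  by apply: (pair_segment (s := s)) => //; rewrite s2.
case s0 : (s 0) X0; case s1 : (s 1) Y0 => Y0 X0; rewrite /pos_if in X0 Y0 t1 t2.
(* the height 5 / 2 is large enough for its square to exceed [x + y] and the bump *)
- pose k : R := if sz then 1 else -1.
  have kk : k ^+ 2 = 1 by rewrite /k; case: (sz); ring.
  have kz : 0 < k * P 0 2 by move: zP; rewrite /k /pos_if; case: (sz); lra.
  have kz2 : k * P 0 2 < 2.
    by move: x3; rewrite ltr_norml /k; case: (sz); lra.
  have PE : P 0 2 ^+ 2 = (k * P 0 2) ^+ 2 by rewrite exprMn kk mul1r.
  apply: (low (vec3 (P 0 0) (P 0 1) (k * (5 / 2)))); rewrite ?s0 ?s1 /pos_if ?vec3E //.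
  + rewrite dotE !vec3E.
    have -> : k * (5 / 2) * (k * (5 / 2)) = 25 / 4 by rewrite mulrACA -expr2 kk; field.
    by nra.
  + rewrite dotE !vec3E -/k.
    have -> : k * (5 / 2) * (k * (5 / 2)) = 25 / 4 by rewrite mulrACA -expr2 kk; field.
    by nra.
  + move=> t /andP[t0 t1'].
    have E : P 0 2 ^+ 2 <= (P 0 2 + t * (k * (5 / 2) - P 0 2)) ^+ 2.
      rewrite PE (_ : (P 0 2 + _) ^+ 2 = (k * P 0 2 + t * (5 / 2 - k * P 0 2)) ^+ 2).
        by rewrite lerXn2r ?nnegrE; nra.
      have -> : k * P 0 2 + t * (5 / 2 - k * P 0 2) = k * (P 0 2 + t * (k * (5 / 2) - P 0 2)).
        rewrite [RHS](_ : _ = k * P 0 2 + t * (k ^+ 2 * (5 / 2) - k * P 0 2)); last by ring.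
        by rewrite kk mul1r.
      by rewrite exprMn kk mul1r.
    apply: pgap_anti; rewrite !mxE /= !(tnth_nth 0) /= !subrr !mulr0 !addr0; lra.
  + move=> t /andP[t0 t1']; apply: pgap_far; rewrite !mxE /= !(tnth_nth 0) /= subrr mulr0 addr0.
    have -> : (k * (5 / 2)) ^+ 2 = 25 / 4 by rewrite exprMn kk; field.
    by nra.
- apply: (low (vec3 (P 0 0) (P 0 1 - 2) (P 0 2))); rewrite ?s0 ?s1 /pos_if ?vec3E //;
    try lra; try by rewrite dotE !vec3E; nra.
  + move=> t /andP[t0 t1'].
    by apply: pgap_anti; rewrite !mxE /= !(tnth_nth 0) /= !subrr !mulr0 !addr0; nra.
  + move=> t /andP[t0 t1']; apply: pgap_far; rewrite !mxE /= !(tnth_nth 0) /=.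
    have := sqr_ge0 (P 0 2 + t * (0 - P 0 2)); nra.
- apply: (low (vec3 (P 0 0 - 2) (P 0 1) (P 0 2))); rewrite ?s0 ?s1 /pos_if ?vec3E //;
    try lra; try by rewrite dotE !vec3E; nra.
  + move=> t /andP[t0 t1'].
    by apply: pgap_anti; rewrite !mxE /= !(tnth_nth 0) /= !subrr !mulr0 !addr0; nra.
  + move=> t /andP[t0 t1']; apply: pgap_far; rewrite !mxE /= !(tnth_nth 0) /=.
    have := sqr_ge0 (P 0 2 + t * (0 - P 0 2)); nra.
- apply: (low (vec3 (P 0 0 - 1) (P 0 1 - 1) (P 0 2))); rewrite ?s0 ?s1 /pos_if ?vec3E //;
    try lra; try by rewrite dotE !vec3E; nra.
  + move=> t /andP[t0 t1'].
    by apply: pgap_anti; rewrite !mxE /= !(tnth_nth 0) /= !subrr !mulr0 !addr0; nra.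
  + move=> t /andP[t0 t1']; apply: pgap_far; rewrite !mxE /= !(tnth_nth 0) /=.
    have := sqr_ge0 (P 0 2 + t * (0 - P 0 2)); nra.
Qed.

End PairSide.

Lemma dot_ext (R : realType) (a b : 'rV[R]_3) : (forall w, dot a w = dot b w) -> a = b.
Proof. by move=> H; rewrite -(dot_basis a) -(dot_basis b) !H. Qed.

Lemma dotZl (R : realType) (k : R) (a b : 'rV[R]_3) : dot (k *: a) b = k * dot a b.
Proof. by rewrite dotC dotZr dotC. Qed.

Lemma grad_sign (R : realType) (g : 'rV[R]_3 -> R^o) (e : bool) P :
  differentiable g P ->
  grad (fun p => (-1) ^+ e * (g p : R) : R^o) P = (-1) ^+ e *: grad g P.
Proof.
move=> dg; apply: dot_ext => w.
apply: (etrans (esym (gradE _ _ _))).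
apply: (etrans (congr1 (fun F : _ -> _ => F w) (diffZ ((-1) ^+ e) dg))).
apply: (etrans (congr1 (fun x : R => (-1) ^+ e * x) (gradE g P w))).
exact: (esym (dotZl _ _ _)).
Qed.

Definition pr_normal (R : realType) (g : 'rV[R]_3) (j : 'I_3) : 'rV[R]_3 :=
  match val j with 0%N => vec3 1 0 0 | 1%N => vec3 0 1 0 | _ => g end.

Lemma pr_or_grad (R : realType) (beta : R^o -> R^o) (hb : Defs.bump beta) side (j : 'I_3) P :
  grad (pr_or beta side j) P =
  (-1) ^+ (j != 0 :> nat) *: pr_normal (grad (pr_eq beta side 2) P) j.
Proof.
rewrite (grad_sign _ (pr_eq_diff hb side j P)); congr (_ *: _).
have c0 (u v : 'rV[R]_2) : 'd (fun=> 0 : R^o) u v = 0.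
  exact: (congr1 (fun F : _ -> _ => F v) (diff_cst (0 : R^o) u)).
have E (j' : nat) : (j' < 2)%N -> forall w, dot (grad (pr_eq beta side j') P) w = dot (pr_m R j') w.
  move=> j2 w; rewrite -gradE.
  have [_ E] := @graph_eq_diff R (pr_m R j') (pr_a R j') (vec3 0 0 1) (pr_phi beta side j') P w (pr_phi_diff hb _ _ _).
  apply: (etrans E).
  have -> : pr_phi beta side j' = (fun=> 0) by case: j' j2 {E} => [|[|//]].
  by apply: (etrans (congr1 (fun x : R => dot _ w - x) (c0 _ _))); rewrite subr0.
case: (ord3_cases j) => ->.
- apply: dot_ext => w; exact: (E 0 isT w).
- apply: dot_ext => w; exact: (E 1 isT w).
- by [].
Qed.

(** Only the vertical component of the third normal matters. *)
Lemma pr_det3 (R : realType) (j k l : 'I_3) : uniq [:: j; k; l] -> exists e : bool,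
  forall g : 'rV[R]_3, det3 (pr_normal g j) (pr_normal g k) (pr_normal g l) = (-1) ^+ e * g 0 2.
Proof.
by case: (ord3_cases j) => ->; case: (ord3_cases k) => ->; case: (ord3_cases l) => -> //= _;
  [exists false|exists true|exists true|exists false|exists false|exists true] => g;
  rewrite det3E /pr_normal /= !vec3E; ring.
Qed.

Section PairCrossings.
Variables (R : realType) (beta : R^o -> R^o).
Hypothesis hb : Defs.bump beta.
Variables (D : diagram R) (U V : set 'rV[R]_3) (h h' : 'rV[R]_3 -> 'rV[R]_3).
Hypotheses (hh : diffeo U V h h') (BV : [set q | dot q q <= 9] `<=` V).
Variables (rk : {perm 'I_3}) (sg : bool) (eps : 'I_3 -> bool).
Local Notation sheet := (@side_sheet R beta TriplePair true).
Hypothesis hm : @modeled R D U V h' 3 sheet rk sg eps.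
Variables (X : choiceType) (T : X -> X -> X -> X) (c : set 'rV[R]_3 -> X).
Hypotheses (hT : ternary_quasigroup T) (hc : coloring T D c).
Variable delta : bool.
Hypothesis hdelta : forall p, dot p p <= 9 -> (\det (jac h' p) < 0) = delta.
Variable z0 : R.
Hypotheses (z01 : 0 < z0 <= 1) (bz0 : (beta (z0 ^+ 2) : R) = z0 ^+ 2).
Implicit Types (P Q : 'rV[R]_3) (s : 'I_3 -> bool).

Local Notation eqn := (pr_eq beta true).
Local Notation gap := (pgap beta true).
Local Notation pcol := (pair_col D h' c z0).

(** The correction from sides of oriented sheets to signs of the equations. *)
Definition pair_orient (j : 'I_3) : bool := (j != 0 :> nat) (+) eps j (+) delta.

Lemma pair_side_bit (j : 'I_3) q : (pr_or beta true j q : R) != 0 ->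
  pos_if (side_bit eps delta j (pr_or beta true j) q (+) pair_orient j) (eqn j q : R).
Proof.
rewrite /side_bit /pr_or /pair_orient; move: (eqn j q : R) => x; set e := (j != 0 :> nat).
rewrite mulf_eq0 signr_eq0 /= => nz.
rewrite -[0 < _]/(pos_if true _) pos_if_sgn !pos_ifE nz /=.
by case: (0 < x); case: e; case: (eps j); case: (delta).
Qed.

Lemma near_pair_tame sz Q : pair_tame z0 sz Q -> \forall P \near Q, pair_tame z0 sz P.
Proof.
move=> [x1 x2 x3 zQ].
have co i : {for Q, continuous (fun q : 'rV[R]_3 => q 0 i : R)} by exact: coord_continuous.
have ca i : {for Q, continuous (fun q : 'rV[R]_3 => `|q 0 i| : R)}.
  exact: (@continuous_comp _ _ _ (fun q : 'rV[R]_3 => q 0 i : R) Num.norm Q (co i) (@norm_continuous _ R^o _)).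
have n1 : \forall P \near Q, `|(P : 'rV[R]_3) 0 0| < z0 ^+ 2 / 8 by exact: (cvgr_lt _ (ca 0)).
have n2 : \forall P \near Q, `|(P : 'rV[R]_3) 0 1| < z0 ^+ 2 / 8 by exact: (cvgr_lt _ (ca 1)).
have n3 : \forall P \near Q, `|(P : 'rV[R]_3) 0 2| < 2 by exact: (cvgr_lt _ (ca 2)).
have n4 : \forall P \near Q, pos_if sz ((P : 'rV[R]_3) 0 2).
  by move: zQ; rewrite /pos_if; case: (sz) => z; [exact: (cvgr_gt _ (co 2))|exact: (cvgr_lt _ (co 2))].
by near=> P; split; near: P.
Unshelve. all: by end_near. Qed.

Lemma pair_near_color sz (A : pred 'I_3) s Q : pair_tame z0 sz Q ->
  (forall j, ~~ A j -> pos_if (s j) (eqn j Q : R)) ->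
  \forall q \near Q,
    (forall j, A j -> (pr_or beta true j q : R) != 0) ->
    off_sheets sheet q /\ model_color D h' c q =
      pcol sz (fun j => if A j then
        side_bit eps delta j (pr_or beta true j) q (+) pair_orient j else s j).
Proof.
move=> tQ sQ.
have H : \forall P \near Q, forall j, ~~ A j -> pos_if (s j) (eqn j P : R).
  have Hj (j : 'I_3) : \forall P \near Q, ~~ A j -> pos_if (s j) (eqn j P : R).
    have [Aj|Aj] := boolP (A j); first by near=> P.
    have ct : {for Q, continuous (eqn j)}.
      exact/differentiable_continuous/(pr_eq_diff hb).
    have Sj : \forall P \near Q, pos_if (s j) (eqn j P : R).
      by have := sQ j Aj; rewrite /pos_if; case: (s j) => Qb; [exact: (cvgr_gt _ ct)|exact: (cvgr_lt _ ct)].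
    by near=> P; move=> _; near: P; exact: Sj.
  exact: (filter_forall _ Hj).
near=> q => nz.
have tq : pair_tame z0 sz q by near: q; exact: near_pair_tame.
have sq : forall j, ~~ A j -> pos_if (s j) (eqn j q : R) by near: q; exact: H.
have pq (j : 'I_3) : pos_if (if A j then
        side_bit eps delta j (pr_or beta true j) q (+) pair_orient j else s j) (eqn j q : R).
  by case: ifPn => Aj; [apply: pair_side_bit; exact: nz|exact: sq].
split; last exact: (pair_color_pattern hb hh BV hm c z01 bz0 tq pq).
by apply: pair_off => j; have := pq j; rewrite pos_ifE => /andP[].
Unshelve. all: by end_near. Qed.

Lemma pair_face sz (jU jO : 'I_3) Q : jU != jO -> (rk jU < rk jO)%N ->
  pair_tame z0 sz Q -> eqn jU Q = 0 -> eqn jO Q = 0 ->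
  (forall j, j != jU -> j != jO -> 0 < (eqn j Q : R)) ->
  (forall bU bO, exists w, pos_if bU (dot (grad (pr_or beta true jU) Q) w) /\
                           pos_if bO (dot (grad (pr_or beta true jO) Q) w)) ->
  let col bU bO := pcol sz (fun j => if j == jU then bU (+) pair_orient jU
    else if j == jO then bO (+) pair_orient jO else true) in
  col false true = T (col false false) (col true false) (col true true).
Proof.
move=> jUO rUO tQ eU eO sQ sp col.
have Q9 := pair_tame_ball z01 tQ.
have fU := (pr_sheetP beta true jU _ _).2 (conj erefl eU).
have fO := (pr_sheetP beta true jO _ _).2 (conj erefl eO).
apply: (modeled_double hh hm hc (BV Q9) (hdelta Q9) fU (pr_or_co_oriented hb _ _ _)
  fO (pr_or_co_oriented hb _ _ _)) => //.
- by rewrite /above eq_sym (negbTE jUO).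
- move=> j u /pr_sheetP[-> ej].
  have [->|jU'] := eqVneq j jU; first by left.
  have [->|jO'] := eqVneq j jO; first by right.
  by have := sQ j jU' jO'; rewrite ej ltxx.
have sA (j : 'I_3) : ~~ ((j == jU) || (j == jO)) -> pos_if true (eqn j Q : R).
  by rewrite negb_or => /andP[]; exact: sQ.
have := pair_near_color (s := fun=> true) tQ sA; apply: filterS => q Hq nU nO.
have [|off ->] := Hq _; first by move=> j /orP[/eqP->|/eqP->].
split => //; rewrite /col; congr pcol; apply/funext => j.
have [->//|_] := eqVneq j jU.
by have [->|] := eqVneq j jO.
Qed.

Lemma pair_triple sz (jB jM jT : 'I_3) P : uniq [:: jT; jM; jB] ->
  (rk jB < rk jM)%N -> (rk jM < rk jT)%N -> pair_tame z0 sz P ->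
  (forall j : 'I_3, eqn j P = 0) ->
  let col bB bM bT := pcol sz (fun j =>
    (if j == jB then bB else if j == jM then bM else bT) (+) pair_orient j) in
  forall t, t.1.1 = h' P -> colored_triple_points D c t <->
  t = (h' P, pos_if (~~ (eps jT (+) eps jM (+) eps jB))
         (det3 (grad (pr_or beta true jT) P) (grad (pr_or beta true jM) P)
           (grad (pr_or beta true jB) P)),
    [tuple col false false false; col true false false; col true true false;
           col true true true]).
Proof.
move=> un rBM rMT tP zP col t et.
have P9 := pair_tame_ball z01 tP.
have [TM TB MB] : [/\ jT != jM, jT != jB & jM != jB].
  by move: un; rewrite /= !inE !negb_or => /and3P[/andP[? ?] ? _]; split.
have cover j : [\/ j = jB, j = jM | j = jT].
  move: TM TB MB; case: (ord3_cases jB) => ->; case: (ord3_cases jM) => ->;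
  case: (ord3_cases jT) => -> //= _ _ _; case: (ord3_cases j) => ->;
  by [constructor 1|constructor 2|constructor 3].
have fB := (pr_sheetP beta true jB _ _).2 (conj erefl (zP _)).
have fM := (pr_sheetP beta true jM _ _).2 (conj erefl (zP _)).
have fT := (pr_sheetP beta true jT _ _).2 (conj erefl (zP _)).
have z2 : P 0 2 != 0 by move: tP => [_ _ _]; rewrite pos_ifE => /andP[].
have := modeled_triple hh hm (c := c) (col := col) (BV P9) (hdelta P9) fB fM fT
  (pr_or_co_oriented hb _ _ _) (pr_or_co_oriented hb _ _ _) (pr_or_co_oriented hb _ _ _).
rewrite {1 2}/above (negbTE TM) (negbTE MB).
move=> /(_ rMT rBM _ _ _ t et) -> //.
- by move=> j u /pr_sheetP[-> _]; case: (cover j) => ->; [constructor 1|constructor 2|constructor 3].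
- have sA (j : 'I_3) : ~~ true -> pos_if true (eqn j P : R) by [].
  have := @pair_near_color sz xpredT (fun=> true) P tP sA.
  apply: filterS => q Hq nB nM nT.
  have [|off ->] := Hq _; first by move=> j _; case: (cover j) => ->.
  split => //; rewrite /col; congr pcol; apply/funext => j.
  case: (cover j) => ->; rewrite ?eqxx //.
    by rewrite (negbTE MB).
  by rewrite (negbTE TB) (negbTE TM).
- rewrite !(pr_or_grad hb); have [e E] := pr_det3 R un.
  have [k k1 kE] := pr_grad_vertical hb z2.
  move: (grad _ P) kE => g kE.
  have -> (a b d : bool) (u v w : 'rV[R]_3) : det3 ((-1) ^+ a *: u) ((-1) ^+ b *: v) ((-1) ^+ d *: w) =
     (-1) ^+ a * ((-1) ^+ b * ((-1) ^+ d * det3 u v w)) by rewrite !det3E !mxE; ring.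
  rewrite E kE; rewrite !mulf_neq0 ?signr_eq0 // oppr_eq0 !mulf_neq0 //.
  by rewrite gt_eqF //; lra.
Qed.

End PairCrossings.

Section PairEdge.
Variables (R : realType) (beta : R^o -> R^o).
Hypothesis hb : Defs.bump beta.
Variable z0 : R.
Hypotheses (z01 : 0 < z0 <= 1).

(** On the vertical line over a point of the first sheet with [y > 0] small the
    equation of the third sheet is positive at height zero and negative far away. *)
Lemma pair_edge sz : exists Q, [/\ pair_tame z0 sz Q, Q 0 0 = 0, 0 < Q 0 1 & pgap beta true Q = 0].
Proof.
pose w := z0 ^+ 2 / 16.
have w0 : 0 < w <= 1 / 16.
  have [z1 z2] := andP z01; have : 0 < z0 ^+ 2 <= 1 by rewrite exprn_gt0 //= expr_le1 // ltW.
  by rewrite /w => /andP[]; move: (z0 ^+ 2) => x; lra.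
pose f (t : R) := (beta (w ^+ 2 + t ^+ 2) : R) - (t ^+ 2 - w).
have fc : continuous f.
  move=> t; have c1 : {for t, continuous (fun t : R => t ^+ 2 : R)} by exact: exprn_continuous.
  have c0 (a : R) : {for t, continuous (fun=> a : R)} by exact: cst_continuous.
  have c3 : {for t, continuous (fun t : R => w ^+ 2 + t ^+ 2 : R)}.
    exact: (@continuousD R R^o _ _ _ _ (c0 _) c1).
  have c4 : {for t, continuous (fun t : R => t ^+ 2 - w : R)}.
    exact: (@continuousB R R^o _ _ _ _ c1 (c0 _)).
  have c2 : {for t, continuous (fun t : R => beta (w ^+ 2 + t ^+ 2) : R)}.
    apply: (@continuous_comp _ _ _ (fun t : R => w ^+ 2 + t ^+ 2) beta); first exact: c3.
    exact/differentiable_continuous/(bump_dif hb).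
  exact: (@continuousB R R^o _ _ _ _ c2 c4).
have [w1 w2] := andP w0.
have f0 : 0 < f 0.
  have := bump_ge0 hb (sqr_ge0 w); rewrite /f expr0n /= addr0 sub0r.
  by move: (beta _ : R) => x; lra.
have f1 : f (3 / 2) <= 0.
  have d0 : 0 <= w ^+ 2 + (3 / 2) ^+ 2 by rewrite addr_ge0 ?sqr_ge0.
  have := bump_le1 hb d0; rewrite /f; move: (beta _ : R) => x; lra.
have [|||z] := @IVT R f 0 (3 / 2) 0 _ _ _.
- lra.
- exact: continuous_subspaceT.
- by rewrite ge_min le_max f1 orbT (ltW f0).
rewrite in_itv /= => /andP[z0' z1] fz.
have zp : 0 < z.
  rewrite lt0r z0' andbT; apply/negP => /eqP e; rewrite e in fz; by move: f0; rewrite fz ltxx.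
pose k : R := if sz then 1 else -1.
have kk : k ^+ 2 = 1 by rewrite /k; case: (sz); ring.
exists (vec3 0 w (k * z)); rewrite /pair_tame /pgap !vec3E; split => //.
  split; rewrite ?normr0.
  - by have [z2 z3] := andP z01; rewrite divr_gt0 // exprn_gt0.
  - rewrite gtr0_norm //; have -> : z0 ^+ 2 / 8 = w + w by rewrite /w; field.
    by lra.
  - by rewrite ltr_norml /k; case: (sz); lra.
  - by rewrite /pos_if /k; case: (sz); lra.
move: fz; rewrite /f (exprMn _ k z) kk.
have -> : (0 - w) ^+ 2 + 1 * z ^+ 2 = w ^+ 2 + z ^+ 2 by ring.
by move: (beta _ : R) => x; lra.
Qed.

End PairEdge.

Section PairMove.
Variables (R : realType) (beta : R^o -> R^o).
Hypothesis hb : Defs.bump beta.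
Variables (K : comNzRingType) (X : choiceType) (T : X -> X -> X -> X).
Variables (D D' : diagram R) (c c' : set 'rV[R]_3 -> X).
Hypotheses (hT : ternary_quasigroup T) (hc : coloring T D c).
Variables (U V : set 'rV[R]_3) (h h' : 'rV[R]_3 -> 'rV[R]_3).
Hypotheses (hh : diffeo U V h h') (BV : [set q | dot q q <= 9] `<=` V).
Variables (rk : {perm 'I_3}) (sg : bool) (eps : 'I_3 -> bool).
Hypothesis hm : @modeled R D U V h' 3 (@side_sheet R beta TriplePair true) rk sg eps.
Hypothesis hm' : @modeled R D' U V h' 3 (@side_sheet R beta TriplePair false) rk sg eps.
Local Notation B := (h' @` [set q : 'rV[R]_3 | dot q q <= 9]).
Hypothesis same : forall y, ~ B y -> same_diagram_at D D' y.
Hypothesis hagree : forall y : 'rV[R]_3, ~ B y -> ~ image3 D y ->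
  c (region D y) = c' (region D' y).

(** Three corners of the face at an edge joining the two triple points have a
    color that does not depend on the height, hence so does the fourth. *)
Lemma pair_col_indep delta z0 : 0 < z0 <= 1 -> (beta (z0 ^+ 2) : R) = z0 ^+ 2 ->
  (forall p, dot p p <= 9 -> (\det (jac h' p) < 0) = delta) ->
  forall s, pair_col D h' c z0 true s = pair_col D h' c z0 false s.
Proof.
move=> z01 bz0 hdelta.
have easy s : ~~ [&& s 0, s 1 & ~~ s 2] -> pair_col D h' c z0 true s = pair_col D h' c z0 false s.
  by rewrite /pair_col /pair_base; case: (s 0); case: (s 1); case: (s 2).
move=> s; have [/and3P[s0 s1 s2]|] := boolP [&& s 0, s 1 & ~~ s 2]; last exact: easy.
have key (jU jO : 'I_3) : (rk jU < rk jO)%N -> jU != jO -> jU != 1 -> jO != 1 ->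
    pair_col D h' c z0 true s = pair_col D h' c z0 false s.
  move=> rUO jUO U1 O1.
  have cover j : [\/ j = jU, j = jO | j = 1].
    move: jUO U1 O1; case: (ord3_cases jU) => ->; case: (ord3_cases jO) => -> //= _ _ _;
      case: (ord3_cases j) => ->; by [constructor 1|constructor 2|constructor 3].
  pose F sz bU bO := pair_col D h' c z0 sz (fun j =>
    if j == jU then bU (+) pair_orient eps delta jU
    else if j == jO then bO (+) pair_orient eps delta jO else true).
  have sF sz : pair_col D h' c z0 sz s =
      F sz (s jU (+) pair_orient eps delta jU) (s jO (+) pair_orient eps delta jO).
    rewrite /F; congr pair_col; apply/funext => j; rewrite !addbK.
    have [->//|nU] := eqVneq j jU; have [->//|nO] := eqVneq j jO.
    by case: (cover j) nU nO => ->; rewrite ?eqxx.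
  have face sz : F sz false true = T (F sz false false) (F sz true false) (F sz true true).
    have [Q [tQ Q0 Q1 GQ]] := pair_edge hb z01 sz.
    have eq0 (j : 'I_3) : j != 1 -> pr_eq beta true j Q = 0.
      by rewrite pr_eqE; case: (ord3_cases j) => ->.
    apply: (pair_face hb hh BV hm hc hdelta z01 bz0 jUO rUO tQ (eq0 _ U1) (eq0 _ O1)).
      by move=> j nU nO; case: (cover j) nU nO => ->; rewrite ?eqxx // pr_eqE.
    have z2 : Q 0 2 != 0 by move: tQ => [_ _ _]; rewrite pos_ifE => /andP[].
    have [k k1 kE] := pr_grad_vertical hb z2.
    move=> bU bO; rewrite !(pr_or_grad hb); move: (grad _ Q) kE => g kE.
    have g2 : g 0 2 != 0.
      by rewrite kE oppr_eq0 !mulf_neq0 // gt_eqF //; lra.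
    pose sgn (b : bool) : R := if b then 1 else -1.
    have sgnP b : pos_if b (sgn b) by rewrite /pos_if /sgn; case: b; lra.
    have wit b0 b2 : exists w, pos_if b0 (dot (pr_normal g 0) w) /\ pos_if b2 (dot (pr_normal g 2) w).
      exists (vec3 (sgn b0) 0 ((sgn b2 - g 0 0 * sgn b0) / g 0 2)).
      rewrite /pr_normal /= !dotE !vec3E; split.
        by rewrite (_ : _ + _ + _ = sgn b0) //; ring.
      rewrite (_ : _ + _ + _ = sgn b2) //; by field.
    move: jUO U1 O1 => {sF rUO cover F eq0}.
    case: (ord3_cases jU) => ->; case: (ord3_cases jO) => -> //= _ _ _.
      have [w [w1 w2]] := wit bU (~~ bO).
      by exists w; rewrite !dotZl ?expr0 ?expr1 ?mul1r ?mulN1r ?pos_ifN.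
    have [w [w1 w2]] := wit bO (~~ bU).
    by exists w; rewrite !dotZl ?expr0 ?expr1 ?mul1r ?mulN1r ?pos_ifN.
  rewrite !sF; apply: (face_corner hT (face true) (face false)) => s' t' st.
  apply: easy; apply: contra_notN st => /and3P[].
  have val0 j : j != 1 -> s j = (j == 0).
    by case: (ord3_cases j) => -> //=; rewrite (negbTE s2).
  rewrite (val0 jU) // (val0 jO) //.
  move: jUO U1 O1 => {sF face rUO cover F}.
  case: (ord3_cases jU) => ->; case: (ord3_cases jO) => -> //= _ _ _;
  by case: (pair_orient _ _ 0); case: (pair_orient _ _ 2); case: s'; case: t'.
have [lt|lt] := ltnP (rk 0) (rk 2); first by apply: (key 0 2).
apply: (key 2 0) => //; rewrite ltn_neqAle lt andbT.
by rewrite (inj_eq val_inj) (inj_eq perm_inj).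
Qed.

End PairMove.

Section PairMove.
Variables (R : realType) (beta : R^o -> R^o).
Hypothesis hb : Defs.bump beta.
Variables (K : comNzRingType) (X : choiceType) (T : X -> X -> X -> X).
Variables (D D' : diagram R) (c c' : set 'rV[R]_3 -> X).
Hypotheses (hT : ternary_quasigroup T) (hc : coloring T D c).
Variables (U V : set 'rV[R]_3) (h h' : 'rV[R]_3 -> 'rV[R]_3).
Hypotheses (hh : diffeo U V h h') (BV : [set q | dot q q <= 9] `<=` V).
Variables (rk : {perm 'I_3}) (sg : bool) (eps : 'I_3 -> bool).
Hypothesis hm : @modeled R D U V h' 3 (@side_sheet R beta TriplePair true) rk sg eps.
Hypothesis hm' : @modeled R D' U V h' 3 (@side_sheet R beta TriplePair false) rk sg eps.
Local Notation B := (h' @` [set q : 'rV[R]_3 | dot q q <= 9]).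
Hypothesis same : forall y, ~ B y -> same_diagram_at D D' y.
Hypothesis hagree : forall y : 'rV[R]_3, ~ B y -> ~ image3 D y ->
  c (region D y) = c' (region D' y).

(** Each sheet is a graph, so three preimages lie on three different sheets. *)
Lemma pair_sheets_meet (E : diagram R) side (e : set 'rV[R]_3 -> X) p t :
  @modeled R E U V h' 3 (@side_sheet R beta TriplePair side) rk sg eps ->
  dot p p <= 9 -> t.1.1 = h' p -> colored_triple_points E e t ->
  forall j : 'I_3, pr_eq beta side j p = 0.
Proof.
move=> hmE p9 ep tc.
have [j1 [u1 [j2 [u2 [j3 [u3 [[e1 e2 e3] [n12 n13 n23]]]]]]]] :=
  modeled_preimages hh hmE (BV p9) ep tc.
have [v1 w1] := (pr_sheetP _ _ _ _ _).1 e1.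
have [v2 w2] := (pr_sheetP _ _ _ _ _).1 e2.
have [v3 w3] := (pr_sheetP _ _ _ _ _).1 e3.
have d12 : j1 != j2 by apply/eqP => z; apply: n12; rewrite v1 v2 z.
have d13 : j1 != j3 by apply/eqP => z; apply: n13; rewrite v1 v3 z.
have d23 : j2 != j3 by apply/eqP => z; apply: n23; rewrite v2 v3 z.
move=> j; have [->|->|->] // : [\/ j = j1, j = j2 | j = j3].
move: d12 d13 d23; case: (ord3_cases j1) => ->; case: (ord3_cases j2) => ->;
case: (ord3_cases j3) => -> //= _ _ _; case: (ord3_cases j) => ->;
by [constructor 1|constructor 2|constructor 3].
Qed.

(** The vertical component of the third normal has opposite signs at the two triple
    points, hence so has the determinant, while the colored paths are equal by
    [pair_col_indep]. *)
Lemma pair_homologous : homologous T (diagram_chain K D c) (diagram_chain K D' c').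
Proof.
have [z0 [z01 bz0 uz0]] := pair_height hb.
have [delta hdelta] := ball3_delta hh BV.
pose J := (rk^-1)%g.
pose P (sz : bool) : 'rV[R]_3 := vec3 0 0 (if sz then z0 else - z0).
pose sb (sz : bool) := pos_if (~~ (eps (J 2) (+) eps (J 1) (+) eps (J 0)))
  (det3 (grad (pr_or beta true (J 2)) (P sz)) (grad (pr_or beta true (J 1)) (P sz))
        (grad (pr_or beta true (J 0)) (P sz))).
pose col bB bM bT := pair_col D h' c z0 true (fun j =>
    (if j == J 0 then bB else if j == J 1 then bM else bT) (+) pair_orient eps delta j).
pose path := [tuple col false false false; col true false false; col true true false;
           col true true true].
pose pt sz : 'rV[R]_3 * bool * 4.-tuple X := (h' (P sz), sb sz, path).
have [zp z1] := andP z01.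
have un : uniq [:: J 2; J 1; J 0].
  by rewrite (map_inj_uniq (@perm_inj _ J) [:: 2; 1; 0]).
have tP sz : pair_tame z0 sz (P sz).
  rewrite /pair_tame /P !vec3E normr0; split.
  - by rewrite divr_gt0 // exprn_gt0.
  - by rewrite divr_gt0 // exprn_gt0.
  - by case: sz; rewrite ?normrN gtr0_norm //; lra.
  - by rewrite /pos_if; case: sz; lra.
have P9 sz : dot (P sz) (P sz) <= 9 := pair_tame_ball z01 (tP sz).
have eP sz (j : 'I_3) : pr_eq beta true j (P sz) = 0.
  rewrite pr_eqE /pgap /P !vec3E; case: (ord3_cases j) => -> //=.
  have -> : (if sz then z0 else - z0) ^+ 2 = z0 ^+ 2 by case: sz; rewrite ?sqrrN.
  have -> : (0 - 0 : R) ^+ 2 + z0 ^+ 2 = z0 ^+ 2 by ring.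
  by rewrite bz0; ring.
have sbN : sb false = ~~ sb true.
  have [e E] := pr_det3 R un.
  have zt : P true 0 2 = z0 by rewrite vec3E.
  have zf : P false 0 2 = - z0 by rewrite vec3E.
  have [|k k1 kE] := pr_grad_vertical hb (P := P true); first by rewrite zt gt_eqF.
  have [|k' k1' kE'] := pr_grad_vertical hb (P := P false); first by rewrite zf oppr_eq0 gt_eqF.
  rewrite /sb !(pr_or_grad hb); move: (grad _ (P true)) (grad _ (P false)) kE kE' => g g'.
  rewrite zt zf => kE kE'.
  have S (a b d : bool) (u v w : 'rV[R]_3) : det3 ((-1) ^+ a *: u) ((-1) ^+ b *: v) ((-1) ^+ d *: w) =
     (-1) ^+ a * ((-1) ^+ b * ((-1) ^+ d * det3 u v w)) by rewrite !det3E !mxE; ring.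
  rewrite !S !E kE kE' !pos_if_sgn !pos_ifN; set b := (X in pos_if X).
  have p1 : 0 < 2 * k * z0 by rewrite !mulr_gt0 //; lra.
  have p2 : 2 * k' * (- z0) < 0 by rewrite mulrN oppr_lt0 !mulr_gt0 //; lra.
  by case: b; rewrite /pos_if ?p1 ?p2 ?(lt_gtF p1) ?(lt_gtF p2).
have ptP sz t : t.1.1 = h' (P sz) -> colored_triple_points D c t <-> t = pt sz.
  move=> et.
  rewrite (pair_triple hb hh BV hm c hdelta z01 bz0 un _ _ (tP sz) (eP sz) et) ?permKV //.
  rewrite /pt /path /col; case: sz {et} => //.
  by rewrite !(pair_col_indep hb hT hc hh BV hm z01 bz0 hdelta).
have inB sz : B (h' (P sz)) by exists (P sz) => //=; exact: P9.
move: ptP sbN; rewrite /pt => {pt}; move: sb path => sb path ptP sbN.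
pose pt sz : 'rV[R]_3 * bool * 4.-tuple X := (h' (P sz), sb sz, path).

apply: (@move_homologous R K X T D D' c c' U V h h' hh BV same hagree [:: pt true; pt false] [::]).
- rewrite /= andbT inE; apply/eqP => -[_ e]; move: sbN; rewrite e.
  by case: (sb false).
- by [].
- move=> t [p /= p9 ep]; split; last first.
    rewrite !inE => /orP[]/eqP e; [apply/(ptP true)|apply/(ptP false)] => //; by rewrite e.
  move=> tc; have z := pair_sheets_meet hm p9 (esym ep) tc.
  have [z1' [z2' z3']] : p 0 0 = 0 /\ p 0 1 = 0 /\ pgap beta true p = 0.
    by have := z 0; have := z 1; have := z 2; rewrite !pr_eqE /=.
  have bz : (beta (p 0 2 ^+ 2) : R) = p 0 2 ^+ 2.
    move: z3'; rewrite /pgap z1' z2'.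
    have -> : (0 - 0 : R) ^+ 2 + p 0 2 ^+ 2 = p 0 2 ^+ 2 by ring.
    by move: (beta _ : R) => x; lra.
  have [sz pE] : exists sz, p = P sz.
    case: (uz0 _ bz) => e; [exists true|exists false]; apply: vec3_ext; by rewrite vec3E.
  rewrite pE in ep; rewrite (_ : t = pt sz); last by apply/(ptP sz).
  by rewrite !inE; case: sz {pE ep} => //; rewrite eqxx ?orbT.
- move=> t [p /= p9 ep]; split => // tc; exfalso.
  have z := pair_sheets_meet hm' p9 (esym ep) tc.
  have [z1' [z2' z3']] : p 0 0 = 0 /\ p 0 1 = 0 /\ pgap beta false p = 0.
    by have := z 0; have := z 1; have := z 2; rewrite !pr_eqE /=.
  move: z3'; rewrite /pgap z1' z2'.
  have -> : (0 - 0 : R) ^+ 2 + p 0 2 ^+ 2 = p 0 2 ^+ 2 by ring.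
  have := bump_ge0 hb (sqr_ge0 (p 0 2)) => b0 e.
  have q0 : p 0 2 ^+ 2 = 0.
    apply/eqP; rewrite eq_le sqr_ge0 andbT; move: e b0; move: (beta _ : R) => x; lra.
  move: e; rewrite q0; have := bump_gt0 hb; move: (beta _ : R) => x; lra.
- by move=> t; rewrite !inE => /orP[]/eqP->; exact: inB.
- by [].
exists 0; rewrite boundary3_0 subr0 big_nil big_cons big_seq1 sub0r.
rewrite /signed_chain /pt /= sbN.
suff -> : (if sb true then 1 else -1 : K) *: << path >> + (if ~~ sb true then 1 else -1 : K) *: << path >> = 0.
  by rewrite oppr0; exact: degenerate_chain0.
by case: (sb true); rewrite !scaleN1r scale1r ?addNr ?subrr.
Qed.

End PairMove.

(** * The cross-cap and its branches *)

Section Umbrella.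
Variable R : realType.
Implicit Types (u : 'rV[R]_2) (p q w : 'rV[R]_3).

(** Whitney's cross-cap. *)
Definition umbrella u : 'rV[R]_3 := vec3 (u 0 0) (u 0 1 ^+ 2) (u 0 0 * u 0 1).

Lemma umbrella_diff u (w : 'rV[R]_2) : differentiable umbrella u /\
  'd umbrella u w = vec3 (w 0 0) (2 * u 0 1 * w 0 1) (u 0 0 * w 0 1 + u 0 1 * w 0 0).
Proof.
pose c i : 'rV[R]_2 -> R^o := fun v => v 0 i.
have dc i : differentiable (c i) u by exact: differentiable_coord.
have cE i : 'd (c i) u w = w 0 i.
  exact: (congr1 (fun F : _ -> _ => F w) (@diff_val _ _ _ _ _ _ _ (coord_diff u i))).
have dM i j : differentiable (c i * c j) u by exact: differentiableM.
have eM i j : 'd (c i * c j) u w = u 0 i * w 0 j + u 0 j * w 0 i :> R.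
  apply: (etrans (congr1 (fun F : _ -> _ => F w) (diffM (dc i) (dc j)))).
  exact: (congr2 (fun x y : R => u 0 i * x + u 0 j * y) (cE j) (cE i)).
have d0 : differentiable (fun v => c 0 v *: (vec3 1 0 0 : 'rV[R]_3)) u.
  exact: (differentiableZl _ (dc 0)).
have d1 : differentiable (fun v => (c 1 * c 1) v *: (vec3 0 1 0 : 'rV[R]_3)) u.
  exact: (differentiableZl _ (dM 1 1)).
have d2 : differentiable (fun v => (c 0 * c 1) v *: (vec3 0 0 1 : 'rV[R]_3)) u.
  exact: (differentiableZl _ (dM 0 1)).
have E : umbrella = (fun v => c 0 v *: (vec3 1 0 0 : 'rV[R]_3)) +
  (fun v => (c 1 * c 1) v *: (vec3 0 1 0 : 'rV[R]_3)) +
  (fun v => (c 0 * c 1) v *: (vec3 0 0 1 : 'rV[R]_3)).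
  apply/funext => v.
  rewrite -[RHS]/(v 0 0 *: vec3 1 0 0 + (v 0 1 * v 0 1) *: vec3 0 1 0 + (v 0 0 * v 0 1) *: vec3 0 0 1).
  by apply: vec3_ext; rewrite /umbrella !mxE /= !(tnth_nth 0) /=; ring.
have d01 := differentiableD d0 d1; have d012 := differentiableD d01 d2.
split; first by rewrite E.
have z0 : 'd (fun v => c 0 v *: (vec3 1 0 0 : 'rV[R]_3)) u w = w 0 0 *: vec3 1 0 0.
  apply: (etrans (congr1 (fun F : _ -> _ => F w) (diffZl (vec3 1 0 0) (dc 0)))).
  exact: (congr1 (fun x : R => x *: vec3 1 0 0) (cE 0)).
have z1 : 'd (fun v => (c 1 * c 1) v *: (vec3 0 1 0 : 'rV[R]_3)) u w =
    (u 0 1 * w 0 1 + u 0 1 * w 0 1) *: vec3 0 1 0.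
  apply: (etrans (congr1 (fun F : _ -> _ => F w) (diffZl (vec3 0 1 0) (dM 1 1)))).
  exact: (congr1 (fun x : R => x *: vec3 0 1 0) (eM 1 1)).
have z2 : 'd (fun v => (c 0 * c 1) v *: (vec3 0 0 1 : 'rV[R]_3)) u w =
    (u 0 0 * w 0 1 + u 0 1 * w 0 0) *: vec3 0 0 1.
  apply: (etrans (congr1 (fun F : _ -> _ => F w) (diffZl (vec3 0 0 1) (dM 0 1)))).
  exact: (congr1 (fun x : R => x *: vec3 0 0 1) (eM 0 1)).
apply: (etrans (congr1 (fun g : _ -> _ => 'd g u w) E)).
apply: (etrans (congr1 (fun F : _ -> _ => F w) (diffD d01 d2))).
apply: (etrans (congr2 (fun x y : 'rV[R]_3 => x + y) (congr1 (fun F : _ -> _ => F w) (diffD d0 d1)) z2)).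
apply: (etrans (congr1 (fun x : 'rV[R]_3 => x + _) (congr2 (fun x y : 'rV[R]_3 => x + y) z0 z1))).
by apply: vec3_ext; rewrite !mxE /= !(tnth_nth 0) /=; ring.
Qed.

(** Over [y > 0], a local equation of the branch [b > 0] or [b < 0] of the cross-cap,
    on which [b] is plus or minus the square root of [y]. *)
Definition branch_eq (s : bool) p : R^o := (-1) ^+ (~~ s) * p 0 2 - p 0 0 * Num.sqrt (p 0 1).

Lemma sqrt_diff (y k : R) : 0 < y -> differentiable (Num.sqrt : R^o -> R^o) y /\
  'd (Num.sqrt : R^o -> R^o) y k = k * (2 * Num.sqrt y)^-1 :> R.
Proof.
move=> y0; have H := is_derive1_sqrt y0.
have d : differentiable (Num.sqrt : R^o -> R^o) y by apply/derivable1_diffP; case: H.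
split=> //; have e1 : 'd (Num.sqrt : R^o -> R^o) y 1 = (2 * Num.sqrt y)^-1 :> R.
  by rewrite -deriveE //; exact: (@derive_val _ _ _ _ _ _ _ H).
have -> : 'd (Num.sqrt : R^o -> R^o) y k = k * ('d (Num.sqrt : R^o -> R^o) y 1 : R) :> R.
  have kE : k = k *: (1 : R^o) :> R^o by rewrite /GRing.scale /= mulr1.
  by rewrite {1}kE linearZ.
by rewrite e1.
Qed.

Lemma branch_eq_diff s p w : 0 < p 0 1 -> differentiable (branch_eq s) p /\
  'd (branch_eq s) p w = (-1) ^+ (~~ s) * w 0 2 -
    (p 0 0 * (w 0 1 * (2 * Num.sqrt (p 0 1))^-1) + Num.sqrt (p 0 1) * w 0 0) :> R.
Proof.
move=> p0.
pose c i : 'rV[R]_3 -> R^o := fun v => v 0 i.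
have dc i : differentiable (c i) p by exact: differentiable_coord.
have cE i : 'd (c i) p w = w 0 i.
  exact: (congr1 (fun F : _ -> _ => F w) (@diff_val _ _ _ _ _ _ _ (coord_diff p i))).
pose S : 'rV[R]_3 -> R^o := (Num.sqrt : R^o -> R^o) \o c 1.
have [ds es] := sqrt_diff (w 0 1) p0.
have dS : differentiable S p by exact: differentiable_comp.
have eS : 'd S p w = w 0 1 * (2 * Num.sqrt (p 0 1))^-1 :> R.
  apply: (etrans (congr1 (fun F : _ -> _ => F w) (diff_comp (dc 1) ds))).
  exact: (etrans (congr1 (fun x : R^o => 'd (Num.sqrt : R^o -> R^o) (p 0 1) x : R) (cE 1)) es).
have dM : differentiable (c 0 * S) p by exact: differentiableM.
have eM : 'd (c 0 * S) p w = p 0 0 * (w 0 1 * (2 * Num.sqrt (p 0 1))^-1) + Num.sqrt (p 0 1) * w 0 0 :> R.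
  apply: (etrans (congr1 (fun F : _ -> _ => F w) (diffM (dc 0) dS))).
  exact: (congr2 (fun x y : R => p 0 0 * x + Num.sqrt (p 0 1) * y) eS (cE 0)).
have dZ : differentiable (((-1) ^+ (~~ s) : R) *: c 2) p by exact: differentiableZ.
have eZ : 'd (((-1) ^+ (~~ s) : R) *: c 2) p w = (-1) ^+ (~~ s) * w 0 2 :> R.
  apply: (etrans (congr1 (fun F : _ -> _ => F w) (diffZ ((-1) ^+ (~~ s)) (dc 2)))).
  exact: (congr1 (fun x : R => (-1) ^+ (~~ s) * x) (cE 2)).
have E : branch_eq s = ((-1) ^+ (~~ s) : R) *: c 2 - c 0 * S by [].
split; first by rewrite E; exact: differentiableB.
apply: (etrans (congr1 (fun g : _ -> _ => 'd g p w) E)).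
apply: (etrans (congr1 (fun F : _ -> _ => F w) (diffB dZ dM))).
exact: (congr2 (fun x y : R => x - y) eZ eM).
Qed.

(** On the branch the normal of the parametrization is [2 |b|] times the gradient. *)
Lemma umbrella_co_oriented s u : pos_if s (u 0 1) -> co_oriented umbrella u (branch_eq s).
Proof.
move=> su; have b0 : u 0 1 != 0 by move: su; rewrite pos_ifE => /andP[].
have y0 : 0 < umbrella u 0 1 by rewrite vec3E exprn_even_gt0.
pose b := (-1) ^+ (~~ s) * u 0 1.
have bp : 0 < b.
  by rewrite -[0 < b]/(pos_if true b) pos_if_sgn addTb negbK.
have sb : Num.sqrt (umbrella u 0 1) = b.
  rewrite vec3E (_ : u 0 1 ^+ 2 = b ^+ 2) ?sqrtr_sqr ?gtr0_norm //.
  by rewrite /b exprMn sqrr_sign mul1r.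
have ub : u 0 1 = (-1) ^+ (~~ s) * b by rewrite /b mulrA -expr2 sqrr_sign mul1r.
have [du _] := umbrella_diff u 0.
have [dg _] := branch_eq_diff s 0 y0.
split; first exact: du.
- exact: dg.
- rewrite /branch_eq sb !vec3E {1}ub; move: ((-1) ^+ _) (sqrr_sign R (~~ s)) => e ee.
  have -> : e * (u 0 0 * (e * b)) - u 0 0 * b = (e ^+ 2 - 1) * (u 0 0 * b) by ring.
  by rewrite ee subrr mul0r.
exists (2 * b); first by rewrite mulr_gt0.
move=> w; rewrite -gradE.
have [_ d0] := umbrella_diff u (delta_mx 0 0).
have [_ d1] := umbrella_diff u (delta_mx 0 1).
have [_ e] := branch_eq_diff s w y0.
rewrite d0 d1; apply: (etrans _ (congr1 (fun x : R => 2 * b * x) (esym e))).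
rewrite sb det3E !vec3E !mxE /=.
move: ub bp (sqrr_sign R (~~ s)) {su sb y0 b0 dg e du d0 d1}; rewrite -/b; move: b ((-1) ^+ _) => {}b e -> bp ee.
have be : b != 0 by rewrite gt_eqF.
have -> : forall (x : R), x = w 0 1 * (2 * b)^-1 -> 2 * b * (e * w 0 2 - (u 0 0 * x + b * w 0 0)) =
   2 * b * e * w 0 2 - u 0 0 * w 0 1 - 2 * b * b * w 0 0.
  by move=> x ->; field.
- have -> : 2 * b * b = 2 * (e * b) * (e * b) by rewrite [RHS](_ : _ = e ^+ 2 * (2 * b * b)); [rewrite ee mul1r|ring].
  ring.
- by [].
Qed.

End Umbrella.

(** * A branch point passing through a sheet *)

Section PassSheets.
Variables (R : realType) (beta : R^o -> R^o).
Hypothesis hb : Defs.bump beta.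
Implicit Types (P Q p q w : 'rV[R]_3) (j : 'I_3).
Local Notation e3 := (vec3 0 0 1 : 'rV[R]_3).

Definition pass_phi (side : bool) (u : 'rV[R]_2) : R^o :=
  if side then (radial beta u : R) else - (radial beta u : R).

Lemma pass_phi_diff side u : differentiable (pass_phi side) u.
Proof.
have [d _] := radial_diff hb u 0.
by case: side => //; exact: (differentiableN d).
Qed.

Definition pass_eq side : 'rV[R]_3 -> R^o := graph_eq (pr_m R 2) (pr_a R 2) e3 (pass_phi side).

Definition pass_gap (side : bool) P : R := P 0 0 + P 0 1 -
  (if side then 1 else -1) * (beta ((P 0 0 - P 0 1) ^+ 2 + P 0 2 ^+ 2) : R).

Lemma pass_eqE side P : pass_eq side P = pass_gap side P.
Proof.
rewrite /pass_eq /graph_eq /pass_gap /= !dotE !vec3E /pass_phi /radial !vec2E.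
have -> : 1 * P 0 0 + -1 * P 0 1 + 0 * P 0 2 = P 0 0 - P 0 1 by ring.
have -> : 0 * P 0 0 + 0 * P 0 1 + 1 * P 0 2 = P 0 2 by ring.
by case: side; move: (beta _ : R) => x; ring.
Qed.

Lemma pass_sheet0 side u : @side_sheet R beta BranchPass side 0 u = umbrella u.
Proof. by []. Qed.

Lemma pass_sheet1 side u : @side_sheet R beta BranchPass side 1 u =
  graph_sheet (pr_n R 2) (pr_L1 R 2) e3 (pass_phi side) u.
Proof.
rewrite /side_sheet /graph_sheet /pass_phi -/(radial beta u) /=.
by apply: vec3_ext; rewrite !mxE /= !(tnth_nth 0) /=; case: side; field.
Qed.

Definition pass_or side p : R^o := (-1) ^+ true * (pass_eq side p : R).

Lemma pass_or_co_oriented side u :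
  co_oriented (@side_sheet R beta BranchPass side 1) u (pass_or side).
Proof.
rewrite (_ : side_sheet _ _ _ = graph_sheet (pr_n R 2) (pr_L1 R 2) e3 (pass_phi side)); last first.
  by apply/funext => v; exact: pass_sheet1.
apply: graph_sheet_co_oriented.
- exact: pr_dual.
- exact: pr_det_neq0.
- exact: pass_phi_diff.
- exact: (pr_det R 2).
Qed.

Lemma pass_sheet1P side u p :
  @side_sheet R beta BranchPass side 1 u = p <->
  u = proj2 (pr_a R 2) e3 p /\ pass_eq side p = 0.
Proof.
by rewrite pass_sheet1; apply: graph_sheetP; [exact: pr_dual | exact: pr_det_neq0].
Qed.

(** Where [y > 0], the cross-cap has two branches, which together with the graph
    make three local sheets: 0 for [b > 0], 1 for [b < 0] and 2 for the graph. *)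
Definition loc_idx j : 'I_2 := if j == 2 then 1 else 0.

Definition loc_eq j : 'rV[R]_3 -> R^o := if j == 2 then pass_eq true else branch_eq (j == 0).

Definition loc_or j : 'rV[R]_3 -> R^o := if j == 2 then pass_or true else branch_eq (j == 0).

Definition loc_pre j p : 'rV[R]_2 := if j == 2 then proj2 (pr_a R 2) e3 p
  else vec2 (p 0 0) ((-1) ^+ (j != 0) * Num.sqrt (p 0 1)).

Lemma loc_orE j p : loc_or j p = (-1) ^+ (j == 2) * (loc_eq j p : R) :> R.
Proof. by rewrite /loc_or /loc_eq; case: (j == 2) => //; rewrite expr0 mul1r. Qed.

Lemma loc_eq_diff j p : 0 < p 0 1 -> differentiable (loc_eq j) p.
Proof.
move=> p0; rewrite /loc_eq; case: (j == 2); last by have [] := branch_eq_diff (j == 0) 0 p0.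
by have [] := @graph_eq_diff R (pr_m R 2) (pr_a R 2) e3 (pass_phi true) p 0 (pass_phi_diff _ _).
Qed.

Lemma loc_sheetP i u p : 0 < p 0 1 -> @side_sheet R beta BranchPass true i u = p <->
  exists j, [/\ i = loc_idx j, u = loc_pre j p & loc_eq j p = 0].
Proof.
move=> p0; have s0 : 0 < Num.sqrt (p 0 1) by rewrite sqrtr_gt0.
have sq : Num.sqrt (p 0 1) ^+ 2 = p 0 1 by rewrite sqr_sqrtr // ltW.
split.
  have [->|i1] : i = 1 \/ i = 0.
    by case: i => -[|[|//]] ?; [right|left]; exact: val_inj.
    by move=> /pass_sheet1P[-> e]; exists 2.
  rewrite i1 pass_sheet0 => e.
  have e0 : u 0 0 = p 0 0 by rewrite -e vec3E.
  have e1 : u 0 1 ^+ 2 = p 0 1 by rewrite -e vec3E.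
  have e2 : u 0 0 * u 0 1 = p 0 2 by rewrite -e vec3E.
  have u0 : u 0 1 != 0 by apply: contraTneq p0 => z; rewrite -e1 z expr0n ltxx.
  have us : Num.sqrt (p 0 1) = `|u 0 1| by rewrite -e1 sqrtr_sqr.
  have [up|un|/eqP] := ltgtP 0 (u 0 1); last by rewrite eq_sym (negbTE u0).
    exists 0; rewrite /loc_pre /loc_eq /loc_idx /branch_eq /= us gtr0_norm //; split => //.
      by apply: vec2_ext; rewrite vec2E ?expr0 ?mul1r.
    by rewrite expr0 mul1r -e2 e0 subrr.
  exists 1; rewrite /loc_pre /loc_eq /loc_idx /branch_eq /= us ltr0_norm //; split => //.
    by apply: vec2_ext; rewrite vec2E ?expr1 ?mulrN ?mulN1r ?opprK.
  by rewrite expr1 mulN1r -e2 e0 mulrN opprK addNr.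
move=> [j [-> -> e]]; move: e; rewrite /loc_idx /loc_pre /loc_eq.
case: (ord3_cases j) => -> /=.
- rewrite /branch_eq expr0 !mul1r => /eqP; rewrite subr_eq0 => /eqP e.
  by apply: vec3_ext; rewrite ?pass_sheet0 ?/side_sheet /= ?vec3E ?vec2E ?expr0 ?mul1r.
- rewrite /branch_eq expr1 !mulN1r => /eqP; rewrite subr_eq0 => /eqP e.
  by apply: vec3_ext; rewrite ?pass_sheet0 ?/side_sheet /= ?vec3E ?vec2E ?expr0 ?expr1 ?mul1r ?mulN1r ?sqrrN // mulrN -e opprK.
- by move=> e; exact: ((pass_sheet1P true _ _).2 (conj erefl e)).
Qed.

Lemma loc_or_co_oriented j p : 0 < p 0 1 -> loc_eq j p = 0 ->
  co_oriented (@side_sheet R beta BranchPass true (loc_idx j)) (loc_pre j p) (loc_or j).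
Proof.
move=> p0 e; have s0 : 0 < Num.sqrt (p 0 1) by rewrite sqrtr_gt0.
rewrite /loc_idx /loc_pre /loc_or; have [_|j2] := eqVneq j 2.
  exact: pass_or_co_oriented.
apply: umbrella_co_oriented; rewrite vec2E pos_if_sgn.
by have -> : (j == 0) (+) (j != 0) = true by case: (j == 0).
Qed.

(** The height order of the local sheets: the graph is above or below both
    branches, and [sg] orders these. *)
Definition loc_rank (rk : {perm 'I_2}) (sg : bool) j : nat :=
  if j == 2 then (2 * rk 1%R)%N else (2 * rk 0%R + ((j == 0%R) (+) sg))%N.

Lemma loc_above (rk : {perm 'I_2}) sg j k p : 0 < p 0 1 -> (loc_rank rk sg k < loc_rank rk sg j)%N ->
  above rk sg (loc_idx j) (loc_pre j p) (loc_idx k) (loc_pre k p).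
Proof.
move=> p0; have s0 : 0 < Num.sqrt (p 0 1) by rewrite sqrtr_gt0.
have r01 : rk 0 != rk 1 by rewrite (inj_eq perm_inj).
have {}r01 : ((rk 0 : nat) != rk 1) by rewrite (inj_eq val_inj).
have l0 := ltn_ord (rk 0); have l1 := ltn_ord (rk 1).
rewrite /above /loc_rank /loc_idx /loc_pre.
case: (ord3_cases j) => ->; case: (ord3_cases k) => -> /=; rewrite ?ltnn ?vec2E //.
all: move: (Num.sqrt _) s0 => s s0; move: l0 l1 r01; case: (nat_of_ord (rk 0)) => [|[|//]]; case: (nat_of_ord (rk 1)) => [|[|//]] // _ _ _;
  case: sg => //= _; rewrite ?expr0 ?expr1; lra.
Qed.

End PassSheets.

(** Coordinates in which the two branches of the umbrella over [y > 0] are the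
    planes [m = x] and [m = - x]. *)
Definition fan (R : realType) (x s m : R) : 'rV[R]_3 := vec3 x (s ^+ 2) (m * s).

Section PassSide.
Variables (R : realType) (beta : R^o -> R^o).
Hypothesis hb : Defs.bump beta.
Variables (D : diagram R) (U V : set 'rV[R]_3) (h h' : 'rV[R]_3 -> 'rV[R]_3).
Hypotheses (hh : diffeo U V h h') (BV : [set q | dot q q <= 9] `<=` V).
Variables (rk : {perm 'I_2}) (sg : bool) (eps : 'I_2 -> bool).
Local Notation sheet := (@side_sheet R beta BranchPass true).
Hypothesis hm : @modeled R D U V h' 2 sheet rk sg eps.
Variables (X : choiceType) (T : X -> X -> X -> X) (c : set 'rV[R]_3 -> X).
Variable y0 : R.
Hypotheses (y01 : 0 < y0 <= 1) (by0 : (beta (y0 ^+ 2) : R) = y0).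
Implicit Types (P Q q : 'rV[R]_3) (f : 'I_3 -> bool).

Local Notation gap := (pass_gap beta true).
Local Notation eqn := (loc_eq beta).

Let r : R := y0 / 8.
Let lo : R := Num.sqrt (y0 / 2).
Let hi : R := 7 / 5.
Let color P : X := c (region D (h' P)).

Lemma gap_fan x s m : gap (fan x s m) =
  x + s ^+ 2 - (beta ((x - s ^+ 2) ^+ 2 + (m * s) ^+ 2) : R).
Proof. by rewrite /pass_gap /fan !vec3E mul1r. Qed.

Lemma loE : 0 < lo /\ lo ^+ 2 = y0 / 2.
Proof. by have [a b] := andP y01; rewrite sqrtr_gt0 sqr_sqrtr; lra. Qed.

Lemma lo_hi : lo < 1.
Proof.
have [l0 l2] := loE; have [a b] := andP y01.
by rewrite ltNge; apply/negP => l1; move: l2; rewrite expr2; nra.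
Qed.

(** At a fixed angle [m / x] the height of a point above the graph grows with [y]. *)
Lemma gap_fan_mono x s s' m : 0 <= s -> s <= s' -> x <= s ^+ 2 -> gap (fan x s m) <= gap (fan x s' m).
Proof.
move=> s0 ss xs; rewrite !gap_fan.
have sq : s ^+ 2 <= s' ^+ 2 by rewrite lerXn2r ?nnegrE //; lra.
have : (x - s ^+ 2) ^+ 2 + (m * s) ^+ 2 <= (x - s' ^+ 2) ^+ 2 + (m * s') ^+ 2.
  apply: lerD; last by rewrite !exprMn ler_wpM2l ?sqr_ge0.
  move: (s ^+ 2) (s' ^+ 2) xs sq => a b xa ab; rewrite -subr_ge0.
  have -> : (x - b) ^+ 2 - (x - a) ^+ 2 = (b - a) * ((b - x) + (a - x)) by ring.
  by rewrite mulr_ge0 //; lra.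
move=> /(bump_dec hb); rewrite addr_ge0 ?sqr_ge0 // => /(_ isT).
by move: (beta _ : R) (beta _ : R) => u v; lra.
Qed.

Lemma gap_fan_lo x m : `|x| <= r -> `|m| <= r -> gap (fan x lo m) < 0.
Proof.
have [l0 l2] := loE; have [a b] := andP y01.
rewrite !ler_norml /r => /andP[x1 x2] /andP[m1 m2]; rewrite gap_fan exprMn l2.
(* this keeps the bump above its value at the triple point *)
have le : (x - y0 / 2) ^+ 2 + m ^+ 2 * (y0 / 2) <= y0 ^+ 2.
  have mm : m ^+ 2 <= (y0 / 8) ^+ 2 by rewrite -[leLHS]real_normK ?num_real // lerXn2r ?nnegrE ?normr_ge0 // ?ler_norml; lra.
  have mm' : m ^+ 2 * (y0 / 2) <= (y0 / 8) ^+ 2.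
    apply: le_trans mm; apply: ler_piMr; [exact: sqr_ge0|lra].
  have xx : (x - y0 / 2) ^+ 2 <= (5 / 8 * y0) ^+ 2.
    by rewrite -[leLHS]real_normK ?num_real // lerXn2r ?nnegrE ?normr_ge0 // ?ler_norml; lra.
  apply: le_trans (lerD xx mm') _; rewrite !exprMn -subr_ge0.
  rewrite (_ : _ - _ = y0 ^+ 2 * (38 / 64)); last by field.
  by rewrite mulr_ge0 ?sqr_ge0; lra.
have d0 : 0 <= (x - y0 / 2) ^+ 2 + m ^+ 2 * (y0 / 2).
  by apply: addr_ge0; [exact: sqr_ge0|apply: mulr_ge0; [exact: sqr_ge0|lra]].
have := bump_dec hb d0 le; rewrite by0; move: (beta _ : R) => u; lra.
Qed.

Lemma gap_fan_hi x m : `|x| <= r -> 0 < gap (fan x hi m).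
Proof.
have [a b] := andP y01; rewrite ler_norml /r => /andP[x1 x2]; rewrite gap_fan.
have d0 : 0 <= (x - hi ^+ 2) ^+ 2 + (m * hi) ^+ 2 by rewrite addr_ge0 ?sqr_ge0.
have := bump_le1 hb d0; have : 9 / 5 <= hi ^+ 2 by rewrite /hi; lra.
by move: (beta _ : R) => u; move: (hi ^+ 2) => v; lra.
Qed.

Lemma pass_off P : 0 < P 0 1 -> (forall j, eqn j P != 0 :> R) -> off_sheets sheet P.
Proof. by move=> P0 nz j u /(loc_sheetP _ _ _ P0)[k [_ _ e]]; have := nz k; rewrite e eqxx. Qed.

Lemma loc_eq_fan j x s m : 0 < s -> eqn j (fan x s m) =
  if j == 2 then gap (fan x s m) else s * (if j == 0 then m - x else - m - x) :> R.
Proof.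
move=> s0; rewrite /loc_eq; case: (ord3_cases j) => -> /=; last by rewrite pass_eqE.
  by rewrite /branch_eq /fan !vec3E /= sqrtr_sqr gtr0_norm // expr0; ring.
by rewrite /branch_eq /fan !vec3E /= sqrtr_sqr gtr0_norm // expr1; ring.
Qed.

Definition fan_box (x s m : R) := [/\ `|x| <= 1, `|m| <= 1, 0 < s & s <= hi].

Lemma fan_segment f (x s m x' s' m' : R) : fan_box x s m -> fan_box x' s' m' ->
  pos_if (f 0) (m - x) -> pos_if (f 1) (- m - x) ->
  pos_if (f 0) (m' - x') -> pos_if (f 1) (- m' - x') ->
  (forall t : R, 0 <= t <= 1 ->
    pos_if (f 2) (gap (fan (x + t * (x' - x)) (s + t * (s' - s)) (m + t * (m' - m))))) ->
  color (fan x s m) = color (fan x' s' m').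
Proof.
rewrite /fan_box !ler_norml => -[/andP[x1 x2] /andP[m1 m2] s1 s2] [/andP[x1' x2'] /andP[m1' m2'] s1' s2'] a0 a1 b0 b1 G.
pose y (t : R) := fan (x + t * (x' - x)) (s + t * (s' - s)) (m + t * (m' - m)).
have y0E : y 0 = fan x s m by rewrite /y !mul0r !addr0.
have y1E : y 1 = fan x' s' m' by rewrite /y !mul1r !subrKC.
rewrite -y0E -y1E; congr c; apply: (modeled_path hh hm) => t t01.
  have -> : y = fun t => vec3 x (s ^+ 2) (m * s) + t *: vec3 (x' - x) (2 * s * (s' - s)) (m * (s' - s) + (m' - m) * s)
     + t ^+ 2 *: vec3 0 ((s' - s) ^+ 2) ((m' - m) * (s' - s)).
    by apply/funext => u; rewrite /y /fan; apply: vec3_ext; rewrite !mxE /= !(tnth_nth 0) /=; ring.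
  apply: cvgD; last by apply: cvgZr_tmp; exact: exprn_continuous.
  by apply: cvgD; [exact: cvg_cst | apply: cvgZr_tmp; exact: cvg_id].
have [t0 t1] := andP t01.
have [xt [mt [st0 st]]] : [/\ -1 <= x + t * (x' - x) & x + t * (x' - x) <= 1] /\
   [/\ -1 <= m + t * (m' - m) & m + t * (m' - m) <= 1] /\
   0 < s + t * (s' - s) /\ s + t * (s' - s) <= hi.
  split; first by split; nra.
  split; first by split; nra.
  by split; [exact: (pos_if_conv (b := true))|nra].
have := G t t01; have g0 := pos_if_conv a0 b0 t01; have g1 := pos_if_conv a1 b1 t01.
have {}g0 : pos_if (f 0) ((m + t * (m' - m)) - (x + t * (x' - x))).
  by rewrite (_ : _ - _ = (m - x) + t * ((m' - x') - (m - x))) //; ring.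
have {}g1 : pos_if (f 1) (- (m + t * (m' - m)) - (x + t * (x' - x))).
  by rewrite (_ : _ - _ = (- m - x) + t * ((- m' - x') - (- m - x))) //; ring.
rewrite /y; move: (x + _) (s + _) (m + _) xt mt st0 st g0 g1.
move=> {a0 a1 b0 b1 y0E y1E y G x1 x2 m1 m2 s1 s2} x {}s {}m [x1 x2] [m1 m2] s0 s1 g0 g1 g2.
split.
  apply: BV; rewrite /= dotE /fan !vec3E.
  have s4 : s ^+ 2 <= 49 / 25.
    have -> : 49 / 25 = hi ^+ 2 by rewrite /hi; field.
    by rewrite lerXn2r ?nnegrE; lra.
  have s2 := sqr_ge0 s.
  have -> : x * x + s ^+ 2 * s ^+ 2 + m * s * (m * s) = x ^+ 2 + (s ^+ 2) ^+ 2 + m ^+ 2 * s ^+ 2 by ring.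
  have xx : x ^+ 2 <= 1 by rewrite -subr_ge0 (_ : 1 - x ^+ 2 = (1 - x) * (1 + x)); [rewrite mulr_ge0; lra|ring].
  have mm : m ^+ 2 <= 1 by rewrite -subr_ge0 (_ : 1 - m ^+ 2 = (1 - m) * (1 + m)); [rewrite mulr_ge0; lra|ring].
  have ms : m ^+ 2 * s ^+ 2 <= s ^+ 2 by apply: ler_piMl.
  have ss : (s ^+ 2) ^+ 2 <= (49 / 25) ^+ 2 by rewrite lerXn2r ?nnegrE //; lra.
  by lra.
apply: pass_off; first by rewrite vec3E exprn_gt0.
have nz b (z : R) : pos_if b z -> z != 0 by rewrite pos_ifE => /andP[].
move=> j; rewrite loc_eq_fan //; case: (ord3_cases j) => -> /=; last exact: (nz _ _ g2).
  by apply: mulf_neq0; [rewrite gt_eqF|exact: (nz _ _ g0)].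
by apply: mulf_neq0; [rewrite gt_eqF|exact: (nz _ _ g1)].
Qed.

Let half (b : bool) : R := (if b then 1 else -1) * (r / 2).

(** A base point for each sign pattern of the equations of the local sheets, close
    to the double line, for a value of [y] that is small below the graph and large
    above it. *)
Definition pass_base f : 'rV[R]_3 :=
  fan (- (half (f 0) + half (f 1)) / 2) (if f 2 then hi else lo) ((half (f 0) - half (f 1)) / 2).

Definition pass_col f : X := color (pass_base f).

Definition pass_tame P := [/\ `|P 0 0| < r, P 0 2 ^+ 2 < r ^+ 2 * P 0 1,
  y0 / 2 < P 0 1 & P 0 1 < hi ^+ 2].

(** In the coordinates of [fan] the sides of the branches do not depend on [s], so
    the point is first moved along [s], away from the graph by [gap_fan_mono], and
    then to the base point at constant [s]. *)
Lemma pass_color_pattern f P : pass_tame P ->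
  (forall j, pos_if (f j) (eqn j P : R)) -> color P = pass_col f.
Proof.
move=> [x1 z1 ly uy] sP.
have [l0 l2] := loE; have [a b] := andP y01.
pose s := Num.sqrt (P 0 1); pose m := P 0 2 / s.
have y1 : 0 < P 0 1 by lra.
have s0 : 0 < s by rewrite sqrtr_gt0.
have ss : s ^+ 2 = P 0 1 by rewrite sqr_sqrtr // ltW.
have PE : P = fan (P 0 0) s m.
  apply: vec3_ext; rewrite /fan vec3E // /m; by rewrite divfK // gt_eqF.
have m1 : `|m| < r.
  have r0 : 0 < r by rewrite /r; lra.
  have : m ^+ 2 < r ^+ 2.
    by rewrite /m expr_div_n ss ltr_pdivrMr.
  rewrite -(real_normK (num_real m)) ltr_pXn2r ?nnegrE ?normr_ge0 ?(ltW r0) //.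
have ls : lo <= s by rewrite -(ler_pXn2r (n := 2)) ?nnegrE ?(ltW s0) ?(ltW l0) // ss l2 ltW.
have sh : s <= hi.
  by rewrite -(ler_pXn2r (n := 2)) ?nnegrE ?(ltW s0) // ?ss /hi; [exact: ltW|lra].
have := sP 0; have := sP 1; have := sP 2; rewrite PE !loc_eq_fan //= !pos_if_pmul //.
move: (P 0 0) x1 => x x1; move: s m s0 m1 ls sh {PE ss z1 ly uy y1 sP} => s m s0 m1 ls sh g2 g1 g0.
have xr : `|x| <= r := ltW x1; have mr : `|m| <= r := ltW m1.
have r1 : r <= 1 / 8 by rewrite /r; lra.
pose s' := if f 2 then hi else lo.
have xs : x <= r by move: xr; rewrite ler_norml => /andP[].
have los : r <= lo ^+ 2 by rewrite l2 /r; lra.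
have box' : 0 < s' /\ s' <= hi.
  by have lh := lo_hi; rewrite /s' /hi; case: (f 2); lra.
have hb' k : pos_if k (half k) /\ `|half k| <= r / 2.
  by rewrite /half /pos_if ler_norml; case: k; split; rewrite /r; lra.
have [p0 q0] := hb' (f 0); have [p1 q1] := hb' (f 1).
have bxr : `|- (half (f 0) + half (f 1)) / 2| <= r.
  by move: q0 q1; rewrite !ler_norml; move: (half _) (half _) => u v; lra.
have bmr : `|(half (f 0) - half (f 1)) / 2| <= r.
  by move: q0 q1; rewrite !ler_norml; move: (half _) (half _) => u v; lra.
have mono t : 0 <= t <= 1 -> lo <= s + t * (s' - s) /\ s + t * (s' - s) <= hi.
  have lh := lo_hi; rewrite /s' /hi in box' sh *.
  by move=> /andP[t0 t1]; case: (f 2); split; nra.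
have le1 (u : R) : `|u| <= r -> `|u| <= 1 by move=> /le_trans; apply; lra.
have B1 : fan_box x s m by split => //; exact: le1.
have B2 : fan_box x s' m by case: box'; split => //; exact: le1.
have B3 : fan_box (- (half (f 0) + half (f 1)) / 2) s' ((half (f 0) - half (f 1)) / 2).
  by case: box'; split => //; exact: le1.
transitivity (color (fan x s' m)).
  apply: (fan_segment (f := f) B1 B2) => //.
  move=> t t01; rewrite !subrr !mulr0 !addr0.
  have [w1 w2] := mono t t01.
  have [t0 t1] := andP t01.
  move: g2 w1 w2; rewrite /s' /pos_if; case: (f 2) => g2 w1 w2.
    apply: lt_le_trans g2 _; apply: gap_fan_mono; [exact: ltW| |].
      by move: sh; move: (hi) => H; nra.
    have : lo ^+ 2 <= s ^+ 2 by rewrite lerXn2r ?nnegrE //; lra.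
    by lra.
  apply: le_lt_trans g2; apply: gap_fan_mono; [by lra| |].
    by nra.
  have : lo ^+ 2 <= (s + t * (lo - s)) ^+ 2 by rewrite lerXn2r ?nnegrE //; lra.
  by lra.
apply: (fan_segment (f := f) B2 B3) => //.
- by rewrite (_ : _ - _ = half (f 0)) //; field.
- by rewrite (_ : _ - _ = half (f 1)) //; field.
move=> t t01; rewrite -/s' !subrr !mulr0 !addr0.
have conv (u v : R) : `|u| <= r -> `|v| <= r -> `|u + t * (v - u)| <= r.
  move: t01 => /andP[t0 t1]; rewrite !ler_norml => /andP[u1 u2] /andP[v1 v2].
  by apply/andP; split; nra.
rewrite /s' /pos_if; case: (f 2); first by apply: gap_fan_hi; exact: conv.
by apply: gap_fan_lo; exact: conv.
Qed.

(** Below the graph the plane [x = 0] can be followed from one sector to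
    the other through the points with [y < 0], where there is no cross-cap. *)
Lemma pass_link f g : f 2 = false -> g 2 = false -> f 0 -> ~~ f 1 -> ~~ g 0 -> g 1 ->
  pass_col f = pass_col g.
Proof.
move=> f2 g2 f0 f1 g0 g1; rewrite /pass_col /pass_base f2 g2 f0 (negbTE f1) (negbTE g0) g1.
have [l0 l2] := loE; have [a b] := andP y01; have lh := lo_hi.
pose z := r / 2 * lo.
have z0 : 0 < z by rewrite /z mulr_gt0 // divr_gt0 // /r divr_gt0.
have z1 : z < 1 by rewrite /z /r; nra.
have E1 : fan (- (half true + half false) / 2) lo ((half true - half false) / 2) = vec3 0 (y0 / 2) z.
  by rewrite /fan l2 /half /z; apply: vec3_ext; rewrite !vec3E //; field.
have E2 : fan (- (half false + half true) / 2) lo ((half false - half true) / 2) = vec3 0 (y0 / 2) (- z).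
  by rewrite /fan l2 /half /z; apply: vec3_ext; rewrite !vec3E //; field.
rewrite E1 E2.
have seg P Q : P 0 0 = 0 -> Q 0 0 = 0 -> dot P P <= 9 -> dot Q Q <= 9 ->
    (forall t : R, 0 <= t <= 1 -> let p := P + t *: (Q - P) in gap p < 0 /\
      (p 0 2 != 0 \/ p 0 1 < 0)) -> color P = color Q.
  move=> P0 Q0 P9 Q9 H; congr c; apply: (modeled_segment hh hm) => t t01.
  split; first by apply: BV; exact: ball3_convex.
  have [G off] := H t t01.
  have x0 : (P + t *: (Q - P)) 0 0 = 0 by rewrite !mxE P0 Q0; ring.
  move: (P + _) G off x0 => p G off x0 j u.
  have [->|->] : j = 1 \/ j = 0.
    by case: j => -[|[|//]] ?; [right|left]; exact: val_inj.
    by move=> /pass_sheet1P[_]; rewrite pass_eqE => e; move: G; rewrite e ltxx.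
  rewrite pass_sheet0 => e; move: off x0; rewrite -e /umbrella !vec3E => off u0.
  by case: off; rewrite ?u0 ?mul0r ?eqxx // ltNge sqr_ge0.
have gneg (y w : R) : y <= y0 / 2 -> `|w| <= y0 / 2 -> gap (vec3 0 y w) < 0.
  move=> yl wl; rewrite /pass_gap !vec3E mul1r add0r sub0r sqrrN.
  have d0 : 0 <= y ^+ 2 + w ^+ 2 by rewrite addr_ge0 ?sqr_ge0.
  have [yn|yp] := ltP y 0.
    by have := bump_ge0 hb d0; move: (beta _ : R) => u; lra.
  have le : y ^+ 2 + w ^+ 2 <= y0 ^+ 2.
    have yy : y ^+ 2 <= (y0 / 2) ^+ 2 by rewrite lerXn2r ?nnegrE //; lra.
    have ww : w ^+ 2 <= (y0 / 2) ^+ 2.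
      by rewrite -(real_normK (num_real w)) lerXn2r ?nnegrE ?normr_ge0 //; lra.
    apply: le_trans (lerD yy ww) _; rewrite !exprMn -subr_ge0.
    rewrite (_ : _ - _ = y0 ^+ 2 * (1 / 2)); last by field.
    by rewrite mulr_ge0 ?sqr_ge0.
  by have := bump_dec hb d0 le; rewrite by0; move: (beta _ : R) => u; lra.
have zy : `|z| <= y0 / 2 by rewrite gtr0_norm // /z /r; nra.
have zz : z * z <= 1 by nra.
have yy : y0 / 2 * (y0 / 2) <= 1 by nra.
pose Q (k : R) := vec3 0 (- 1) k.
have down k : 0 < k \/ k < 0 -> `|k| <= y0 / 2 -> k * k <= 1 -> color (vec3 0 (y0 / 2) k) = color (Q k).
  move=> k0 k1 k2; apply: seg; rewrite ?vec3E // ?dotE ?vec3E; try lra.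
  move=> t /andP[t0 t1]; set p := _ + _.
  have -> : p = vec3 0 (y0 / 2 - t * (1 + y0 / 2)) k.
    by rewrite /p /Q; apply: vec3_ext; rewrite !mxE /= !(tnth_nth 0) /=; ring.
  split; last by left; rewrite vec3E; case: k0 => ?; [rewrite gt_eqF|rewrite lt_eqF].
  by apply: gneg => //; nra.
rewrite (down z) //; last by left.
rewrite (down (- z)) ?normrN // ?mulrNN //; last by right; lra.
apply: seg; rewrite ?vec3E // ?dotE ?vec3E ?mulrNN; try lra.
move=> t /andP[t0 t1]; set p := _ + _.
have -> : p = vec3 0 (- 1) (z - t * (2 * z)).
  by rewrite /p /Q; apply: vec3_ext; rewrite !mxE /= !(tnth_nth 0) /=; ring.
split; last by right; rewrite vec3E; lra.
apply: gneg; first by lra.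
apply: le_trans zy; rewrite (gtr0_norm z0) ler_norml; apply/andP; split; nra.
Qed.

End PassSide.

Section PassCrossings.
Variables (R : realType) (beta : R^o -> R^o).
Hypothesis hb : Defs.bump beta.
Variables (D : diagram R) (U V : set 'rV[R]_3) (h h' : 'rV[R]_3 -> 'rV[R]_3).
Hypotheses (hh : diffeo U V h h') (BV : [set q | dot q q <= 9] `<=` V).
Variables (rk : {perm 'I_2}) (sg : bool) (eps : 'I_2 -> bool).
Local Notation sheet := (@side_sheet R beta BranchPass true).
Hypothesis hm : @modeled R D U V h' 2 sheet rk sg eps.
Variables (X : choiceType) (T : X -> X -> X -> X) (c : set 'rV[R]_3 -> X).
Hypotheses (hc : coloring T D c).
Variable delta : bool.
Hypothesis hdelta : forall p, dot p p <= 9 -> (\det (jac h' p) < 0) = delta.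
Variable y0 : R.
Hypotheses (y01 : 0 < y0 <= 1) (by0 : (beta (y0 ^+ 2) : R) = y0).
Implicit Types (P Q q : 'rV[R]_3) (f : 'I_3 -> bool) (j : 'I_3).

Local Notation gap := (pass_gap beta true).
Local Notation eqn := (loc_eq beta).
Local Notation loc_or := (loc_or beta).
Local Notation pcol := (pass_col D h' c y0).
Local Notation lrank := (loc_rank rk sg).

(** The correction from sides of oriented sheets to signs of the equations. *)
Definition loc_orient j : bool := (j == 2) (+) eps (loc_idx j) (+) delta.

Lemma loc_side_bit j q : (loc_or j q : R) != 0 ->
  pos_if (side_bit eps delta (loc_idx j) (loc_or j) q (+) loc_orient j) (eqn j q : R).
Proof.
rewrite /side_bit loc_orE /loc_orient; move: (eqn j q : R) => x; set e := (j == 2).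
rewrite mulf_eq0 signr_eq0 /= => nz.
rewrite -[0 < _]/(pos_if true _) pos_if_sgn !pos_ifE nz /=.
by case: (0 < x); case: e; case: (eps _); case: (delta).
Qed.

Lemma pass_tame_y Q : pass_tame y0 Q -> 0 < Q 0 1.
Proof. by have [a b] := andP y01; move=> [_ _ y1 _]; lra. Qed.

Lemma pass_tame_ball Q : pass_tame y0 Q -> dot Q Q <= 9.
Proof.
have [a b] := andP y01; move=> [+ z1 y1 y2]; rewrite ltr_norml => /andP[x1 x2].
have y2' : Q 0 1 < 2 by apply: lt_le_trans y2 _; lra.
rewrite dotE -!expr2.
have xx : Q 0 0 ^+ 2 <= 1.
  by rewrite -subr_ge0 (_ : _ - _ = (1 - Q 0 0) * (1 + Q 0 0)); [rewrite mulr_ge0; lra|ring].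
have yy : Q 0 1 ^+ 2 <= 2 ^+ 2 by rewrite lerXn2r ?nnegrE; lra.
have rr : (y0 / 8) ^+ 2 <= 1.
  by rewrite -subr_ge0 (_ : _ - _ = (1 - y0 / 8) * (1 + y0 / 8)); [rewrite mulr_ge0; lra|field].
have zz : (y0 / 8) ^+ 2 * Q 0 1 <= 2.
  by have := sqr_ge0 (y0 / 8); move: (_ ^+ 2) rr => u u1 u0; nra.
by lra.
Qed.

Lemma near_pass_tame Q : pass_tame y0 Q -> \forall P \near Q, pass_tame y0 P.
Proof.
move=> [x1 z1 y1 y2].
have co i : {for Q, continuous (fun q : 'rV[R]_3 => q 0 i : R)} by exact: coord_continuous.
have ca i : {for Q, continuous (fun q : 'rV[R]_3 => `|q 0 i| : R)}.
  exact: (@continuous_comp _ _ _ (fun q : 'rV[R]_3 => q 0 i : R) Num.norm Q (co i) (@norm_continuous _ R^o _)).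
have cc (k : R) : {for Q, continuous (cst k : 'rV[R]_3 -> R)} by exact: cst_continuous.
have cz : {for Q, continuous (fun q : 'rV[R]_3 => q 0 2 * q 0 2 - (y0 / 8) ^+ 2 * q 0 1 : R)}.
  exact: (@continuousB R R^o _ _ _ _ (continuousM (co 2) (co 2)) (continuousM (cc _) (co 1))).
have n1 : \forall P \near Q, `|(P : 'rV[R]_3) 0 0| < y0 / 8 by exact: (cvgr_lt _ (ca 0)).
have n2 : \forall P \near Q, (P : 'rV[R]_3) 0 2 * P 0 2 - (y0 / 8) ^+ 2 * P 0 1 < 0.
  by apply: (cvgr_lt _ cz); rewrite subr_lt0 -expr2.
have n3 : \forall P \near Q, y0 / 2 < (P : 'rV[R]_3) 0 1 by exact: (cvgr_gt _ (co 1)).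
have n4 : \forall P \near Q, (P : 'rV[R]_3) 0 1 < (7 / 5) ^+ 2 by exact: (cvgr_lt _ (co 1)).
near=> P; split.
- by near: P.
- by rewrite expr2 -subr_lt0; near: P.
- by near: P.
- by near: P.
Unshelve. all: by end_near. Qed.

Lemma pass_near_color (A : pred 'I_3) f Q : pass_tame y0 Q ->
  (forall j, ~~ A j -> pos_if (f j) (eqn j Q : R)) ->
  \forall q \near Q,
    (forall j, A j -> (loc_or j q : R) != 0) ->
    off_sheets sheet q /\ model_color D h' c q =
      pcol (fun j => if A j then
        side_bit eps delta (loc_idx j) (loc_or j) q (+) loc_orient j else f j).
Proof.
move=> tQ sQ.
have H : \forall P \near Q, forall j, ~~ A j -> pos_if (f j) (eqn j P : R).
  have Hj j : \forall P \near Q, ~~ A j -> pos_if (f j) (eqn j P : R).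
    have [Aj|Aj] := boolP (A j); first by near=> P.
    have ct : {for Q, continuous (eqn j)}.
      exact/differentiable_continuous/(loc_eq_diff hb _ (pass_tame_y tQ)).
    have Sj : \forall P \near Q, pos_if (f j) (eqn j P : R).
      by have := sQ j Aj; rewrite /pos_if; case: (f j) => Qb; [exact: (cvgr_gt _ ct)|exact: (cvgr_lt _ ct)].
    by near=> P; move=> _; near: P; exact: Sj.
  exact: (filter_forall _ Hj).
near=> q => nz.
have tq : pass_tame y0 q by near: q; exact: near_pass_tame.
have sq : forall j, ~~ A j -> pos_if (f j) (eqn j q : R) by near: q; exact: H.
have pq j : pos_if (if A j then
        side_bit eps delta (loc_idx j) (loc_or j) q (+) loc_orient j else f j) (eqn j q : R).
  by case: ifPn => Aj; [apply: loc_side_bit; exact: nz|exact: sq].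
split; last exact: (pass_color_pattern hb hh BV hm c y01 by0 tq pq).
by apply: pass_off; [exact: pass_tame_y|move=> j; have := pq j; rewrite pos_ifE => /andP[]].
Unshelve. all: by end_near. Qed.

Lemma pass_face f (jU jO : 'I_3) Q : jU != jO -> (lrank jU < lrank jO)%N ->
  pass_tame y0 Q -> eqn jU Q = 0 -> eqn jO Q = 0 ->
  (forall j, j != jU -> j != jO -> pos_if (f j) (eqn j Q : R)) ->
  (forall bU bO, exists w, pos_if bU (dot (grad (loc_or jU) Q) w) /\
                           pos_if bO (dot (grad (loc_or jO) Q) w)) ->
  let col bU bO := pcol (fun j => if j == jU then bU (+) loc_orient jU
    else if j == jO then bO (+) loc_orient jO else f j) in
  col false true = T (col false false) (col true false) (col true true).
Proof.
move=> jUO rUO tQ eU eO sQ sp col.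
have Q9 := pass_tame_ball tQ; have Qy := pass_tame_y tQ.
have fU : sheet (loc_idx jU) (loc_pre jU Q) = Q by apply/loc_sheetP => //; exists jU.
have fO : sheet (loc_idx jO) (loc_pre jO Q) = Q by apply/loc_sheetP => //; exists jO.
apply: (modeled_double hh hm hc (BV Q9) (hdelta Q9) fU (loc_or_co_oriented hb Qy eU)
  fO (loc_or_co_oriented hb Qy eO)) => //.
- exact: loc_above.
- move=> i u /(loc_sheetP _ _ _ Qy)[j [-> -> ej]].
  have [->|jU'] := eqVneq j jU; first by left.
  have [->|jO'] := eqVneq j jO; first by right.
  by have := sQ j jU' jO'; rewrite pos_ifE ej eqxx.
have sA j : ~~ ((j == jU) || (j == jO)) -> pos_if (f j) (eqn j Q : R).
  by rewrite negb_or => /andP[]; exact: sQ.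
have := pass_near_color tQ sA; apply: filterS => q Hq nU nO.
have [|off ->] := Hq _; first by move=> j /orP[/eqP->|/eqP->].
split => //; rewrite /col; congr pcol; apply/funext => j.
have [->//|_] := eqVneq j jU.
by have [->|] := eqVneq j jO.
Qed.

Lemma pass_triple (jB jM jT : 'I_3) P : uniq [:: jT; jM; jB] ->
  (lrank jB < lrank jM)%N -> (lrank jM < lrank jT)%N -> pass_tame y0 P ->
  (forall j, eqn j P = 0) ->
  det3 (grad (loc_or jT) P) (grad (loc_or jM) P) (grad (loc_or jB) P) != 0 ->
  let col bB bM bT := pcol (fun j =>
    (if j == jB then bB else if j == jM then bM else bT) (+) loc_orient j) in
  exists b : bool, forall t, t.1.1 = h' P -> colored_triple_points D c t <->
  t = (h' P, b, [tuple col false false false; col true false false; col true true false;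
           col true true true]).
Proof.
move=> un rBM rMT tP zP dt col.
have P9 := pass_tame_ball tP; have Py := pass_tame_y tP.
have [TM TB MB] : [/\ jT != jM, jT != jB & jM != jB].
  by move: un; rewrite /= !inE !negb_or => /and3P[/andP[? ?] ? _]; split.
have cover j : [\/ j = jB, j = jM | j = jT].
  move: TM TB MB {rBM rMT dt col un}; case: (ord3_cases jB) => ->; case: (ord3_cases jM) => ->;
  case: (ord3_cases jT) => -> //= _ _ _; case: (ord3_cases j) => ->;
  by [constructor 1|constructor 2|constructor 3].
have fE j : sheet (loc_idx j) (loc_pre j P) = P by apply/loc_sheetP => //; exists j.
exists (pos_if (~~ (eps (loc_idx jT) (+) eps (loc_idx jM) (+) eps (loc_idx jB)))
   (det3 (grad (loc_or jT) P) (grad (loc_or jM) P) (grad (loc_or jB) P))).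
move=> t et.
have := modeled_triple hh hm (c := c) (col := col) (BV P9) (hdelta P9) (fE jB) (fE jM) (fE jT)
  (loc_or_co_oriented hb Py (zP _)) (loc_or_co_oriented hb Py (zP _)) (loc_or_co_oriented hb Py (zP _))
  (loc_above Py rMT) (loc_above Py rBM).
move=> /(_ _ _ dt t et) -> //.
- move=> i u /(loc_sheetP _ _ _ Py)[j [-> -> _]].
  by case: (cover j) => ->; [constructor 1|constructor 2|constructor 3].
have sA j : ~~ true -> pos_if true (eqn j P : R) by [].
have := @pass_near_color xpredT (fun=> true) P tP sA.
apply: filterS => q Hq nB nM nT.
have [|off ->] := Hq _; first by move=> j _; case: (cover j) => ->.
split => //; rewrite /col; congr pcol; apply/funext => j.
case: (cover j) => ->; rewrite ?eqxx //.
  by rewrite (negbTE MB).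
by rewrite (negbTE TB) (negbTE TM).
Qed.

End PassCrossings.

Lemma span_pair (R : realType) (n1 n2 w e : 'rV[R]_3) :
  dot n1 w = 0 -> dot n2 w != 0 -> dot n1 e != 0 ->
  forall b1 b2, exists v, pos_if b1 (dot n1 v) /\ pos_if b2 (dot n2 v).
Proof.
move=> w1 w2 e1 b1 b2.
pose sgn (b : bool) : R := if b then 1 else -1.
have sgnP b : pos_if b (sgn b) by rewrite /pos_if /sgn; case: b; lra.
pose a := sgn b1 / dot n1 e.
exists (a *: e + ((sgn b2 - a * dot n2 e) / dot n2 w) *: w).
rewrite !dotDr !dotZr w1 mulr0 addr0 /a !divfK // addrC subrK; split; exact: sgnP.
Qed.

Lemma umbrella_fiber (R : realType) (u u' : 'rV[R]_2) : umbrella u = umbrella u' ->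
  u = u' \/ [/\ u 0 0 = 0, u' 0 0 = 0, u' 0 1 = - u 0 1 & u 0 1 != 0].
Proof.
move=> e.
have e0 : u 0 0 = u' 0 0 by have := congr1 (fun v : 'rV[R]_3 => v 0 0) e; rewrite !vec3E.
have e1 : u 0 1 ^+ 2 = u' 0 1 ^+ 2 by have := congr1 (fun v : 'rV[R]_3 => v 0 1) e; rewrite !vec3E.
have e2 : u 0 0 * u 0 1 = u' 0 0 * u' 0 1 by have := congr1 (fun v : 'rV[R]_3 => v 0 2) e; rewrite !vec3E.
have [d|d] := eqVneq (u 0 1) (u' 0 1); first by left; apply: vec2_ext.
right; have /eqP : (u 0 1 - u' 0 1) * (u 0 1 + u' 0 1) = 0 by rewrite -subr_sqr e1 subrr.
rewrite mulf_eq0 subr_eq0 (negbTE d) /= => /eqP s.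
have u0 : u 0 0 = 0.
  have /eqP : u 0 0 * (u 0 1 - u' 0 1) = 0 by rewrite mulrBr e2 e0 subrr.
  by rewrite mulf_eq0 subr_eq0 (negbTE d) orbF => /eqP.
split => //; first by rewrite -e0.
- lra.
- by apply: contraNneq d => z; apply/eqP; move: s; rewrite z; lra.
Qed.

Section PassGeometry.
Variables (R : realType) (beta : R^o -> R^o).
Hypothesis hb : Defs.bump beta.
Implicit Types (P Q p w : 'rV[R]_3) (j : 'I_3).

(** On the double line the graph is where [y] equals the bump; the first increases
    and the second decreases with [y]. *)
Lemma pass_height : exists y : R, [/\ 0 < y <= 1, (beta (y ^+ 2) : R) = y,
  forall t : R, 0 < t -> (beta (t ^+ 2) : R) = t -> t = y,
  (beta ((3 / 4 * y) ^+ 2) : R) > 3 / 4 * y & (beta ((3 / 2) ^+ 2) : R) < 3 / 2].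
Proof.
pose f (t : R) := (beta (t ^+ 2) : R) - t.
have fc : continuous f.
  move=> t; have c1 : {for t, continuous (fun t : R => t ^+ 2 : R)} by exact: exprn_continuous.
  have c2 : {for t, continuous (fun t : R => beta (t ^+ 2) : R)}.
    apply: (@continuous_comp _ _ _ (fun t : R => t ^+ 2) beta); first exact: c1.
    exact/differentiable_continuous/(bump_dif hb).
  have c3 : {for t, continuous (fun t : R => t : R)} by exact: cvg_id.
  exact: (@continuousB R R^o _ _ _ _ c2 c3).
have f0 : 0 < f 0 by rewrite /f expr2 mul0r subr0 (bump_gt0 hb).
have f1 : f 1 <= 0.
  by rewrite /f expr1n (bump_out hb) // sub0r oppr_le0.
have [||y] := @IVT R f 0 1 0 ler01 _ _.
- exact: continuous_subspaceT.
- by rewrite ge_min le_max f1 orbT (ltW f0).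
rewrite in_itv /= => /andP[y0 y1] fy.
have by' : (beta (y ^+ 2) : R) = y by apply/eqP; rewrite -subr_eq0; apply/eqP.
have {}y0 : 0 < y.
  rewrite lt0r y0 andbT; apply/negP => /eqP e; rewrite e in fy; by move: f0; rewrite fy ltxx.
have below (t : R) : 0 <= t -> t < y -> t < (beta (t ^+ 2) : R).
  move=> t0 ty; apply: (lt_le_trans ty); rewrite -{1}by'; apply: (bump_dec hb); first exact: sqr_ge0.
  by rewrite lerXn2r ?nnegrE //; lra.
exists y; split => //; first by rewrite y0.
- move=> t t0 bt; apply/eqP; rewrite eq_le !leNgt; apply/andP; split; apply/negP => lt.
    have : (beta (t ^+ 2) : R) <= beta (y ^+ 2).
      by apply: (bump_dec hb); [exact: sqr_ge0|rewrite lerXn2r ?nnegrE //; lra].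
    by rewrite bt by' leNgt lt.
  by have := below t (ltW t0) lt; rewrite bt ltxx.
- apply: below; lra.
- have := bump_le1 hb (sqr_ge0 (3 / 2 : R)); move: (beta _ : R) => u; lra.
Qed.

(** The graph contains each point at most once, so two of the three preimages are
    on the cross-cap, whose only double points are on the line [x = z = 0]. *)
Lemma pass_sheets_meet side p (j1 j2 j3 : 'I_2) u1 u2 u3 :
  @side_sheet R beta BranchPass side j1 u1 = p ->
  @side_sheet R beta BranchPass side j2 u2 = p ->
  @side_sheet R beta BranchPass side j3 u3 = p ->
  (j1, u1) <> (j2, u2) -> (j1, u1) <> (j3, u3) -> (j2, u2) <> (j3, u3) ->
  [/\ p 0 0 = 0, p 0 2 = 0, 0 < p 0 1 & pass_gap beta side p = 0].
Proof.
have two (j : 'I_2) : j = 0 \/ j = 1.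
  by case: j => -[|[|//]] ?; [left|right]; exact: val_inj.
have um u u' : umbrella u = p -> umbrella u' = p -> u <> u' ->
    [/\ p 0 0 = 0, p 0 2 = 0, 0 < p 0 1 & u' 0 1 = - u 0 1].
  move=> e e' ne; case: (@umbrella_fiber R u u'); first by rewrite e e'.
    by move=> /ne.
  move=> [a a' b b0]; rewrite -e /umbrella !vec3E a mul0r; split => //.
  by rewrite exprn_even_gt0.
have gr u : @side_sheet R beta BranchPass side 1 u = p -> pass_gap beta side p = 0.
  by move=> /pass_sheet1P[_]; rewrite pass_eqE.
have gu u u' : @side_sheet R beta BranchPass side 1 u = p ->
    @side_sheet R beta BranchPass side 1 u' = p -> u = u'.
  by move=> /pass_sheet1P[-> _] /pass_sheet1P[-> _].
have cg (j : 'I_2) (u u' : 'rV[R]_2) : (j, u) <> (j, u') -> u <> u' by move=> n e; apply: n; rewrite e.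
case: (two j1) => ->; case: (two j2) => ->; case: (two j3) => -> e1 e2 e3 n12 n13 n23.
- have [a b d e] := um _ _ e1 e2 (cg _ _ _ n12); have [_ _ _ e'] := um _ _ e1 e3 (cg _ _ _ n13).
  have [_ _ _ e''] := um _ _ e2 e3 (cg _ _ _ n23).
  have z : u1 0 1 = 0 by lra.
  by case: (@umbrella_fiber R u1 u2); [rewrite -!(pass_sheet0 beta side) e1 e2|move/(cg _ _ _ n12)|rewrite z eqxx => -[]].
- by have [a b d e] := um _ _ e1 e2 (cg _ _ _ n12); split => //; exact: gr e3.
- by have [a b d e] := um _ _ e1 e3 (cg _ _ _ n13); split => //; exact: gr e2.
- by case: (cg _ _ _ n23); exact: gu.
- by have [a b d e] := um _ _ e2 e3 (cg _ _ _ n23); split => //; exact: gr e1.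
- by case: (cg _ _ _ n13); exact: gu.
- by case: (cg _ _ _ n12); exact: gu.
- by case: (cg _ _ _ n12); exact: gu.
Qed.

Lemma branch_grad s Q w : 0 < Q 0 1 -> dot (grad (branch_eq s) Q) w =
  (-1) ^+ (~~ s) * w 0 2 -
    (Q 0 0 * (w 0 1 * (2 * Num.sqrt (Q 0 1))^-1) + Num.sqrt (Q 0 1) * w 0 0).
Proof.
move=> Q0; have [_ e] := branch_eq_diff s w Q0.
exact: (etrans (esym (gradE _ _ _)) e).
Qed.

Lemma pass_or_grad Q : 0 < (Q 0 0 - Q 0 1) ^+ 2 + Q 0 2 ^+ 2 -> exists2 k : R, k <= 0 &
  forall w, dot (grad (pass_or beta true) Q) w =
   - (w 0 0 + w 0 1 - 2 * ((Q 0 0 - Q 0 1) * (w 0 0 - w 0 1) + Q 0 2 * w 0 2) * k).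
Proof.
set d := _ + _ => d0; exists ('d beta d 1 : R); first exact: (bump_slope hb).
have e3E w : proj2 (pr_a R 2) (vec3 0 0 1) w = vec2 (w 0 0 - w 0 1) (w 0 2).
  by rewrite /proj2 /pr_a !dotE !vec3E; apply: vec2_ext; rewrite !vec2E; ring.
move=> w.
have H := @graph_eq_grad R (pr_m R 2) (pr_a R 2) (vec3 0 0 1) (pass_phi beta true) true Q w
  (pass_phi_diff hb _ _).
apply: (etrans H).
have [_ er] := radial_diff hb (proj2 (pr_a R 2) (vec3 0 0 1) Q) (proj2 (pr_a R 2) (vec3 0 0 1) w).
rewrite /radial_diff_spec in er.
apply: (etrans (congr1 (fun x : R => (-1) ^+ true * (dot (pr_m R 2) w - x)) er)).
rewrite !e3E !vec2E -/d; move: ('d beta d 1 : R) => k.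
by rewrite expr1 mulN1r /pr_m dotE !vec3E; ring.
Qed.

End PassGeometry.

Section PassMove.
Variables (R : realType) (beta : R^o -> R^o).
Hypothesis hb : Defs.bump beta.
Variables (K : comNzRingType) (X : choiceType) (T : X -> X -> X -> X).
Variables (D D' : diagram R) (c c' : set 'rV[R]_3 -> X).
Hypotheses (hT : ternary_quasigroup T) (hc : coloring T D c).
Variables (U V : set 'rV[R]_3) (h h' : 'rV[R]_3 -> 'rV[R]_3).
Hypotheses (hh : diffeo U V h h') (BV : [set q | dot q q <= 9] `<=` V).
Variables (rk : {perm 'I_2}) (sg : bool) (eps : 'I_2 -> bool).
Hypothesis hm : @modeled R D U V h' 2 (@side_sheet R beta BranchPass true) rk sg eps.
Hypothesis hm' : @modeled R D' U V h' 2 (@side_sheet R beta BranchPass false) rk sg eps.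
Local Notation B := (h' @` [set q : 'rV[R]_3 | dot q q <= 9]).
Hypothesis same : forall y, ~ B y -> same_diagram_at D D' y.
Hypothesis hagree : forall y : 'rV[R]_3, ~ B y -> ~ image3 D y ->
  c (region D y) = c' (region D' y).

Section Colors.
Variable delta : bool.
Hypothesis hdelta : forall p, dot p p <= 9 -> (\det (jac h' p) < 0) = delta.
Variable y0 : R.
Hypotheses (y01 : 0 < y0 <= 1) (by0 : (beta (y0 ^+ 2) : R) = y0).
Hypotheses (y0lo : (beta ((3 / 4 * y0) ^+ 2) : R) > 3 / 4 * y0)
  (y0hi : (beta ((3 / 2) ^+ 2) : R) < 3 / 2).
Implicit Types (P Q q : 'rV[R]_3) (f : 'I_3 -> bool) (j : 'I_3).

Local Notation gap := (pass_gap beta true).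
Local Notation eqn := (loc_eq beta).
Local Notation loc_or := (loc_or beta).
Local Notation pcol := (pass_col D h' c y0).
Local Notation lrank := (loc_rank rk sg).
Local Notation orient := (loc_orient eps delta).

(** The double line of the cross-cap meets both sides of the graph. *)
Lemma branch_face f (p q : 'I_3) : p != q -> p != 2 -> q != 2 -> (lrank p < lrank q)%N ->
  let col bU bO := pcol (fun j => if j == p then bU (+) orient p
    else if j == q then bO (+) orient q else f j) in
  col false true = T (col false false) (col true false) (col true true).
Proof.
move=> pq p2 q2 rpq.
pose y : R := if f 2 then 3 / 2 else 3 / 4 * y0.
pose Q : 'rV[R]_3 := vec3 0 y 0.
have [a b] := andP y01.
have y1 : 0 < y by rewrite /y; case: (f 2); lra.
have tQ : pass_tame y0 Q.
  rewrite /pass_tame /Q !vec3E normr0 expr0n /=; split.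
  - lra.
  - by rewrite mulr_gt0 // exprn_gt0 // divr_gt0.
  - by rewrite /y; case: (f 2); lra.
  - by rewrite /y; case: (f 2); lra.
have e0 j : j != 2 -> eqn j Q = 0.
  by move=> j2; rewrite /loc_eq (negbTE j2) /branch_eq /Q !vec3E mulr0 mul0r subr0.
have gQ : pos_if (f 2) (gap Q).
  rewrite /pass_gap /Q !vec3E mul1r add0r sub0r sqrrN expr0n addr0 /y /pos_if.
  by case: (f 2); rewrite ?subr_gt0 ?subr_lt0.
have cover j : j != p -> j != q -> j = 2.
  by move: pq p2 q2 {rpq}; case: (ord3_cases p) => ->; case: (ord3_cases q) => -> //= _ _ _;
    case: (ord3_cases j) => ->.
apply: (pass_face hb hh BV hm hc hdelta y01 by0 pq rpq tQ (e0 _ p2) (e0 _ q2)).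
  by move=> j jp jq; rewrite (cover j jp jq) /loc_eq eqxx pass_eqE.
have orE j : j != 2 -> loc_or j = branch_eq (j == 0) by move=> j2; rewrite /loc_or (negbTE j2).
rewrite !orE //.
have pq0 : (q == 0) = ~~ (p == 0).
  by move: pq p2 q2 {rpq orE cover e0}; case: (ord3_cases p) => ->; case: (ord3_cases q) => ->.
have s0 : 0 < Num.sqrt y by rewrite sqrtr_gt0.
have Qy : 0 < Q 0 1 by rewrite vec3E.
apply: (@span_pair _ _ _ (vec3 ((-1) ^+ (~~ (p == 0))) 0 (Num.sqrt y)) (vec3 0 0 1)).
- by rewrite branch_grad // /Q !vec3E; ring.
- rewrite branch_grad // /Q !vec3E pq0; move: (Num.sqrt y) s0 => s s0.
  by case: (p == 0) => /=; rewrite ?expr0 ?expr1; [rewrite lt_eqF|rewrite gt_eqF] => //; nra.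
- by rewrite branch_grad // /Q !vec3E mul0r !mulr0 mulr1 addr0 subr0 signr_eq0.
Qed.

Lemma gap_fan_continuous (x m : R) : continuous (fun s : R => gap (fan x s m)).
Proof.
move=> t.
have c0 (a : R) : {for t, continuous (fun=> a : R)} by exact: cst_continuous.
have c1 : {for t, continuous (fun t : R => t ^+ 2 : R)} by exact: exprn_continuous.
have ci : {for t, continuous (fun t : R => t : R)} by exact: cvg_id.
have c2 : {for t, continuous (fun t : R => x - t ^+ 2 : R)}.
  exact: (@continuousB R R^o _ _ _ _ (c0 _) c1).
have c3 : {for t, continuous (fun t : R => m * t : R)} by exact: (continuousM (c0 _) ci).
have c4 : {for t, continuous (fun t : R => (x - t ^+ 2) * (x - t ^+ 2) + (m * t) * (m * t) : R)}.
  exact: (@continuousD R R^o _ _ _ _ (continuousM c2 c2) (continuousM c3 c3)).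
have c5 : {for t, continuous (fun t : R => beta ((x - t ^+ 2) * (x - t ^+ 2) + (m * t) * (m * t)) : R)}.
  apply: (@continuous_comp _ _ _ _ beta); first exact: c4.
  exact/differentiable_continuous/(bump_dif hb).
have c6 : {for t, continuous (fun t : R => x + t ^+ 2 : R)}.
  exact: (@continuousD R R^o _ _ _ _ (c0 _) c1).
rewrite (_ : (fun s : R => gap (fan x s m)) = (fun t : R => (x + t ^+ 2) - beta ((x - t ^+ 2) * (x - t ^+ 2) + (m * t) * (m * t)) : R)).
  exact: (@continuousB R R^o _ _ _ _ c6 c5).
by apply/funext => s; rewrite gap_fan !expr2.
Qed.

(** Following a branch in a direction with [x < 0] fixed, the graph is crossed by the
    intermediate value theorem; the other branch is then on a known side. *)
Lemma graph_edge (j : 'I_3) : j != 2 -> exists Q,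
  [/\ pass_tame y0 Q, eqn j Q = 0, eqn 2 Q = 0,
     forall k, k != j -> k != 2 -> 0 < (eqn k Q : R) &
     forall b b', exists w, pos_if b (dot (grad (loc_or j) Q) w) /\
       pos_if b' (dot (grad (loc_or 2) Q) w)].
Proof.
move=> j2; have [a b] := andP y01.
have [l0 l2] := loE y01; have lh := lo_hi y01.
pose e : R := (-1) ^+ (~~ (j == 0)).
have ee : e ^+ 2 = 1 by rewrite /e sqrr_sign.
pose x : R := - (y0 / 16); pose m := e * x.
have xr : `|x| <= y0 / 8 by rewrite /x normrN gtr0_norm; lra.
have mr : `|m| <= y0 / 8 by rewrite /m normrM /e normr_sign mul1r.
have glo := gap_fan_lo hb y01 by0 xr mr.
have ghi := gap_fan_hi hb y01 m xr.
have [|||s] := @IVT R (fun s => gap (fan x s m)) (Num.sqrt (y0 / 2)) (7 / 5) 0 _ _ _.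
- lra.
- exact/continuous_subspaceT/gap_fan_continuous.
- by rewrite ge_min le_max (ltW glo) (ltW ghi) orbT.
rewrite in_itv /= => /andP[ls sh] gs.
have {}ls : Num.sqrt (y0 / 2) < s.
  by rewrite lt_neqAle ls andbT; apply/eqP => z; move: glo; rewrite z gs ltxx.
have {}sh : s < 7 / 5.
  by rewrite lt_neqAle sh andbT; apply/eqP => z; move: ghi; rewrite -z gs ltxx.
have s0 : 0 < s by apply: lt_trans ls.
pose Q := fan x s m.
have Qy : 0 < Q 0 1 by rewrite /Q vec3E exprn_gt0.
have sE : Num.sqrt (Q 0 1) = s by rewrite /Q vec3E sqrtr_sqr gtr0_norm.
exists Q; split.
- rewrite /pass_tame /Q !vec3E; split.
  + by rewrite /x normrN gtr0_norm; lra.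
  + rewrite exprMn ltr_pM2r ?exprn_gt0 // /m exprMn ee mul1r /x sqrrN ltr_pXn2r ?nnegrE //; lra.
  + by rewrite -l2 ltr_pXn2r ?nnegrE //; lra.
  + by rewrite ltr_pXn2r ?nnegrE //; lra.
- rewrite loc_eq_fan // (negbTE j2) /m /e; case: (ord3_cases j) j2 => -> //= _; rewrite ?expr0 ?expr1; ring.
- by rewrite loc_eq_fan.
- move=> k kj k2; rewrite loc_eq_fan // (negbTE k2) mulr_gt0 // /m /e.
  by case: (ord3_cases j) j2 kj => -> //= _; case: (ord3_cases k) k2 => -> //= _ _;
    rewrite ?expr0 ?expr1 /x; lra.
have orE : loc_or j = branch_eq (j == 0) by rewrite /loc_or (negbTE j2).
rewrite orE (_ : loc_or 2 = pass_or beta true) //.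
have d0 : 0 < (Q 0 0 - Q 0 1) ^+ 2 + Q 0 2 ^+ 2.
  apply: ltr_pwDl; last exact: sqr_ge0.
  rewrite exprn_even_gt0 //= subr_eq0 lt_eqF //; apply: lt_trans Qy.
  by rewrite /Q vec3E /x; lra.
have [k k0 kE] := pass_or_grad hb d0.
(* the velocity along the branch at fixed [x], and the vertical direction *)
apply: (@span_pair _ _ _ (vec3 0 1 (e * x / (2 * s))) (vec3 0 0 1)).
- rewrite branch_grad // sE -/e /Q !vec3E.
  have -> : e * (e * x / (2 * s)) = e ^+ 2 * (x / (2 * s)) by ring.
  by rewrite ee; ring.
- rewrite kE /Q !vec3E oppr_eq0 gt_eqF //.
  have -> : m * s * (e * x / (2 * s)) = x ^+ 2 / 2.
    transitivity (e ^+ 2 * (x ^+ 2 / 2)); last by rewrite ee mul1r.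
    by rewrite /m; field; rewrite gt_eqF.
  have x0 : x <= 0 by rewrite /x; lra.
  have := sqr_ge0 x; have := sqr_ge0 s; move: (x ^+ 2) (s ^+ 2) => u v v0 u0.
  have : ((x - v) * (0 - 1) + u / 2) * k <= 0 by rewrite mulr_ge0_le0 //; lra.
  by lra.
- by rewrite branch_grad // /Q !vec3E mul0r !mulr0 mulr1 addr0 subr0 signr_eq0.
Qed.

(** Three corners of the face at the double line of the graph and a branch have
    a color that does not depend on the branch, hence so does the fourth. *)
Lemma sector_color (t : bool) :
  pcol (fun j => if j == 0 then true else if j == 1 then false else t) =
  pcol (fun j => if j == 0 then false else if j == 1 then true else t).
Proof.
pose W p0 p1 p2 := pcol (fun j => if j == 0 then p0 else if j == 1 then p1 else p2).
have link : W true false false = W false true false by apply: (pass_link hb hh BV hm).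
case: t; last exact: link.
pose o0 := orient 0; pose o2 := orient 2.
have r01 : rk 0 != rk 1 by rewrite (inj_eq perm_inj).
have {}r01 : (rk 0 : nat) != rk 1 by rewrite (inj_eq val_inj).
have l0 := ltn_ord (rk 0); have l1 := ltn_ord (rk 1).
have colE (j : 'I_3) x y : j != 2 ->
    pcol (fun i => if i == j then x else if i == 2 then y else true) =
    (if j == 0 then W x true y else W true x y) /\
    pcol (fun i => if i == 2 then y else if i == j then x else true) =
    (if j == 0 then W x true y else W true x y).
  move=> j2; split.
    case: (ord3_cases j) j2 => -> //= _; congr pcol; apply/funext => i;
      by case: (ord3_cases i) => ->.
  case: (ord3_cases j) j2 => -> //= _; congr pcol; apply/funext => i;
    by case: (ord3_cases i) => ->.
have oE (j : 'I_3) : j != 2 -> orient j = o0.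
  by rewrite /o0; case: (ord3_cases j) => ->.
have key : W false true true = W true false true; last exact: esym key.
have [S_top|S_bot] := ltnP (rk 0) (rk 1).
  have face j : j != 2 -> let F x y := if j == 0 then W (x (+) o0) true (y (+) o2) else W true (x (+) o0) (y (+) o2) in
      F false true = T (F false false) (F true false) (F true true).
    move=> j2 F; have [Q [tQ e1 e2 e3 sp]] := graph_edge j2.
    have rj : (lrank j < lrank 2%R)%N.
      rewrite /loc_rank (negbTE j2) /=; move: S_top r01 l0 l1.
      case: (nat_of_ord (rk 0)) => [|[|//]]; case: (nat_of_ord (rk 1)) => [|[|//]] // _ _ _ _.
      by case: (_ (+) _).
    have := pass_face hb hh BV hm hc hdelta y01 by0 (f := fun=> true) j2 rj tQ e1 e2 e3 sp.
    have E x y := (colE j (x (+) o0) (y (+) o2) j2).1.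
    cbv zeta. rewrite (oE j) // -/o2. by rewrite !E.
  have := face_corner hT (face 0 isT) (face 1 isT) (s := false (+) o0) (t := true (+) o2).
  rewrite /= !addNb !addbb /=; apply => s t st.
  case: (s (+) o0) (addbK o0 s) => /= es; first by [].
  case: (t (+) o2) (addbK o2 t) => /= et; last exact: esym link.
  by case: st; rewrite -es -et.
have face j : j != 2 -> let F y x := if j == 0 then W (x (+) o0) true (y (+) o2) else W true (x (+) o0) (y (+) o2) in
    F false true = T (F false false) (F true false) (F true true).
  move=> j2 F; have [Q [tQ e1 e2 e3 sp]] := graph_edge j2.
  have rj : (lrank 2%R < lrank j)%N.
    rewrite /loc_rank (negbTE j2) /=; move: S_bot r01 l0 l1.
    case: (nat_of_ord (rk 0)) => [|[|//]]; case: (nat_of_ord (rk 1)) => [|[|//]] // _ _ _ _.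
  have j2' : 2 != j by rewrite eq_sym.
  have := pass_face hb hh BV hm hc hdelta y01 by0 (f := fun=> true) j2' rj tQ e2 e1
    (fun k k2 kj => e3 k kj k2) (fun b b' => let: ex_intro w (conj p q) := sp b' b in ex_intro _ w (conj q p)).
  have E x y := (colE j (x (+) o0) (y (+) o2) j2).2.
  cbv zeta. rewrite (oE j) // -/o2. by rewrite !E.
have := face_corner hT (face 0 isT) (face 1 isT) (s := true (+) o2) (t := false (+) o0).
rewrite /= !addNb !addbb /=; apply => s t st.
case: (t (+) o0) (addbK o0 t) => /= et; first by [].
case: (s (+) o2) (addbK o2 s) => /= es; last exact: esym link.
by case: st; rewrite -es -et.
Qed.

End Colors.
End PassMove.

Section PassMove.
Variables (R : realType) (beta : R^o -> R^o).
Hypothesis hb : Defs.bump beta.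
Variables (K : comNzRingType) (X : choiceType) (T : X -> X -> X -> X).
Variables (D D' : diagram R) (c c' : set 'rV[R]_3 -> X).
Hypotheses (hT : ternary_quasigroup T) (hc : coloring T D c).
Variables (U V : set 'rV[R]_3) (h h' : 'rV[R]_3 -> 'rV[R]_3).
Hypotheses (hh : diffeo U V h h') (BV : [set q | dot q q <= 9] `<=` V).
Variables (rk : {perm 'I_2}) (sg : bool) (eps : 'I_2 -> bool).
Hypothesis hm : @modeled R D U V h' 2 (@side_sheet R beta BranchPass true) rk sg eps.
Hypothesis hm' : @modeled R D' U V h' 2 (@side_sheet R beta BranchPass false) rk sg eps.
Local Notation B := (h' @` [set q : 'rV[R]_3 | dot q q <= 9]).
Hypothesis same : forall y, ~ B y -> same_diagram_at D D' y.
Hypothesis hagree : forall y : 'rV[R]_3, ~ B y -> ~ image3 D y ->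
  c (region D y) = c' (region D' y).

(** The two branches cross along a line transverse to the graph. *)
Lemma loc_det3 (y : R) (j k l : 'I_3) : 0 < y -> uniq [:: j; k; l] ->
  det3 (grad (loc_or beta j) (vec3 0 y 0)) (grad (loc_or beta k) (vec3 0 y 0))
    (grad (loc_or beta l) (vec3 0 y 0)) != 0.
Proof.
move=> y0; set Q := vec3 0 y 0.
have Qy : 0 < Q 0 1 by rewrite vec3E.
have s0 : 0 < Num.sqrt y by rewrite sqrtr_gt0.
have d0 : 0 < (Q 0 0 - Q 0 1) ^+ 2 + Q 0 2 ^+ 2.
  by rewrite /Q !vec3E sub0r sqrrN expr0n addr0 exprn_gt0.
have [k0 k00 kE] := pass_or_grad hb d0.
have e0 : grad (loc_or beta 0) Q = vec3 (- Num.sqrt y) 0 1.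
  apply: dot_ext => w; apply: (etrans (branch_grad true w Qy)).
  by rewrite /Q dotE !vec3E; ring.
have e1 : grad (loc_or beta 1) Q = vec3 (- Num.sqrt y) 0 (- 1).
  apply: dot_ext => w; apply: (etrans (branch_grad false w Qy)).
  by rewrite /Q dotE !vec3E /= expr1; ring.
have [g [e2 g1]] : exists g : 'rV[R]_3, grad (loc_or beta 2) Q = g /\ g 0 1 < 0.
  exists (grad (loc_or beta 2) Q); split => //.
  move: (grad (loc_or beta 2) Q) (kE : forall w, dot (grad (loc_or beta 2) Q) w = _) => {kE} g kE.
  have -> : g 0 1 = dot g (vec3 0 1 0) by rewrite dotE !vec3E; ring.
  rewrite kE /Q !vec3E.
  have : y * k0 <= 0 by rewrite mulr_ge0_le0 // ltW.
  by lra.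
have nz : Num.sqrt y * g 0 1 < 0 by rewrite nmulr_llt0.
case: (ord3_cases j) => ->; case: (ord3_cases k) => ->; case: (ord3_cases l) => -> //= _;
  rewrite ?e0 ?e1 ?e2 det3E !vec3E;
  move: (Num.sqrt y) (g 0 0) (g 0 1) (g 0 2) nz => s a b d nz; apply/eqP => e; lra.
Qed.

Section Path.
Variable delta : bool.
Hypothesis hdelta : forall p, dot p p <= 9 -> (\det (jac h' p) < 0) = delta.
Variable y0 : R.
Hypotheses (y01 : 0 < y0 <= 1) (by0 : (beta (y0 ^+ 2) : R) = y0).
Hypotheses (y0lo : (beta ((3 / 4 * y0) ^+ 2) : R) > 3 / 4 * y0)
  (y0hi : (beta ((3 / 2) ^+ 2) : R) < 3 / 2).
Local Notation lrank := (loc_rank rk sg).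
Local Notation orient := (loc_orient eps delta).

Definition loc_color (jB jM jT : 'I_3) bB bM bT := pass_col D h' c y0 (fun j =>
    (if j == jB then bB else if j == jM then bM else bT) (+) orient j).

(** At the triple point the two branches of the umbrella are consecutive in
    height, and the colored path crosses them one after the other; the equality
    of the colors of two opposite sectors makes it degenerate. *)
Lemma pass_path : exists jB jM jT, [/\ uniq [:: jT; jM; jB], (lrank jB < lrank jM)%N,
  (lrank jM < lrank jT)%N & let col := loc_color jB jM jT in
  @degenerate X T 2 [tuple col false false false; col true false false; col true true false;
           col true true true]].
Proof.
have [p [q [pq p2 q2 rpq]]] : exists p q : 'I_3, [/\ p != q, p != 2, q != 2 & (lrank p < lrank q)%N].
  rewrite /loc_rank; case: sg.
    by exists 0, 1; split => //=; rewrite ltn_add2l.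
  by exists 1, 0; split => //=; rewrite ltn_add2l.
have oE (j : 'I_3) : j != 2 -> orient j = orient 0 by case: (ord3_cases j) => ->.
have cover j : [\/ j = p, j = q | j = 2].
  move: pq p2 q2 {rpq}; case: (ord3_cases p) => ->; case: (ord3_cases q) => -> //= _ _ _;
  case: (ord3_cases j) => ->; by [constructor 1|constructor 2|constructor 3].
pose W x y t := pass_col D h' c y0 (fun j => if j == p then x (+) orient p
    else if j == q then y (+) orient q else t (+) orient 2).
have link t : W false true t = W true false t.
  have s := sector_color hb hT hc hh BV hm hdelta y01 by0 (t (+) orient 2).
  rewrite /W (oE p) // (oE q) //; move: (orient 0) (orient 2) s => o o' s.
  pose Z (x y : bool) := pass_col D h' c y0 (fun j => if j == 0 then x else if j == 1 then y else t (+) o').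
  have E x y : pass_col D h' c y0 (fun j => if j == p then x else if j == q then y else t (+) o') =
     if p == 0 then Z x y else Z y x.
    move: pq p2 q2 {rpq cover W s}.
    case: (ord3_cases p) => ->; case: (ord3_cases q) => -> //= _ _ _; congr pass_col; apply/funext => j;
      by case: (ord3_cases j) => ->.
  have s' : Z true false = Z false true := s.
  by rewrite !E /=; case: o => /=; case: (p == 0) => //=; rewrite s'.
have face t : W false true t = T (W false false t) (W true false t) (W true true t).
  exact: (branch_face hb hc hh BV hm hdelta y01 by0 y0lo y0hi (fun=> t (+) orient 2) pq p2 q2 rpq).
have r01 : rk 0 != rk 1 by rewrite (inj_eq perm_inj).
have {}r01 : (rk 0 : nat) != rk 1 by rewrite (inj_eq val_inj).
have l0 := ltn_ord (rk 0); have l1 := ltn_ord (rk 1).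
have un : uniq [:: 2; q; p] by rewrite /= !inE !negb_or ![2 == _]eq_sym p2 q2 eq_sym pq.
have un' : uniq [:: q; p; 2] by rewrite /= !inE !negb_or p2 q2 eq_sym pq.
have n2p : (2 == p) = false by apply/negbTE; rewrite eq_sym.
have n2q : (2 == q) = false by apply/negbTE; rewrite eq_sym.
have nqp : (q == p) = false by apply/negbTE; rewrite eq_sym.
have [S_top|S_bot] := ltnP (rk 0) (rk 1).
  exists p, q, 2; split => //.
    rewrite /loc_rank (negbTE q2) /=; move: S_top r01 l0 l1.
    case: (nat_of_ord (rk 0)) => [|[|//]]; case: (nat_of_ord (rk 1)) => [|[|//]] // _ _ _ _.
    by case: (_ (+) _).
  have E x y t : loc_color p q 2 x y t = W x y t.
    rewrite /loc_color /W; congr pass_col; apply/funext => j.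
    by case: (cover j) => ->; rewrite ?eqxx ?nqp ?n2p ?n2q.
  exists 0%N => //=; rewrite !E.
  by rewrite -face link.
exists 2, p, q; split => //.
  rewrite /loc_rank (negbTE p2) /=; move: S_bot r01 l0 l1.
  by case: (nat_of_ord (rk 0)) => [|[|//]]; case: (nat_of_ord (rk 1)) => [|[|//]] // _ _ _ _.
have E x y t : loc_color 2 p q t x y = W x y t.
  rewrite /loc_color /W; congr pass_col; apply/funext => j.
  by case: (cover j) => ->; rewrite ?eqxx ?nqp ?n2p ?n2q ?(negbTE p2) ?(negbTE q2).
exists 1%N => //=; rewrite !E.
by rewrite -face link.
Qed.

End Path.

(** The only triple point in the ball has a degenerate colored path. *)
Lemma pass_homologous : homologous T (diagram_chain K D c) (diagram_chain K D' c').
Proof.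
have [y0 [y01 by0 uy0 ylo yhi]] := pass_height hb.
have [delta hdelta] := ball3_delta hh BV.
have [jB [jM [jT [un rBM rMT deg]]]] := pass_path hdelta y01 by0 ylo yhi.
pose P : 'rV[R]_3 := vec3 0 y0 0.
have [yp y1] := andP y01.
have tP : pass_tame y0 P.
  rewrite /pass_tame /P !vec3E normr0 expr0n /=; split; try lra.
  by rewrite mulr_gt0 // exprn_gt0 // divr_gt0.
have zP j : loc_eq beta j P = 0.
  rewrite /loc_eq; case: (j == 2); last by rewrite /branch_eq /P !vec3E mulr0 mul0r subr0.
  by rewrite pass_eqE /pass_gap /P !vec3E add0r sub0r sqrrN expr0n addr0 mul1r by0 subrr.
rewrite /loc_color in deg; cbv zeta in deg.
have [b Pb] := pass_triple hb hh BV hm c hdelta y01 by0 un rBM rMT tP zP (loc_det3 yp un).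
move: deg Pb; set w := [tuple _; _; _; _] => deg Pb.
have {}deg : degenerate T w := deg; clearbody w.
have pE (p : 'rV[R]_3) t (E : diagram R) side (e : set 'rV[R]_3 -> X) : @modeled R E U V h' 2 (@side_sheet R beta BranchPass side) rk sg eps ->
    dot p p <= 9 -> h' p = t.1.1 -> colored_triple_points E e t ->
    [/\ p 0 0 = 0, p 0 2 = 0, 0 < p 0 1 & pass_gap beta side p = 0].
  move=> hmE p9 ep tc.
  have [j1 [u1 [j2 [u2 [j3 [u3 [[e1 e2 e3] [n12 n13 n23]]]]]]]] :=
    modeled_preimages hh hmE (BV p9) (esym ep) tc.
  exact: (pass_sheets_meet e1 e2 e3).
have gapE side (p : 'rV[R]_3) : p 0 0 = 0 -> p 0 2 = 0 -> pass_gap beta side p =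
    p 0 1 - (if side then 1 else -1) * (beta (p 0 1 ^+ 2) : R).
  by move=> a d; rewrite /pass_gap a d add0r sub0r sqrrN expr0n addr0.
have P9 := pass_tame_ball y01 tP.
apply: (@move_homologous R K X T D D' c c' U V h h' hh BV same hagree [:: (h' P, b, w)] [::]).
- by [].
- by [].
- move=> t [p /= p9 ep]; split; last first.
    by rewrite inE => /eqP e; apply/Pb => //; rewrite e.
  move=> tc; have [p0 p2 p1 g] := pE p t D true c hm p9 ep tc.
  have pP : p = P.
    apply: vec3_ext; rewrite vec3E //; apply: uy0 => //.
    by move: g; rewrite gapE // mul1r; move: (beta _ : R) => u; lra.
  by rewrite inE; apply/eqP/Pb => //; rewrite -ep pP.
- move=> t [p /= p9 ep]; split => // tc; exfalso.
  have [p0 p2 p1 g] := pE p t D' false c' hm' p9 ep tc.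
  move: g; rewrite gapE //; have := bump_ge0 hb (sqr_ge0 (p 0 1)).
  by move: (beta _ : R) => u; lra.
- by move=> t; rewrite inE => /eqP->; exists P.
- by [].
exists 0; rewrite boundary3_0 subr0 big_nil big_seq1 sub0r /signed_chain.
exists [:: (- (if b then 1 else -1 : K), w)].
  by move=> q; rewrite inE => /eqP->.
by rewrite big_seq1 /= scaleNr.
Qed.

End PassMove.

(** * Moves without triple points, and the theorem *)

Section FewSheets.
Variable R : realType.
Implicit Types (p : 'rV[R]_3) (u v : 'rV[R]_2).

Definition three_sheets_meet (k : nat) (f : 'I_k -> 'rV[R]_2 -> 'rV[R]_3) p : Prop :=
  exists j1 u1 j2 u2 j3 u3, [/\ f j1 u1 = p, f j2 u2 = p & f j3 u3 = p] /\
   [/\ (j1, u1) <> (j2, u2), (j1, u1) <> (j3, u3) & (j2, u2) <> (j3, u3)].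

(** Above a point of the image of a sheet whose first two coordinates are
    [(a, b ^ 2)] there are at most two parameters, namely [(a, b)] and
    [(a, - b)]. *)
Lemma folded_sheet_fiber (f : 'I_1 -> 'rV[R]_2 -> 'rV[R]_3) p :
  (forall j u, f j u 0 0 = u 0 0 /\ f j u 0 1 = u 0 1 ^+ 2) -> ~ three_sheets_meet f p.
Proof.
move=> H [j1 [u1 [j2 [u2 [j3 [u3 [[e1 e2 e3] [n12 n13 n23]]]]]]]].
have opp j j' u v : f j u = p -> f j' v = p -> (j, u) <> (j', v) -> v 0 1 = - u 0 1.
  move=> e e'; rewrite !ord1 => ne.
  have [a b] := H j u; have [a' b'] := H j' v.
  have x : u 0 0 = v 0 0 by rewrite -a -a' e e'.
  have y : u 0 1 ^+ 2 = v 0 1 ^+ 2 by rewrite -b -b' e e'.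
  have /eqP : (u 0 1 - v 0 1) * (u 0 1 + v 0 1) = 0 by rewrite -subr_sqr y subrr.
  rewrite mulf_eq0 => /orP[]/eqP z; last by lra.
  by case: ne; congr (_, _); apply: vec2_ext => //; lra.
have z1 := opp _ _ _ _ e1 e2 n12; have z2 := opp _ _ _ _ e1 e3 n13.
have z3 := opp _ _ _ _ e2 e3 n23.
apply: n12; rewrite !ord1; congr (_, _); apply: vec2_ext; last by lra.
by have [<- _] := H j1 u1; have [<- _] := H j2 u2; rewrite e1 e2.
Qed.

(** Each sheet contains at most one point over given first two coordinates. *)
Lemma two_graphs_fiber (f : 'I_2 -> 'rV[R]_2 -> 'rV[R]_3) p :
  (forall j u, f j u 0 0 = u 0 0 /\ f j u 0 1 = u 0 1) -> ~ three_sheets_meet f p.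
Proof.
move=> H [j1 [u1 [j2 [u2 [j3 [u3 [[e1 e2 e3] [n12 n13 n23]]]]]]]].
have neq j j' u v : f j u = p -> f j' v = p -> (j, u) <> (j', v) -> j != j'.
  move=> e e' ne; apply/eqP => jj; apply: ne; congr (_, _) => //.
  have [a b] := H j u; have [a' b'] := H j' v.
  by apply: vec2_ext; [rewrite -a -a' e e'|rewrite -b -b' e e'].
have := neq _ _ _ _ e1 e2 n12; have := neq _ _ _ _ e1 e3 n13; have := neq _ _ _ _ e2 e3 n23.
move=> {e1 e2 e3 n12 n13 n23 neq}.
by case: j1 => -[|[|//]] ?; case: j2 => -[|[|//]] ?; case: j3 => -[|[|//]] ?.
Qed.

End FewSheets.

Section Main.
Variables (R : realType) (K : comNzRingType) (X : choiceType)
    (T : X -> X -> X -> X).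
Hypothesis hT : KTQ T.

Lemma no_triple_homologous (D D' : diagram R) (c c' : set 'rV[R]_3 -> X)
    (U V : set 'rV[R]_3) (h h' : 'rV[R]_3 -> 'rV[R]_3) (k : nat)
    (f f' : 'I_k -> 'rV[R]_2 -> 'rV[R]_3) rk sg eps :
  diffeo U V h h' -> [set q | dot q q <= 9] `<=` V ->
  let B := h' @` [set q : 'rV[R]_3 | dot q q <= 9] in
  (forall y, ~ B y -> same_diagram_at D D' y) ->
  (forall y : 'rV[R]_3, ~ B y -> ~ image3 D y -> c (region D y) = c' (region D' y)) ->
  modeled D U V h' f rk sg eps -> modeled D' U V h' f' rk sg eps ->
  (forall p, ~ three_sheets_meet f p) -> (forall p, ~ three_sheets_meet f' p) ->
  homologous T (diagram_chain K D c) (diagram_chain K D' c').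
Proof.
move=> hh BV B same hagree hm hm' nf nf'.
have none (E : diagram R) (e : set 'rV[R]_3 -> X) g t :
    modeled E U V h' g rk sg eps -> (forall p, ~ three_sheets_meet g p) ->
    B t.1.1 -> colored_triple_points E e t <-> t \in [::].
  move=> hE ng [p p9 ep]; split => // tc; exfalso; apply: (ng p).
  exact: (modeled_preimages hh hE (BV _ p9) (esym ep) tc).
apply: (@move_homologous R K X T D D' c c' U V h h' hh BV same hagree [::] [::]) => //.
- by move=> t; apply: none hm nf.
- by move=> t; apply: none hm' nf'.
exists 0; rewrite boundary3_0 !big_nil !subr0; exact: degenerate_chain0.
Qed.

(** The moves from the side [t > 0] to the side [t < 0]; the opposite direction follows
    by symmetry. *)
Lemma move_homologous_true (D D' : diagram R) (c c' : set 'rV[R]_3 -> X)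
    (m : roseman) (beta : R^o -> R^o) (rk : {perm 'I_(nb_sheets m)}) sg eps
    (U V : set 'rV[R]_3) (h h' : 'rV[R]_3 -> 'rV[R]_3) :
  coloring T D c -> coloring T D' c' -> Defs.bump beta ->
  diffeo U V h h' -> [set q | dot q q <= 9] `<=` V ->
  let B := h' @` [set q : 'rV[R]_3 | dot q q <= 9] in
  (forall y, ~ B y -> same_diagram_at D D' y) ->
  (forall y : 'rV[R]_3, ~ B y -> ~ image3 D y -> c (region D y) = c' (region D' y)) ->
  modeled D U V h' (@side_sheet R beta m true) rk sg eps ->
  modeled D' U V h' (@side_sheet R beta m false) rk sg eps ->
  homologous T (diagram_chain K D c) (diagram_chain K D' c').
Proof.
case: hT => qT _ _ hc hc' hb hh BV B same hagree.
case: m rk eps => rk eps hm hm'.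
- apply: (no_triple_homologous hh BV same hagree hm hm') => p; apply: folded_sheet_fiber => j u;
    by rewrite /side_sheet !vec3E.
- apply: (no_triple_homologous hh BV same hagree hm hm') => p; apply: folded_sheet_fiber => j u;
    by rewrite /side_sheet !vec3E.
- apply: (no_triple_homologous hh BV same hagree hm hm') => p; apply: two_graphs_fiber;
    by case=> -[|[|//]] j2 u; rewrite /side_sheet /= !vec3E.
- apply: (no_triple_homologous hh BV same hagree hm hm') => p; apply: two_graphs_fiber;
    by case=> -[|[|//]] j2 u; rewrite /side_sheet /= !vec3E.
- exact: (pair_homologous hb K qT hc hh BV hm hm' same hagree).
- exact: (pass_homologous hb K qT hc hh BV hm hm' same hagree).
- exact: (tetra_homologous hb K hc hc' hh BV hm hm' same hagree).
Qed.

End Main.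

Theorem lemma4p12 (R : realType) (K : comNzRingType) (X : choiceType)
    (T : X -> X -> X -> X) (hT : KTQ T)
    (D D' : diagram R) (c c' : set 'rV[R]_3 -> X)
    (hc : coloring T D c) (hc' : coloring T D' c')
    (B : set 'rV[R]_3) (hmove : roseman_move D D' B)
    (hagree : forall y : 'rV[R]_3, ~ B y -> ~ image3 D y ->
       c (region D y) = c' (region D' y)) :
  homology_class T (diagram_chain K D c) =
  homology_class T (diagram_chain K D' c').
Proof.
case: hmove => m [side [beta [rk [sg [eps [U [V [h [h' [hb [hh [BV BE]] hm hm' same]]]]]]]]]].
rewrite BE in same hagree; apply: homologous_class; case: side hm hm' => hm hm'.
  exact: (move_homologous_true K hT hc hc' hb hh BV same hagree hm hm').
apply: homologous_sym.
apply: (move_homologous_true K hT hc' hc hb hh BV _ (hagree_sym same hagree) hm' hm).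
by move=> y /same; exact: same_diagram_sym.
Qed.
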